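(* Let $0<R'<R$, let $f$ be a non-constant meromorphic function in $D(0,R)=\{z\in\mathbb{C}:0<|z|<R\}$ with a singular point at the origin, of finite order $\sigma(f,0)=\sigma<\infty$, let $\varepsilon>0$ be a given constant, and let $k\in\mathbb{N}$ be a positive integer. Then the following two statements hold. (i) There exists a set $E_1^*\subset(0,R')$ of finite logarithmic measure, $\int_0^{R'}\frac{\chi_{E_1^*}(t)}{t}\,dt<\infty$, such that for all $z$ with $r=|z|\in(0,R')\setminus E_1^*$, $$\left|\frac{f^{(k)}(z)}{f(z)}\right|\le\frac{1}{r^{k(\sigma+1+\varepsilon)}}. \qquad ( * )$$ (ii) There exists a set $E_2^*\subset[0,2\pi)$ of linear measure zero such that for every $\theta\in[0,2\pi)\setminus E_2^*$ there exists a constant $r_0=r_0(\theta)>0$ such that $( * )$ holds for all $z$ satisfying $\arg z=\theta$ and $r=|z|<r_0$.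
   Context: For a meromorphic function $f$ in $D(0,R)=\{z\in\mathbb{C}:0<|z|<R\}$ and a fixed $R'$ with $0<R'<R$, put $$m_0(r,f)=\frac1{2\pi}\int_0^{2\pi}\ln^+|f(re^{i\varphi})|\,d\varphi,\qquad N_0(r,R',f)=\int_r^{R'}\frac{n(t,f)}{t}\,dt,$$ where $n(t,f)$ is the number of poles of $f$ in $\{z:t\le|z|\le R'\}$, counted with multiplicity, and $T_0(r,f)=T_0(r,R',f)=m_0(r,f)+N_0(r,R',f)$. The order of $f$ near $0$ is $$\sigma(f,0)=\sigma_T(f,0)=\limsup_{r\to0}\frac{\log^+T_0(r,f)}{-\log r},$$ which does not depend on the choice of $R'$. $\chi_E$ denotes the characteristic function of a set $E$. *)

(* Defs.v *)
From HB Require Import structures.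
From mathcomp Require Import all_boot all_order all_algebra.
From mathcomp Require Import complex.
From mathcomp Require Import all_classical all_reals all_analysis.
Set Implicit Arguments.
Unset Strict Implicit.
Unset Printing Implicit Defensive.
Import Order.TTheory GRing.Theory Num.Theory.
Import numFieldNormedType.Exports.
Import ComplexField.Normc.
Local Open Scope classical_set_scope.
Local Open Scope ring_scope.
Local Open Scope complex_scope.

(* Complex analysis is done over the numFieldType [R[i]]: the alias [R[i]^o]
   carries its topology and its normed module structure over itself, so that
   [derivable] and [derive1n] are complex derivatives. The modulus is the
   real-valued [normc]. *)

Definition punctured_disc {R : realType} (rho : R) : set R[i] :=
  [set z | 0 < normc z < rho].

Definition polar {R : realType} (r t : R) : R[i] := (r * cos t) +i* (r * sin t).

Definition holomorphic_at {R : realType} (f : R[i]^o -> R[i]^o) (z : R[i]^o) :=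
  \forall w \near z, derivable f w 1.

Definition pole {R : realType} (f : R[i]^o -> R[i]^o) (z : R[i]^o) :=
  (\forall w \near z^', derivable f w 1) /\
  normc (f w) @[w --> z^'] --> +oo.

(* A meromorphic function is a total function; its values at its poles are
   arbitrary, and no notion below depends on them. *)
Definition meromorphic_on {R : realType} (D : set R[i])
    (f : R[i]^o -> R[i]^o) :=
  forall z, D z -> holomorphic_at f z \/ pole f z.

Definition constant_on {R : realType} (D : set R[i]) (f : R[i]^o -> R[i]^o) :=
  exists c, forall z, D z -> f z = c.

(* Removable singularities are not singular points; poles, essential
   singularities and accumulation points of poles are. *)
Definition singular_point {R : realType} (f : R[i]^o -> R[i]^o) (a : R[i]^o) :=
  ~ exists2 g, holomorphic_at g a & \forall w \near a^', g w = f w.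

(* Order of the pole of f at z; 0 if z is not a pole. *)
Definition pole_mult {R : realType} (f : R[i]^o -> R[i]^o) (z : R[i]^o) : nat :=
  xget 0%N [set m : nat | (0 < m)%N /\
    exists2 l : R[i]^o, l != 0 &
      (w - z) ^+ m * f w @[w --> z^'] --> l].

Definition lnp {R : realType} (x : R) : R := Num.max 0 (ln x).

Definition lnpe {R : realType} (x : \bar R) : \bar R := maxe 0%E (lne x).

Definition m0 {R : realType} (r : R) (f : R[i]^o -> R[i]^o) : \bar R :=
  ((2 * pi)^-1%:E *
    \int[lebesgue_measure]_(t in `[0%R, (2 * pi)%R])
      (lnp (normc (f (polar r t))))%:E)%E.

Definition pole_count {R : realType} (t R' : R) (f : R[i]^o -> R[i]^o) : \bar R :=
  \esum_(z in [set z : R[i] | t <= normc z <= R' /\ pole f z])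
    ((pole_mult f z)%:R : R)%:E.

Definition N0 {R : realType} (r R' : R) (f : R[i]^o -> R[i]^o) : \bar R :=
  (\int[lebesgue_measure]_(t in `[r, R']) (pole_count t R' f * t^-1%:E))%E.

Definition T0 {R : realType} (r R' : R) (f : R[i]^o -> R[i]^o) : \bar R :=
  (m0 r f + N0 r R' f)%E.

Definition order_at0 {R : realType} (R' : R) (f : R[i]^o -> R[i]^o) : \bar R :=
  limf_esup (fun r : R => (lnpe (T0 r R' f) * (- ln r)^-1%:E)%E) 0^'+.

(* For meromorphic g, "g is finite at z and |g(z)| <= b". The value of g at z is
   taken to be its limit, as g may be given by an expression such as f^(k) / f
   that is not defined at z itself: removable singularities are filled in, and
   the bound fails at the poles of g. *)
Definition mero_norm_le {R : realType} (g : R[i]^o -> R[i]^o) (z : R[i]^o)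
    (b : R) :=
  exists2 l : R[i]^o, g w @[w --> z^'] --> l & normc l <= b.

Definition log_derivative_bound {R : realType} (f : R[i]^o -> R[i]^o)
    (k : nat) (sigma eps : R) (z : R[i]^o) :=
  mero_norm_le (fun w => derive1n k f w / f w) z
    (1 / (normc z `^ (k%:R * (sigma + 1 + eps)))).

(* Main.v *)
Require Import Defs.
From HB Require Import structures.
From mathcomp Require Import all_boot all_order all_algebra.
From mathcomp Require Import complex.
From mathcomp Require Import all_classical all_reals all_analysis.
From mathcomp Require Import measurable_realfun ring lra.
Import Order.TTheory GRing.Theory Num.Theory.
Import numFieldNormedType.Exports.
Import ComplexField.Normc.
Local Open Scope classical_set_scope.
Local Open Scope ring_scope.
Local Open Scope complex_scope.
Set Implicit Arguments.
Unset Strict Implicit.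
Unset Printing Implicit Defensive.
Local Notation Re := complex.Re.
Local Notation Im := complex.Im.

(** Write r = |z|.  Jensen's formula on the annulus s <= |z| <= t, together with
    T_0(s) <= s^-tau for tau > sigma, bounds by O(s^-tau) both the number of
    zeros and poles of f with |c| >= 2s and the mean of |ln|f|| on |z| = s.
    Near the circle of radius r write f = h * prod (z - a) / prod (z - b), with
    h holomorphic and zero-free on a thick annulus; the mean of |ln|h|| is then
    O(r^-tau ln(1/r)), and Cauchy's formula for z h'/h, with the derivatives of
    ln|h| integrated by parts, gives
      |f'/f| <= r^(-tau'-1) + sum_c 1/|z - c|,
    c running over the nearby zeros and poles.  A weak-type covering argument
    bounds the sum by a constant times r^(-tau''-1) off a small set of radii,
    resp. of angles.  These sets are summable over dyadic annuli, whence the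
    finite logarithmic measure, resp. measure zero by Borel-Cantelli.  Finally,
    where |f'/f| <= 2A on a disc of radius 1/(8A), |f| is at most twice its
    value at the centre, so iterated Cauchy estimates give
    |f^(k)/f| <= 2 (16 k A)^k. *)

(** * Modulus and complex derivatives *)

Section ComplexPlane.
Variable R : realType.
Local Notation C := (R[i]^o).
Implicit Types (z w : C) (f g : C -> C).

(** The puncture shapes the argument. On an annulus [h] has no single-valued logarithm, so only
    ln|h| and z h'/h occur; and as nothing is known at the origin itself, Jensen's formula carries
    an undetermined term c ln s + d, harmless because tau > 0 makes it O(s^-tau). The margin eps is
    spent in stages. T_0 is bounded with exponent sigma + eps/8; raising it to sigma + eps/4 absorbs
    the constants and the factor ln(1/r) in the number of zeros and poles and in h'/h; the sum of
    the 1/|z - c| is cut at height r^-(sigma + eps/2 + 1); the rest swallows the constants of the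
    k-th power. At scale r the bad radii then have measure O(r^(1 + eps/8)) and the bad angles
    O(r^(eps/8)), summable against dt/t and dt respectively. The two cases differ by a factor r
    because the distance from r e^(it) to c is at least r |sin(t - arg c)|. Passing from f'/f to
    f^(k)/f on small discs avoids any control of the zeros of the intermediate derivatives. *)

Lemma normcE z : `|z| = (normc z)%:C. Proof. by []. Qed.

Lemma normc_ge0 (z : R[i]) : 0 <= normc z.
Proof. by case: z => a b; exact: sqrtr_ge0. Qed.
Local Hint Resolve normc_ge0 : core.

Lemma scaleco (a b : C) : a *: b = a * b. Proof. by []. Qed.

Lemma normc_eq0 (z : R[i]) : (normc z == 0) = (z == 0).
Proof. by apply/eqP/eqP => [/eq0_normc//|->]; rewrite normc0. Qed.

Lemma normc_gt0 (z : R[i]) : (0 < normc z) = (z != 0).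
Proof. by rewrite lt_neqAle eq_sym normc_eq0 normc_ge0 andbT. Qed.

Lemma normcN (z : R[i]) : normc (- z) = normc z.
Proof. by apply: complexI; rewrite -!normcE normrN. Qed.

Lemma normcB (z w : R[i]) : normc (z - w) = normc (w - z).
Proof. by rewrite -normcN opprB. Qed.

Lemma ler_normcD (z w : R[i]) : normc (z + w) <= normc z + normc w.
Proof. by rewrite -lecR rmorphD/= -!normcE ler_normD. Qed.

Lemma ler_normcB (z w : R[i]) : normc (z - w) <= normc z + normc w.
Proof. by rewrite -(normcN w) ler_normcD. Qed.

Lemma lerB_normc (z w : R[i]) : normc z - normc w <= normc (z - w).
Proof. by rewrite lerBlDr; apply: le_trans (ler_normcD _ _); rewrite subrK. Qed.

Lemma normcX (z : R[i]) n : normc (z ^+ n) = normc z ^+ n.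
Proof. by elim: n => [|n IH]; rewrite ?expr0 ?normc1// !exprS normcM IH. Qed.

Lemma ler_normc_sum I (s : seq I) (F : I -> R[i]) :
  normc (\sum_(i <- s) F i) <= \sum_(i <- s) normc (F i).
Proof.
elim/big_ind2: _ => [|x a y b xa yb|//]; first by rewrite normc0.
exact: le_trans (ler_normcD _ _) (lerD xa yb).
Qed.

Lemma normc_real (x : R) : normc x%:C = `|x|.
Proof. by rewrite /normc /= expr0n/= addr0 sqrtr_sqr. Qed.

Lemma ler_Re_normc (z : R[i]) : `|Re z| <= normc z.
Proof.
case: z => a b /=; rewrite -sqrtr_sqr; apply: ler_wsqrtr.
by rewrite lerDl sqr_ge0.
Qed.

Lemma ler_Im_normc (z : R[i]) : `|Im z| <= normc z.
Proof.
case: z => a b /=; rewrite -sqrtr_sqr; apply: ler_wsqrtr.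
by rewrite lerDr sqr_ge0.
Qed.

Lemma ler_normc_ReIm (z : R[i]) : normc z <= `|Re z| + `|Im z|.
Proof.
case: z => a b /=; rewrite -[leRHS]ger0_norm ?addr_ge0// -sqrtr_sqr.
apply: ler_wsqrtr; rewrite sqrrD !real_normK ?num_real//.
have := mulr_ge0 (normr_ge0 a) (normr_ge0 b); lra.
Qed.

(** Norms in [C] are themselves complex, and so are radii; a positive complex number has zero
    imaginary part, so its real part serves as a radius and estimates can be made in [R]. *)
Lemma nbhs_normcP z (P : set C) :
  nbhs z P <-> exists2 d : R, 0 < d & forall w, normc (w - z) < d -> P w.
Proof.
split=> [/nbhs_ballP[[e e'] /= /[!ltcE]/= /andP[/eqP -> e0] zP]|[d d0 zP]].
  by exists e => // w wz; apply: zP; rewrite /ball/= normcE ltcR normcB.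
apply/nbhs_ballP; exists d%:C => /=; first by rewrite ltcR.
by move=> w; rewrite /ball/= normcE ltcR normcB; exact: zP.
Qed.

Lemma dnbhs_normcP z (P : set C) :
  (\forall w \near z^', P w) <->
  exists2 d : R, 0 < d & forall w, w != z -> normc (w - z) < d -> P w.
Proof.
split => [/nbhs_normcP[d d0 zP]|[d d0 zP]].
  by exists d => // w wz /zP; exact.
by apply/nbhs_normcP; exists d => // w wd wz; exact: zP.
Qed.

Lemma cvgc_normP T (F : set_system T) (FF : Filter F) (f : T -> C) (l : C) :
  f @ F --> l <-> forall e : R, 0 < e -> \forall x \near F, normc (f x - l) < e.
Proof.
split=> [/cvgrPdist_lt fl e e0|fl].
  have := fl e%:C; rewrite ltcR => /(_ e0); apply: filterS => x.
  by rewrite normcE ltcR normcB.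
apply/cvgrPdist_lt => -[e e'] /[!ltcE]/= /andP[/eqP -> /fl].
by apply: filterS => x; rewrite normcE ltcR normcB.
Qed.

Lemma cvg_dnbhs_normcP f z (l : C) :
  f w @[w --> z^'] --> l <-> forall e : R, 0 < e ->
    exists2 d : R, 0 < d &
      forall w, w != z -> normc (w - z) < d -> normc (f w - l) < e.
Proof.
have H := @cvgc_normP _ (z^') _ f l; split=> [/H fl e e0|fl]; first exact/dnbhs_normcP/fl.
by apply/H => e e0; exact/dnbhs_normcP/fl.
Qed.

Lemma contc_normP f z : {for z, continuous f} <-> forall e : R, 0 < e ->
    exists2 d : R, 0 < d & forall w, normc (w - z) < d -> normc (f w - f z) < e.
Proof.
have H := @cvgc_normP _ (nbhs z) _ f (f z); split=> [/H fl e e0|fl].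
  exact/nbhs_normcP/fl.
by apply/H => e e0; exact/nbhs_normcP/fl.
Qed.

(** The division-free form makes sense at [w = z] and turns the differentiation of composites and
    parameter integrals into the estimate of a remainder. *)
Lemma is_derivecP f z (l : C) : is_derive z 1 f l <->
  forall e : R, 0 < e -> exists2 d : R, 0 < d & forall w, normc (w - z) < d ->
    normc (f w - f z - l * (w - z)) <= e * normc (w - z).
Proof.
have key : (h^-1 *: (f (h *: (1 : C) + z) - f z) @[h --> (0 : C)^'] --> l) <->
  forall e : R, 0 < e -> exists2 d : R, 0 < d & forall w, normc (w - z) < d ->
    normc (f w - f z - l * (w - z)) <= e * normc (w - z).
  rewrite cvg_dnbhs_normcP; split => H e e0; last first.
    (* Half of [e], because the remainder bound is not strict while the limit asks for a strict
       inequality. *)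
    have [|d d0 dP] := H (e / 2); first by rewrite divr_gt0.
    exists d => // h h0; rewrite subr0 => hd.
    have := dP (h + z); rewrite addrK => /(_ hd) fh.
    have -> : h^-1 *: (f (h *: (1:C) + z) - f z) - l = h^-1 * (f (h + z) - f z - l * h).
      rewrite !scaleco [h * 1]mulr1 [RHS]mulrBr [l * h]mulrC mulrA mulVf ?mul1r//.
    rewrite normcM normcV ltr_pdivrMl ?normc_gt0// (le_lt_trans fh)//.
    by rewrite mulrC ltr_pM2l ?normc_gt0// ltr_pdivrMr// ltr_pMr// ltr1n.
  have [d d0 dP] := H e e0; exists d => // w wd.
  have [->|wz] := eqVneq w z; first by rewrite !subrr mulr0 subr0 normc0 mulr0.
  have h0 : w - z != 0 by rewrite subr_eq0.
  have := dP (w - z) h0; rewrite subr0 => /(_ wd).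
  have -> : (w - z)^-1 *: (f ((w - z) *: (1:C) + z) - f z) - l = (w - z)^-1 * (f w - f z - l * (w - z)).
    rewrite !scaleco [_ * (1 : C)]mulr1 subrK [RHS]mulrBr [l * _]mulrC mulrA mulVf ?mul1r//.
  rewrite normcM normcV => /ltW.
  by rewrite ler_pdivrMl ?normc_gt0// [e * _]mulrC.
rewrite -key; split => [[df <-]|fl]; first exact: df.
have df : derivable f z 1 by apply/cvg_ex; exists l.
by split; [exact: df|apply: cvg_lim; [exact: norm_hausdorff|exact: fl]].
Qed.

Lemma derivablec f z : derivable f z 1 <-> exists l, is_derive z 1 f l.
Proof.
by split=> [fz|[l [fz _]]//]; exists ('D_1 f z); exact/derivableP.
Qed.

Lemma derivablec_continuous f z : derivable f z 1 -> {for z, continuous f}.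
Proof. by move=> /derivable1_diffP/differentiable_continuous. Qed.


Lemma is_derivecB f g z (a b : C) : is_derive z 1 f a -> is_derive z 1 g b ->
  is_derive z 1 (fun w => f w - g w) (a - b).
Proof. exact: is_deriveB. Qed.

Lemma is_derivecM f g z (a b : C) : is_derive z 1 f a -> is_derive z 1 g b ->
  is_derive z 1 (fun w => f w * g w) (a * g z + f z * b).
Proof.
move=> fa gb; rewrite addrC [a * _]mulrC; exact: (is_deriveM fa gb).
Qed.

Lemma is_derivecV f z (a : C) : f z != 0 -> is_derive z 1 f a ->
  is_derive z 1 (fun w => (f w)^-1) (- a / f z ^+ 2).
Proof.
move=> fz0 fa; apply: DeriveDef; first exact: derivableV.
by rewrite deriveV//= derive_val scaleco mulrC mulrN mulNr.
Qed.

Lemma is_derivecX f n z (a : C) : is_derive z 1 f a ->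
  is_derive z 1 (fun w => f w ^+ n) (n%:R * a * f z ^+ n.-1).
Proof.
move=> fa; elim: n => [|n IH].
  under eq_fun do rewrite expr0; rewrite !mul0r; exact: is_derive_cst.
under eq_fun do rewrite exprS.
rewrite [X in is_derive _ _ _ X](_ : _ = a * f z ^+ n + f z * (n%:R * a * f z ^+ n.-1)); first exact: is_derivecM fa IH.
case: n {IH} => [|n] /=; first by rewrite !mul0r mulr0 addr0 mul1r.
rewrite exprS; ring.
Qed.

Lemma is_derivec_shift z w : is_derive w 1 (fun u : C => u - z) 1.
Proof.
rewrite -[X in is_derive _ _ _ X]subr0.
exact: is_derivecB (is_derive_id _ _) (is_derive_cst _ _ _).
Qed.

Lemma is_derivec_near f g z (a : C) :
  (\forall w \near z, f w = g w) -> is_derive z 1 f a -> is_derive z 1 g a.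
Proof.
move=> /nbhs_normcP[d d0 fg] /is_derivecP fa; apply/is_derivecP => e /fa[d1 d10 P].
exists (Num.min d d1); first by rewrite lt_min d0.
move=> w; rewrite lt_min => /andP[wd wd1]; rewrite -!fg//; first exact: P.
by rewrite subrr normc0.
Qed.

End ComplexPlane.
#[global] Hint Extern 0 (is_true (@Order.le _ _ _ (normc _))) => exact: normc_ge0 : core.

(** * Integrals of real and complex valued functions *)

Section Integral.
Variable R : realType.
Local Notation C := (R[i]^o).
Local Notation mu := (@lebesgue_measure R).
Implicit Types (a b c M : R) (g h : R -> R).

Definition rint a b g : R := \int[mu]_(x in `[a, b]) g x.

Lemma cont_within a b g : {in `[a, b], continuous g} -> {within `[a, b], continuous g}.
Proof. by move=> cg; apply: continuous_in_subspaceT => x /[!inE]; exact: cg. Qed.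

Lemma cont_integrable a b g : {in `[a, b], continuous g} ->
  mu.-integrable `[a, b] (EFin \o g).
Proof.
move=> cg; apply: continuous_compact_integrable; first exact: segment_compact.
exact: cont_within.
Qed.

Lemma eq_rint a b g h : (forall x, a <= x <= b -> g x = h x) ->
  rint a b g = rint a b h.
Proof.
by move=> gh; apply: eq_Rintegral => x; rewrite inE/= in_itv/=; exact: gh.
Qed.

Lemma rint_cst a b M : a <= b -> rint a b (fun=> M) = M * (b - a).
Proof.
move=> ab; rewrite /rint Rintegral_cst//= lebesgue_measure_itv/= lte_fin.
by case: ltgtP ab => //= ->; rewrite subrr mulr0.
Qed.

Lemma rintD a b g h : {in `[a, b], continuous g} -> {in `[a, b], continuous h} ->
  rint a b (fun x => g x + h x) = rint a b g + rint a b h.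
Proof. by move=> cg ch; rewrite /rint RintegralD//; exact: cont_integrable. Qed.

Lemma rintB a b g h : {in `[a, b], continuous g} -> {in `[a, b], continuous h} ->
  rint a b (fun x => g x - h x) = rint a b g - rint a b h.
Proof. by move=> cg ch; rewrite /rint RintegralB//; exact: cont_integrable. Qed.

Lemma rintZl a b c g : {in `[a, b], continuous g} ->
  rint a b (fun x => c * g x) = c * rint a b g.
Proof. by move=> cg; rewrite /rint RintegralZl//; exact: cont_integrable. Qed.

Lemma le_rint a b g h : {in `[a, b], continuous g} -> {in `[a, b], continuous h} ->
  (forall x, a <= x <= b -> g x <= h x) -> rint a b g <= rint a b h.
Proof.
move=> cg ch gh; have [ig ih] := (cont_integrable cg, cont_integrable ch).
apply: le_Rintegral => //.
Qed.

Lemma cst_continuousP a b c : {in `[a, b], continuous (fun _ : R => c)}.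
Proof. by move=> x _; exact: cvg_cst. Qed.

Lemma rint_ler a b g M : a <= b -> {in `[a, b], continuous g} ->
  (forall x, a <= x <= b -> g x <= M) -> rint a b g <= M * (b - a).
Proof.
move=> ab cg gM; rewrite -rint_cst//.
by apply: le_rint => //; exact: cst_continuousP.
Qed.

Lemma rint_norm a b g M : a <= b -> {in `[a, b], continuous g} ->
  (forall x, a <= x <= b -> `|g x| <= M) -> `|rint a b g| <= M * (b - a).
Proof.
move=> ab cg gM; rewrite ler_norml; apply/andP; split.
  rewrite -mulNr -rint_cst//; apply: le_rint => //; first exact: cst_continuousP.
  by move=> x /gM; rewrite ler_norml => /andP[].
by apply: rint_ler => // x /gM; rewrite ler_norml => /andP[].
Qed.

Lemma rint_split a b c g : a <= c -> c <= b -> {in `[a, b], continuous g} ->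
  rint a b g = rint a c g + rint c b g.
Proof.
move=> ac cb cg; have ig := cont_integrable cg.
have /= := @Rintegral_itvB _ g (BLeft a) (BRight b) c ig.
rewrite !bnd_simp => /(_ ac cb); rewrite /rint => /eqP; rewrite subr_eq => /eqP ->.
rewrite addrC; congr (_ + _); apply: Rintegral_itv_obnd_cbnd.
apply: integrableS ig => //; by move=> x; rewrite /= !in_itv/= => /andP[/ltW/(le_trans ac) -> ->].
Qed.

Lemma rint_FTC a b g h : a <= b ->
  (forall x, a <= x <= b -> is_derive x 1 h (g x)) ->
  {in `[a, b], continuous g} -> rint a b g = h b - h a.
Proof.
rewrite le_eqVlt => /predU1P[<-|ab] dh cg.
  by rewrite /rint set_itv1 Rintegral_set1 subrr.
have ch x : a <= x <= b -> {for x, continuous h}.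
  move=> /dh [+ _]; move=> /derivable1_diffP; exact: differentiable_continuous.
rewrite /rint /Rintegral (@continuous_FTC2 _ g h)//.
- exact: cont_within.
- split.
  + by move=> x; rewrite in_itv/= => /andP[/ltW ax /ltW xb]; have [] := dh x; rewrite ?ax.
  + by apply: cvg_at_right_filter; apply: ch; rewrite lexx ltW.
  + by apply: cvg_at_left_filter; apply: ch; rewrite lexx ltW.
- move=> x; rewrite in_itv/= => /andP[/ltW ax /ltW xb]; rewrite derive1E.
  by have [] := dh x; rewrite ?ax.
Qed.

End Integral.

Section ComplexIntegral.
Variable R : realType.
Local Notation C := (R[i]^o).
Implicit Types (a b M : R) (f g : R -> C).

Lemma contcR (g : C -> R) (z : C) : (forall e : R, 0 < e ->
    exists2 d : R, 0 < d & forall w, normc (w - z) < d -> `|g z - g w| < e) ->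
  {for z, continuous g}.
Proof.
by move=> gz; apply/(@cvgrPdist_lt _ _ _ (nbhs z)) => e e0; exact/nbhs_normcP/gz.
Qed.

Lemma continuousRe : continuous (@complex.Re R : C -> R).
Proof.
move=> z; apply: contcR => e e0; exists e => // w.
move=> /(le_lt_trans _); apply; rewrite normcB; apply: le_trans (ler_Re_normc _).
by case: z w => [? ?] [? ?].
Qed.

Lemma continuousIm : continuous (@complex.Im R : C -> R).
Proof.
move=> z; apply: contcR => e e0; exists e => // w.
move=> /(le_lt_trans _); apply; rewrite normcB; apply: le_trans (ler_Im_normc _).
by case: z w => [? ?] [? ?].
Qed.

Lemma continuous_normc : continuous (@normc R : C -> R).
Proof.
move=> z; apply: contcR => e e0; exists e => // w.
move=> /(le_lt_trans _); apply; rewrite ler_norml normcB lerB_normc.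
by rewrite lerNl opprB normcB lerB_normc.
Qed.

Lemma continuous_complex (g h : R -> R) x :
  {for x, continuous g} -> {for x, continuous h} ->
  {for x, continuous (fun t => g t +i* h t : C)}.
Proof.
move=> cg ch; apply/cvgc_normP => e e0.
have e2 : 0 < e / 2 by rewrite divr_gt0.
move: cg ch => /cvgrPdist_lt/(_ _ e2) + /cvgrPdist_lt/(_ _ e2).
apply: filterS2 => t; rewrite distrC => gt; rewrite distrC => ht.
apply: le_lt_trans (ler_normc_ReIm _) _; simpc => /=.
by rewrite (splitr e) ltrD.
Qed.

Definition cint a b f : C :=
  rint a b (fun x => Re (f x)) +i* rint a b (fun x => Im (f x)).

Lemma cont_Re a b f : {in `[a, b], continuous f} ->
  {in `[a, b], continuous (fun x => Re (f x))}.
Proof.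
move=> cf x xab; apply: (@continuous_comp _ _ _ f); first exact: cf.
exact: continuousRe.
Qed.

Lemma cont_Im a b f : {in `[a, b], continuous f} ->
  {in `[a, b], continuous (fun x => Im (f x))}.
Proof.
move=> cf x xab; apply: (@continuous_comp _ _ _ f); first exact: cf.
exact: continuousIm.
Qed.

Lemma eq_cint a b f g : (forall x, a <= x <= b -> f x = g x) ->
  cint a b f = cint a b g.
Proof. by move=> fg; congr (_ +i* _); apply: eq_rint => x /fg ->. Qed.

Lemma cintD a b f g : {in `[a, b], continuous f} -> {in `[a, b], continuous g} ->
  cint a b (fun x => f x + g x) = cint a b f + cint a b g.
Proof.
move=> cf cg; rewrite /cint; simpc.
rewrite -rintD; [|exact: cont_Re..]; rewrite -rintD; [|exact: cont_Im..].
by congr (_ +i* _); apply: eq_rint => x _; case: (f x) (g x) => ? ? [? ?].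
Qed.

Lemma cintB a b f g : {in `[a, b], continuous f} -> {in `[a, b], continuous g} ->
  cint a b (fun x => f x - g x) = cint a b f - cint a b g.
Proof.
move=> cf cg; rewrite /cint; simpc.
rewrite -rintB; [|exact: cont_Re..]; rewrite -rintB; [|exact: cont_Im..].
by congr (_ +i* _); apply: eq_rint => x _; case: (f x) (g x) => ? ? [? ?].
Qed.

Lemma cont_rZl a b (k : R) (g : R -> R) : {in `[a, b], continuous g} ->
  {in `[a, b], continuous (fun x => k * g x)}.
Proof. by move=> cg x xab; apply: cvgM; [exact: cvg_cst|exact: cg]. Qed.

Lemma cintZ a b (k : C) f : {in `[a, b], continuous f} ->
  cint a b (fun x => k * f x) = k * cint a b f.
Proof.
move=> cf; have cr := cont_Re cf; have ci := cont_Im cf.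
case: k => k1 k2; rewrite /cint; simpc.
rewrite -!rintZl// -rintB; [|exact: cont_rZl..].
rewrite -rintD; [|exact: cont_rZl..].
by congr (_ +i* _); apply: eq_rint => x _; case: (f x) => ? ?.
Qed.

Lemma cint_cst a b (k : C) : a <= b -> cint a b (fun=> k) = k * (b - a)%:C.
Proof. by move=> ab; rewrite /cint !rint_cst//; case: k => k1 k2; simpc. Qed.

Lemma cint_split a b c f : a <= c -> c <= b -> {in `[a, b], continuous f} ->
  cint a b f = cint a c f + cint c b f.
Proof.
move=> ac cb cf; rewrite /cint (rint_split ac cb (cont_Re cf)).
by rewrite (rint_split ac cb (cont_Im cf)).
Qed.

(* The factor [2] comes from bounding real and imaginary parts separately. *)
Lemma cint_norm a b f M : a <= b -> {in `[a, b], continuous f} ->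
  (forall x, a <= x <= b -> normc (f x) <= M) ->
  normc (cint a b f) <= 2 * M * (b - a).
Proof.
move=> ab cf fM; apply: le_trans (ler_normc_ReIm _) _ => /=.
rewrite -mulrA mulr_natl mulr2n; apply: lerD; apply: rint_norm => //.
- exact: cont_Re.
- by move=> x /fM; apply: le_trans; exact: ler_Re_normc.
- exact: cont_Im.
- by move=> x /fM; apply: le_trans; exact: ler_Im_normc.
Qed.

Lemma cint_FTC a b (g1 g2 h1 h2 : R -> R) : a <= b ->
  (forall x, a <= x <= b -> is_derive x 1 h1 (g1 x)) ->
  (forall x, a <= x <= b -> is_derive x 1 h2 (g2 x)) ->
  {in `[a, b], continuous g1} -> {in `[a, b], continuous g2} ->
  cint a b (fun x => g1 x +i* g2 x) = (h1 b +i* h2 b : C) - (h1 a +i* h2 a).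
Proof.
by move=> ab d1 d2 c1 c2; rewrite /cint/= (rint_FTC ab d1 c1) (rint_FTC ab d2 c2); simpc.
Qed.

Lemma continuous_RC (g : R -> R) x : {for x, continuous g} ->
  {for x, continuous (fun t => (g t)%:C : C)}.
Proof. by move=> cg; apply: continuous_complex => //; exact: cvg_cst. Qed.

Lemma cont_cD f g x : {for x, continuous f} -> {for x, continuous g} ->
  {for x, continuous (fun t => f t + g t)}.
Proof. by move=> cf cg; apply: cvgD; [exact: cf|exact: cg]. Qed.

Lemma cont_cB f g x : {for x, continuous f} -> {for x, continuous g} ->
  {for x, continuous (fun t => f t - g t)}.
Proof. by move=> cf cg; apply: cvgB; [exact: cf|exact: cg]. Qed.

Lemma cont_cM f g x : {for x, continuous f} -> {for x, continuous g} ->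
  {for x, continuous (fun t => f t * g t)}.
Proof. by move=> cf cg; apply: (@cvgM C); [exact: cf|exact: cg]. Qed.

Lemma cont_cV f x : f x != 0 -> {for x, continuous f} ->
  {for x, continuous (fun t => (f t)^-1)}.
Proof. by move=> f0 cf; apply: (@cvgV C) => //; exact: cf. Qed.

Lemma cont_cX f n x : {for x, continuous f} -> {for x, continuous (fun t => f t ^+ n)}.
Proof.
move=> cf; elim: n => [|n IH]; first exact: cvg_cst.
rewrite /prop_for /continuous_at exprS; under eq_fun do rewrite exprS.
exact: cont_cM.
Qed.

Lemma cont_comp (h : C -> C) f x : {for f x, continuous h} ->
  {for x, continuous f} -> {for x, continuous (fun t => h (f t))}.
Proof. by move=> ch cf; exact: (continuous_comp cf ch). Qed.

End ComplexIntegral.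

(** * Cauchy's formula *)

Section Bisection.
Variable R : realType.
Implicit Types (N : R -> R -> R -> R -> R).

Lemma half_exp_lt (L d : R) : 0 < d -> exists n, L / 2 ^+ n < d.
Proof.
move=> d0; have L1 : 0 < d / (`|L| + 1) by rewrite divr_gt0// ltr_pwDr.
have [n Ln] := ltr_add_invr L1.
exists n; rewrite add0r in Ln.
have n1 : (n.+1%:R : R) <= 2 ^+ n by rewrite -natrX ler_nat ltn_expl.
have : L / 2 ^+ n <= (`|L| + 1) / n.+1%:R.
  rewrite ler_pdivrMr ?exprn_gt0// mulrAC ler_pdivlMr ?ltr0n//.
  apply: le_trans (ler_wpM2r _ (ler_norm L)) _ => //.
  apply: ler_pM => //; first by rewrite lerDl.
move=> /le_lt_trans; apply.
by move: Ln; rewrite ltr_pdivlMr ?ltr_pwDr// mulrC.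
Qed.

(** The point may lie anywhere in the rectangle, since nested rectangles merely contain their limit
    point. *)
Definition locally_small_rect N x1 x2 y1 y2 := forall p q, x1 <= p <= x2 -> y1 <= q <= y2 ->
  forall e, 0 < e -> exists2 del, 0 < del & forall a b c d,
    x1 <= a -> a <= p -> p <= b -> b <= x2 -> y1 <= c -> c <= q -> q <= d -> d <= y2 ->
    b - a < del -> d - c < del ->
    N a b c d <= e * ((b - a) + (d - c)) ^+ 2.

(** Goursat's subdivision for an arbitrary subadditive function of rectangles. If the value were
    positive, some quarter would keep at least a fourth of it; after n steps this is N / 4^n,
    whereas local smallness at the limit point allows only e (L / 2^n)^2. *)
Lemma bisection N x1 x2 y1 y2 : x1 <= x2 -> y1 <= y2 ->
  (forall a b c d, x1 <= a -> a <= b -> b <= x2 -> y1 <= c -> c <= d -> d <= y2 ->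
  N a b c d <= N a ((a + b) / 2) c ((c + d) / 2) + N ((a + b) / 2) b c ((c + d) / 2)
    + N a ((a + b) / 2) ((c + d) / 2) d + N ((a + b) / 2) b ((c + d) / 2) d) ->
  locally_small_rect N x1 x2 y1 y2 -> N x1 x2 y1 y2 <= 0.
Proof.
move=> x12 y12 sN lN; rewrite leNgt; apply/negP => N0.
pose wf (q : R * R * R * R) := let: (a, b, c, d) := q in
  [/\ x1 <= a, a <= b, b <= x2, y1 <= c & (c <= d /\ d <= y2)].
(* The implication from [wf q] makes the choice of a quarter total, hence iterable. *)
pose rel (q q' : R * R * R * R) := let: (a, b, c, d) := q in let: (a', b', c', d') := q' in
  wf q -> wf q' /\ [/\ a <= a', b' <= b, c <= c', d' <= d &
    [/\ b' - a' = (b - a) / 2, d' - c' = (d - c) / 2 & N a b c d / 4 <= N a' b' c' d']].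
have step q : {q' | rel q q'}.
  apply: cid; case: q => [[[a b] c] d].
  have [[x1a ab bx2 y1c [cd dy2]]|nwf] := pselect (wf (a, b, c, d)); last by exists (a, b, c, d).
  have := sN a b c d x1a ab bx2 y1c cd dy2.
  have [h1|h1] := leP (N a b c d / 4) (N a ((a + b) / 2) c ((c + d) / 2)).
    by move=> _; exists (a, (a + b) / 2, c, (c + d) / 2) => _; do !split; lra.
  have [h2|h2] := leP (N a b c d / 4) (N ((a + b) / 2) b c ((c + d) / 2)).
    by move=> _; exists ((a + b) / 2, b, c, (c + d) / 2) => _; do !split; lra.
  have [h3|h3] := leP (N a b c d / 4) (N a ((a + b) / 2) ((c + d) / 2) d).
    by move=> _; exists (a, (a + b) / 2, (c + d) / 2, d) => _; do !split; lra.
  by move=> h; exists ((a + b) / 2, b, (c + d) / 2, d) => _; do !split; lra.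
pose s n := iter n (fun q => sval (step q)) (x1, x2, y1, y2).
pose A n := (s n).1.1.1; pose B n := (s n).1.1.2; pose Cc n := (s n).1.2; pose D n := (s n).2.
have sE n : s n = (A n, B n, Cc n, D n) by rewrite /A /B /Cc /D; case: (s n) => [[[]]].
have srel n : rel (A n, B n, Cc n, D n) (A n.+1, B n.+1, Cc n.+1, D n.+1).
  by rewrite -!sE /s iterS; exact: svalP.
have swf n : wf (A n, B n, Cc n, D n).
  elim: n => [|n IH]; last by have [] := srel n IH.
  by rewrite /A /B /Cc /D /=; do !split.
have {}srel n := (srel n (swf n)).2.
have Amono n m : (n <= m)%N -> A n <= A m.
  by move=> nm; apply: (homo_leq (@lexx _ _) (@le_trans _ _) _ nm) => i; have [] := srel i.
have Bmono n m : (n <= m)%N -> B m <= B n.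
  by move=> /subnK <-; elim: (m - n)%N => // k; rewrite addSn; apply: le_trans; have [] := srel (k + n)%N.
have Cmono n m : (n <= m)%N -> Cc n <= Cc m.
  by move=> nm; apply: (homo_leq (@lexx _ _) (@le_trans _ _) _ nm) => i; have [] := srel i.
have Dmono n m : (n <= m)%N -> D m <= D n.
  by move=> /subnK <-; elim: (m - n)%N => // k; rewrite addSn; apply: le_trans; have [] := srel (k + n)%N.
have AB n m : A n <= B m.
  apply: (le_trans (Amono _ _ (leq_maxl n m))); apply: le_trans (Bmono _ _ (leq_maxr n m)).
  by have [] := swf (maxn n m).
have CD n m : Cc n <= D m.
  apply: (le_trans (Cmono _ _ (leq_maxl n m))); apply: le_trans (Dmono _ _ (leq_maxr n m)).
  by have [_ _ _ _ []] := swf (maxn n m).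
pose p := sup (range A); pose q := sup (range Cc).
have Ap n : A n <= p.
  by apply: ub_le_sup; [exists x2 => _ [k _ <-]; exact: (AB k 0%N)|exists n].
have pB n : p <= B n.
  by apply: ge_sup; [exists (A 0%N); exists 0%N|move=> _ [k _ <-]].
have Cq n : Cc n <= q.
  by apply: ub_le_sup; [exists y2 => _ [k _ <-]; exact: (CD k 0%N)|exists n].
have qD n : q <= D n.
  by apply: ge_sup; [exists (Cc 0%N); exists 0%N|move=> _ [k _ <-]].
have dX n : B n - A n = (x2 - x1) / 2 ^+ n.
  elim: n => [|n IH]; first by rewrite expr0 divr1.
  by have [_ _ _ _ [-> _ _]] := srel n; rewrite IH exprSr invfM mulrA.
have dY n : D n - Cc n = (y2 - y1) / 2 ^+ n.
  elim: n => [|n IH]; first by rewrite expr0 divr1.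
  by have [_ _ _ _ [_ -> _]] := srel n; rewrite IH exprSr invfM mulrA.
have NN n : N x1 x2 y1 y2 / 4 ^+ n <= N (A n) (B n) (Cc n) (D n).
  elim: n => [|n IH]; first by rewrite expr0 divr1.
  have [_ _ _ _ [_ _]] := srel n; apply: le_trans.
  by rewrite exprSr invfM mulrA ler_pM2r.
set L := (x2 - x1) + (y2 - y1).
have L0 : 0 <= L by rewrite addr_ge0// subr_ge0.
(* Chosen so that e L^2 < N; the summand 1 keeps the denominator positive when L = 0. *)
set e := N x1 x2 y1 y2 / (2 * (L ^+ 2 + 1)).
have L21 : 0 < L ^+ 2 + 1 by rewrite ltr_wpDl// sqr_ge0.
have e0 : 0 < e by rewrite divr_gt0// mulr_gt0.
have [|//|del del0 Hdel] := lN p q _ _ e e0.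
  by rewrite (Ap 0%N) (pB 0%N).
  by rewrite (Cq 0%N) (qD 0%N).
have [n Ln] := half_exp_lt L del0.
have pow0 : 0 < (2 : R) ^+ n by rewrite exprn_gt0.
have [w1 w2 w3 w4 [w5 w6]] := swf n.
have := Hdel (A n) (B n) (Cc n) (D n) w1 (Ap n) (pB n) w3 w4 (Cq n) (qD n) w6.
rewrite dX dY => /(_ _ _)/le_trans-/(_ _ _).
have i1 : (x2 - x1) / 2 ^+ n < del.
  by apply: le_lt_trans Ln; rewrite ler_pM2r ?invr_gt0// lerDl subr_ge0.
have i2 : (y2 - y1) / 2 ^+ n < del.
  by apply: le_lt_trans Ln; rewrite ler_pM2r ?invr_gt0// lerDr subr_ge0.
move=> /(_ _ i1 i2) H.
have {H} : N x1 x2 y1 y2 / 4 ^+ n <= e * (L / 2 ^+ n) ^+ 2.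
  by apply: (le_trans (NN n)); rewrite /L mulrDl; exact: H.
apply/negP; rewrite -ltNge exprMn exprVn -exprM mulnC exprM -[2 ^+ 2]/(2 * 2 : R) -natrM mulrA.
rewrite ltr_pM2r ?invr_gt0 ?exprn_gt0//.
have eE : e * (2 * (L ^+ 2 + 1)) = N x1 x2 y1 y2 by rewrite /e divfK ?gt_eqF ?mulr_gt0.
have := mulr_ge0 (ltW e0) (sqr_ge0 L); rewrite -eE; lra.
Qed.

End Bisection.

(** * Invariance of circle integrals under dilation *)

Section Goursat.
Variable R : realType.
Local Notation C := (R[i]^o).

Definition cis (x : R) : C := cos x +i* sin x.

Lemma polarE (r x : R) : polar r x = r%:C * cis x.
Proof. by rewrite /polar /cis; simpc. Qed.

Lemma normc_cis x : normc (cis x) = 1.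
Proof. by rewrite /normc/= cos2Dsin2 sqrtr1. Qed.

Lemma cis_neq0 x : cis x != 0.
Proof. by rewrite -normc_eq0 normc_cis oner_neq0. Qed.

Lemma cis2pi : cis (2 * pi) = cis 0.
Proof. by rewrite /cis mulr_natl cos2pi sin2pi cos0 sin0. Qed.

Lemma continuous_cis : continuous cis.
Proof.
by move=> x; apply: continuous_complex; [exact: continuous_cos|exact: continuous_sin].
Qed.

Lemma MVT_lipschitz (g dg : R -> R) (M : R) (a b : R) :
  (forall x, Num.min a b <= x <= Num.max a b -> is_derive x 1 g (dg x)) ->
  (forall x, Num.min a b <= x <= Num.max a b -> `|dg x| <= M) ->
  `|g b - g a| <= M * `|b - a|.
Proof.
wlog ab : a b / a <= b => [H|].
  have /orP[/H//|ba] := le_total a b.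
  by rewrite minC maxC distrC [`|b - a|]distrC; exact: H.
rewrite (min_idPl ab) (max_idPr ab) => dg1 dgM.
have [||c cab ->] := @MVT_segment R g dg a b ab _ (cont_within _).
- by move=> x; rewrite in_itv/= => /andP[/ltW ? /ltW ?]; apply: dg1; apply/andP.
- move=> x; rewrite in_itv/= => /dg1[+ _].
  by move=> /derivable1_diffP; exact: differentiable_continuous.
by rewrite normrM ler_wpM2r//; apply: dgM; rewrite in_itv in cab.
Qed.

Lemma cis_lipschitz x y : normc (cis x - cis y) <= 2 * `|x - y|.
Proof.
apply: le_trans (ler_normc_ReIm _) _; rewrite mulrDl mul1r lerD//=.
- rewrite -[leRHS]mul1r; apply: (@MVT_lipschitz (@cos R) (fun t => - sin t)) => t _.
  by rewrite normrN sin_max.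
- rewrite -[leRHS]mul1r; apply: (@MVT_lipschitz (@sin R) (@cos R)) => t _.
  exact: cos_max.
Qed.

Lemma cint_cis a b : a <= b -> cint a b cis = - 'i * (cis b - cis a).
Proof.
move=> ab; have dN (x : R) : is_derive x 1 (fun t : R => - cos t) (sin x).
  by rewrite -[X in is_derive _ _ _ X]opprK; apply: is_deriveN; exact: is_derive_cos.
have cc : {in `[a, b], continuous (@cos R)} by move=> x _; exact: continuous_cos.
have cs : {in `[a, b], continuous (@sin R)} by move=> x _; exact: continuous_sin.
have := cint_FTC ab (fun x _ => is_derive_sin x) (fun x _ => dN x) cc cs.
by move=> ->; rewrite /cis; simpc; congr (_ +i* _); ring.
Qed.

Section Dilation.
Variables (f : C -> C) (z a : C) (s m t1 t2 : R).
Hypotheses (t10 : 0 < t1) (t12 : t1 <= t2) (m0 : 0 < m).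
Let c phi : C := a + s%:C * cis phi.
Hypothesis cm : forall phi, m <= normc (c phi).
Let ga (t phi : R) : C := z + t%:C * c phi.
Hypothesis df : forall t phi, t1 <= t <= t2 -> derivable f (ga t phi) 1.
Let ka phi : C := s%:C * cis phi / c phi.

Let c_neq0 phi : c phi != 0.
Proof. by rewrite -normc_gt0 (lt_le_trans m0). Qed.

Let cont_scis x : {for x, continuous (fun phi => s%:C * cis phi : C)}.
Proof. by apply: cont_cM; [exact: cvg_cst|exact: continuous_cis]. Qed.

Let cont_c x : {for x, continuous c}.
Proof. by apply: cont_cD; [exact: cvg_cst|exact: cont_scis]. Qed.

Let cont_ka x : {for x, continuous ka}.
Proof. by apply: cont_cM; [exact: cont_scis|apply: cont_cV; [exact: c_neq0|exact: cont_c]]. Qed.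

Let cont_real x : {for x, continuous (fun t : R => t%:C : C)}.
Proof. by apply: (@continuous_RC _ id); exact: cvg_id. Qed.

Let cont_gal phi x : {for x, continuous (ga ^~ phi)}.
Proof.
apply: cont_cD; first exact: cvg_cst.
by apply: cont_cM; [exact: cont_real|exact: cvg_cst].
Qed.

Let cont_gar t x : {for x, continuous (ga t)}.
Proof.
apply: cont_cD; first exact: cvg_cst.
by apply: cont_cM; [exact: cvg_cst|exact: cont_c].
Qed.

Let Pint (g : C -> C) t c1 c2 := cint c1 c2 (fun phi => g (ga t phi) * ka phi).
Let Qint (g : C -> C) phi a1 a2 := cint a1 a2 (fun t => g (ga t phi) / t%:C).
(** Along w = z + t c(phi) one has dw / (w - z) = i ka(phi) dphi + dt / t, so [Phi] is, up to the
    factor 1/i, the integral of g(w) dw / (w - z) along the boundary of the image of a (t, phi)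
    rectangle. *)
Let Phi g a1 a2 c1 c2 := Pint g a2 c1 c2 - Pint g a1 c1 c2 +
  'i * (Qint g c2 a1 a2 - Qint g c1 a1 a2).

Let Mc := normc a + `|s|.
Let K := Mc + 2 * (t2 * `|s|).

Let c_le phi : normc (c phi) <= Mc.
Proof.
by apply: le_trans (ler_normcD _ _) _; rewrite normcM normc_cis mulr1 normc_real.
Qed.

Let ka_le phi : normc (ka phi) <= `|s| / m.
Proof.
rewrite !normcM normcV normc_cis mulr1 normc_real ler_wpM2l//.
by rewrite lef_pV2 ?posrE// (lt_le_trans m0).
Qed.

Let ga_lip t p phi q : t1 <= p <= t2 ->
  normc (ga t phi - ga p q) <= K * (`|t - p| + `|phi - q|).
Proof.
move=> /andP[t1p pt2]; have p0 : 0 <= p by rewrite (le_trans (ltW t10)).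
have -> : ga t phi - ga p q = (t - p)%:C * c phi + p%:C * (s%:C * (cis phi - cis q)).
  rewrite /ga /c rmorphB/=; ring.
apply: le_trans (ler_normcD _ _) _; rewrite !normcM !normc_real.
have h1 : `|t - p| * normc (c phi) <= `|t - p| * Mc by rewrite ler_wpM2l.
have h2 : `|p| * (`|s| * normc (cis phi - cis q)) <= t2 * (`|s| * (2 * `|phi - q|)).
  rewrite ger0_norm//; apply: ler_pM; rewrite ?mulr_ge0//.
  by rewrite ler_wpM2l// cis_lipschitz.
apply: le_trans (lerD h1 h2) _; rewrite /K.
have M0 : 0 <= Mc by rewrite addr_ge0.
have ts : 0 <= t2 * `|s| by rewrite mulr_ge0// (le_trans p0).
have := mulr_ge0 M0 (normr_ge0 (phi - q)); have := mulr_ge0 ts (normr_ge0 (t - p)); nra.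
Qed.

(** [Phi] vanishes on affine functions: constants cancel between opposite sides, and the linear term
    by [cint_cis]. Only the remainder of the first-order expansion of [f] is left, at most e1 times
    the diameter, integrated over sides of length at most S. *)
Let Phi_local p q : t1 <= p <= t2 -> forall e, 0 < e -> exists2 del, 0 < del &
  forall a1 a2 c1 c2, t1 <= a1 -> a1 <= p -> p <= a2 -> a2 <= t2 -> c1 <= q -> q <= c2 ->
    a2 - a1 < del -> c2 - c1 < del ->
    normc (Phi f a1 a2 c1 c2) <= e * ((a2 - a1) + (c2 - c1)) ^+ 2.
Proof.
move=> pt e e0.
have ts : 0 <= t2 * `|s| by rewrite mulr_ge0// (le_trans (ltW t10)).
have M0 : 0 <= Mc by rewrite addr_ge0.
have K0 : 0 <= K by rewrite addr_ge0// mulr_ge0.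
(* Two sides of each kind, each with the factor 2 of [cint_norm] and with weight at most |s| / m or
   1 / t1. *)
set L := 4 * (`|s| / m + t1^-1).
have L0 : 0 < L by rewrite mulr_gt0// ltr_wpDl ?invr_gt0// divr_ge0// ltW.
pose e1 := e / ((K + 1) * L).
have e10 : 0 < e1 by rewrite divr_gt0// mulr_gt0// ltr_wpDl.
have [be /is_derivecP/(_ _ e10)[d1 d10 fd]] := (derivablec _ _).1 (@df p q pt).
exists (d1 / (2 * (K + 1))); first by rewrite divr_gt0// mulr_gt0// ltr_wpDl.
move=> a1 a2 c1 c2 ta1 a1p pa2 a2t c1q qc2 da dc.
set S := (a2 - a1) + (c2 - c1).
have a12 : a1 <= a2 by rewrite (le_trans a1p).
have c12 : c1 <= c2 by rewrite (le_trans c1q).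
have S0 : 0 <= S by rewrite addr_ge0// subr_ge0.
have KS0 : 0 <= (K + 1) * S by rewrite mulr_ge0// addr_ge0.
have KS : (K + 1) * S < d1.
  have K1 : 0 < K + 1 by rewrite ltr_wpDl.
  have := ltrD da dc; rewrite -/S.
  have -> : d1 / (2 * (K + 1)) + d1 / (2 * (K + 1)) = d1 / (K + 1).
    by field; rewrite gt_eqF.
  by rewrite ltr_pdivlMr// mulrC.
pose g0 := ga p q; pose al := f g0 - be * (g0 - z).
pose er w := f w - f g0 - be * (w - g0).
have near t phi : a1 <= t <= a2 -> c1 <= phi <= c2 -> normc (ga t phi - g0) <= (K + 1) * S.
  move=> /andP[h1 h2] /andP[h3 h4]; apply: (le_trans (ga_lip t phi q pt)).
  apply: ler_pM => //; rewrite ?lerDl ?addr_ge0//.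
  by apply: lerD; rewrite ler_norml; apply/andP; split; lra.
have erle t phi : a1 <= t <= a2 -> c1 <= phi <= c2 ->
    normc (er (ga t phi)) <= e1 * ((K + 1) * S).
  move=> ht hphi; have := near _ _ ht hphi => nr.
  apply: (le_trans (fd _ (le_lt_trans nr KS))).
  by rewrite ler_wpM2l// ltW.
have tt t : a1 <= t <= a2 -> t1 <= t <= t2.
  by move=> /andP[h1 h2]; rewrite (le_trans ta1)//= (le_trans h2).
have t_neq0 t : a1 <= t <= a2 -> t%:C != 0.
  by move=> /tt/andP[h1 _]; rewrite -normc_gt0 normc_real normr_gt0 gt_eqF// (lt_le_trans t10).
have cont_er t phi : a1 <= t <= a2 -> {for ga t phi, continuous er}.
  move=> /tt ht; apply: (@cvgB _ _ _ (nbhs (ga t phi))); last first.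
    apply: (@cvgM C _ (nbhs (ga t phi))); first exact: cvg_cst.
    apply: (@cvgB _ _ _ (nbhs (ga t phi))); [exact: cvg_id|exact: cvg_cst].
  apply: (@cvgB _ _ _ (nbhs (ga t phi))); last exact: cvg_cst.
  exact/derivablec_continuous/df.
have cont_erP t : a1 <= t <= a2 -> {in `[c1, c2], continuous (fun phi => er (ga t phi) * ka phi)}.
  move=> ht x _; apply: cont_cM; last exact: cont_ka.
  by apply: cont_comp; [exact: cont_er|exact: cont_gar].
have cont_inv t : a1 <= t <= a2 -> {for t, continuous (fun t : R => t%:C^-1 : C)}.
  by move=> ht; apply: cont_cV; [exact: t_neq0|exact: cont_real].
have cont_erQ phi : {in `[a1, a2], continuous (fun t => er (ga t phi) / t%:C)}.
  move=> x; rewrite in_itv/= => hx; apply: cont_cM; last exact: cont_inv.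
  by apply: cont_comp; [exact: cont_er|exact: cont_gal].
have fE w : f w = al + be * (w - z) + er w.
  by rewrite /er /al; ring.
have PE t : a1 <= t <= a2 -> Pint f t c1 c2 =
    al * cint c1 c2 ka + (be * t%:C * s%:C) * cint c1 c2 cis + Pint er t c1 c2.
  move=> ht; rewrite /Pint -cintZ; last by move=> x _; exact: cont_ka.
  rewrite -cintZ; last by move=> x _; exact: continuous_cis.
  rewrite -cintD; last 2 first.
  - by move=> x _; apply: cont_cM; [exact: cvg_cst|exact: cont_ka].
  - by move=> x _; apply: cont_cM; [exact: cvg_cst|exact: continuous_cis].
  rewrite -cintD; last 2 first.
  - by move=> x _; apply: cont_cD; (apply: cont_cM; first exact: cvg_cst);
      [exact: cont_ka|exact: continuous_cis].
  - exact: cont_erP.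
  apply: eq_cint => x _; rewrite fE mulrDl; congr (_ + _).
  rewrite /ga /ka; have := c_neq0 x; move: (c x) => cx cx0; field.
  by [].
have QE phi : Qint f phi a1 a2 =
    al * cint a1 a2 (fun t => t%:C^-1) + be * c phi * (a2 - a1)%:C + Qint er phi a1 a2.
  rewrite /Qint -cintZ; last by move=> x; rewrite in_itv/=; exact: cont_inv.
  rewrite -cint_cst// -cintD; last 2 first.
  - move=> x; rewrite in_itv/= => hx; apply: cont_cM; [exact: cvg_cst|exact: cont_inv].
  - by move=> x _; exact: cvg_cst.
  rewrite -cintD; last 2 first.
  - move=> x; rewrite in_itv/= => hx; apply: cont_cD; last exact: cvg_cst.
    by apply: cont_cM; [exact: cvg_cst|exact: cont_inv].
  - exact: cont_erQ.
  apply: eq_cint => x hx; rewrite fE mulrDl; congr (_ + _).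
  rewrite /ga; have := t_neq0 x hx; move: (x%:C) => cx cx0; field.
  by [].
have ha1 : a1 <= a1 <= a2 by rewrite lexx.
have ha2 : a1 <= a2 <= a2 by rewrite lexx andbT.
have hc1 : c1 <= c1 <= c2 by rewrite lexx.
have hc2 : c1 <= c2 <= c2 by rewrite lexx andbT.
have -> : Phi f a1 a2 c1 c2 = Phi er a1 a2 c1 c2.
  rewrite /Phi !PE// !QE cint_cis// /c.
  rewrite rmorphB/=; ring.
have PB t : a1 <= t <= a2 ->
    normc (Pint er t c1 c2) <= 2 * (e1 * ((K + 1) * S) * (`|s| / m)) * S.
  move=> ht; have : normc (Pint er t c1 c2) <=
      2 * (e1 * ((K + 1) * S) * (`|s| / m)) * (c2 - c1).
    apply: cint_norm => //; first exact: cont_erP.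
    by move=> x hx; rewrite normcM; apply: ler_pM => //; exact: erle.
  move=> /le_trans; apply; rewrite ler_wpM2l ?lerDr ?subr_ge0//.
  rewrite mulr_ge0// mulr_ge0 ?divr_ge0 ?(ltW m0)// mulr_ge0 ?(ltW e10)//.
have QB phi : c1 <= phi <= c2 ->
    normc (Qint er phi a1 a2) <= 2 * (e1 * ((K + 1) * S) * t1^-1) * S.
  move=> ht; have : normc (Qint er phi a1 a2) <=
      2 * (e1 * ((K + 1) * S) * t1^-1) * (a2 - a1).
    apply: cint_norm; [exact: a12|exact: cont_erQ|move=> x hx]; rewrite normcM normcV normc_real.
    apply: ler_pM; rewrite ?invr_ge0//; first exact: erle.
    have /andP[t1x _] := tt _ hx; have x0 := lt_le_trans t10 t1x.
    by rewrite lef_pV2 ?posrE ?normr_gt0 ?gt_eqF// ger0_norm// ltW.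
  move=> /le_trans; apply; rewrite ler_wpM2l ?lerDl ?subr_ge0//.
  rewrite mulr_ge0// mulr_ge0 ?invr_ge0 ?(ltW t10)// mulr_ge0 ?(ltW e10)//.
apply: le_trans (ler_normcD _ _) _.
have nP := le_trans (ler_normcB _ _) (lerD (PB a2 ha2) (PB a1 ha1)).
have nQ := le_trans (ler_normcB _ _) (lerD (QB c2 hc2) (QB c1 hc1)).
have ni : normc ('i : C) = 1 by rewrite /normc/= expr0n/= add0r expr1n sqrtr1.
rewrite normcM ni mul1r; apply: le_trans (lerD nP nQ) _.
have -> : e = e1 * ((K + 1) * L).
  by rewrite /e1 divfK// gt_eqF// mulr_gt0// ltr_wpDl.
by rewrite le_eqVlt; apply/orP; left; apply/eqP; rewrite -/S /L; ring.
Qed.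

(* The curves t |-> z + t (a + s cis phi) are contracted to z by bisecting the
   (t, phi) rectangle as in Goursat's proof, so that continuity of the
   derivative of f is not needed. *)
Lemma dilation_invariance :
  cint 0 (2 * pi) (fun phi => f (z + t1%:C * (a + s%:C * cis phi)) *
    (s%:C * cis phi / (a + s%:C * cis phi))) =
  cint 0 (2 * pi) (fun phi => f (z + t2%:C * (a + s%:C * cis phi)) *
    (s%:C * cis phi / (a + s%:C * cis phi))).
Proof.
have pi2 : 0 <= 2 * pi :> R by rewrite mulr_ge0// pi_ge0.
have contf t phi : t1 <= t <= t2 -> {for ga t phi, continuous f}.
  by move=> ht; exact/derivablec_continuous/df.
have : normc (Phi f t1 t2 0 (2 * pi)) <= 0.
  apply: (@bisection _ (fun a1 a2 c1 c2 => normc (Phi f a1 a2 c1 c2))) => //; last first.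
    move=> p q hp hq e /(Phi_local q hp)[del del0 H]; exists del => // *; exact: H.
  move=> a1 a2 c1 c2 ta aa at2 yc cc cy2.
  set mm := (a1 + a2) / 2; set n := (c1 + c2) / 2.
  have a1m : a1 <= mm by rewrite /mm; lra.
  have ma2 : mm <= a2 by rewrite /mm; lra.
  have c1n : c1 <= n by rewrite /n; lra.
  have nc2 : n <= c2 by rewrite /n; lra.
  have PS t : t1 <= t <= t2 -> Pint f t c1 c2 = Pint f t c1 n + Pint f t n c2.
    move=> ht; apply: cint_split => // x _; apply: cont_cM; last exact: cont_ka.
    by apply: cont_comp; [exact: contf|exact: cont_gar].
  have QS phi : Qint f phi a1 a2 = Qint f phi a1 mm + Qint f phi mm a2.
    apply: cint_split => // x; rewrite in_itv/= => /andP[a1x xa2].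
    have hx : t1 <= x <= t2 by rewrite (le_trans ta)//= (le_trans xa2).
    apply: cont_cM; first by apply: cont_comp; [exact: contf|exact: cont_gal].
    apply: cont_cV; last exact: cont_real.
    rewrite -normc_gt0 normc_real normr_gt0 gt_eqF// (lt_le_trans t10)//.
    by case/andP: hx.
  have -> : Phi f a1 a2 c1 c2 = Phi f a1 mm c1 n + Phi f mm a2 c1 n +
      Phi f a1 mm n c2 + Phi f mm a2 n c2.
    have hm : t1 <= mm <= t2 by rewrite (le_trans ta a1m) (le_trans ma2 at2).
    have h1 : t1 <= a1 <= t2 by rewrite ta (le_trans aa).
    have h2 : t1 <= a2 <= t2 by rewrite at2 (le_trans ta).
    rewrite /Phi !QS (PS _ h1) (PS _ h2).
    generalize (Pint f a1 c1 n) (Pint f mm c1 n) (Pint f a2 c1 n) (Pint f a1 n c2)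
      (Pint f mm n c2) (Pint f a2 n c2) (Qint f c1 a1 mm) (Qint f n a1 mm)
      (Qint f c2 a1 mm) (Qint f c1 mm a2) (Qint f n mm a2) (Qint f c2 mm a2).
    by move=> *; ring.
  by do 3 (apply: le_trans (ler_normcD _ _) _; rewrite ?lerD2r).
rewrite le_eqVlt ltNge normc_ge0 orbF normc_eq0 /Phi.
have -> : Qint f (2 * pi) t1 t2 = Qint f 0 t1 t2.
  by apply: eq_cint => t _; rewrite /ga /c cis2pi.
by rewrite subrr mulr0 addr0 subr_eq0 => /eqP.
Qed.

End Dilation.
End Goursat.

(** * Cauchy's formula and mean values on circles *)

Section Cauchy.
Variable R : realType.
Local Notation C := (R[i]^o).
Implicit Types (f g : C -> C) (z w : C) (s : R).

Definition cinto (g : R -> C) : C := cint 0 (2 * pi) g.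

Lemma pi2_gt0 : 0 < 2 * pi :> R. Proof. by rewrite mulr_gt0// pi_gt0. Qed.
Let pi2_ge0 : 0 <= 2 * pi :> R. Proof. exact: ltW pi2_gt0. Qed.

Lemma pi2_neq0 : (2 * pi)%:C != 0 :> C.
Proof. by rewrite -normc_gt0 normc_real gtr0_norm pi2_gt0. Qed.

Definition derivable_disc f z s := forall w, normc (w - z) <= s -> derivable f w 1.

Lemma derivable_discS f z s s' : s' <= s -> derivable_disc f z s -> derivable_disc f z s'.
Proof. by move=> s's fz w /le_trans ws; apply: fz; exact: ws. Qed.

Lemma holomorphic_atP f z :
  holomorphic_at f z <-> exists2 s, 0 < s & derivable_disc f z s.
Proof.
split=> [/nbhs_normcP[d d0 fd]|[s s0 fs]].
  exists (d / 2) => [|w wd]; first by rewrite divr_gt0.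
  by apply: fd; apply: le_lt_trans wd _; rewrite ltr_pdivrMr// ltr_pMr// ltr1n.
by apply/nbhs_normcP; exists s => // w /ltW; exact: fs.
Qed.

Lemma holomorphic_at_derivable f z : holomorphic_at f z -> derivable f z 1.
Proof. exact: nbhs_singleton. Qed.

Lemma cont_scis (k : C) : continuous (fun x : R => k * cis x).
Proof. by move=> x; apply: cont_cM; [exact: cvg_cst|exact: continuous_cis]. Qed.

Lemma cont_circle z s : continuous (fun x : R => z + s%:C * cis x).
Proof. by move=> x; apply: cont_cD; [exact: cvg_cst|exact: cont_scis]. Qed.

Lemma normc_circle z s x : 0 <= s -> normc (z + s%:C * cis x - z) = s.
Proof. by move=> s0; rewrite addrAC subrr add0r normcM normc_cis normc_real mulr1 ger0_norm. Qed.

Lemma cont_on_circle f z s : 0 <= s -> derivable_disc f z s ->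
  continuous (fun x : R => f (z + s%:C * cis x)).
Proof.
move=> s0 fs x; apply: cont_comp; last exact: cont_circle.
by apply/derivablec_continuous/fs; rewrite normc_circle.
Qed.

Lemma circle_dist z w s x : 0 <= s -> s - normc (w - z) <= normc (z + s%:C * cis x - w).
Proof.
move=> s0; have -> : z + s%:C * cis x - w = s%:C * cis x - (w - z) by ring.
apply: le_trans (lerB_normc _ _).
by rewrite normcM normc_cis normc_real mulr1 ger0_norm.
Qed.

(** The circle is contracted to [z] by homotheties centred at [z]: the integral is the same for
    every ratio t in ]0, 1], and as t -> 0 continuity of [f] at [z] replaces f by f z. The integral
    of the kernel is left unevaluated. *)
Lemma cauchy_aux f z z0 s : derivable_disc f z0 s -> normc (z - z0) < s ->
  cinto (fun x => f (z0 + s%:C * cis x) * (s%:C * cis x / (z0 + s%:C * cis x - z))) =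
  f z * cinto (fun x => s%:C * cis x / (z0 + s%:C * cis x - z)).
Proof.
move=> fs zs; have s0 : 0 < s by rewrite (le_lt_trans _ zs).
set m := s - normc (z - z0); have m0 : 0 < m by rewrite subr_gt0.
pose c x : C := (z0 - z) + s%:C * cis x.
have cE x : z0 + s%:C * cis x - z = c x by rewrite /c addrAC.
have cm x : m <= normc (c x) by rewrite -cE circle_dist// ltW.
have c0 x : c x != 0 by rewrite -normc_gt0 (lt_le_trans m0).
pose ka x : C := s%:C * cis x / c x.
have cc : continuous c by exact: cont_circle.
have cka : continuous ka.
  by move=> x; apply: cont_cM; [exact: cont_scis|apply: cont_cV; [exact: c0|exact: cc]].
have kaM x : normc (ka x) <= s / m.
  rewrite normcM normcV normcM normc_cis mulr1 normc_real gtr0_norm//.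
  by rewrite ler_pM2l// lef_pV2 ?posrE// (lt_le_trans m0 (cm x)).
pose ga (t : R) x : C := z + t%:C * c x.
have gaE t x : ga t x - z0 = (1 - t)%:C * (z - z0) + t%:C * (s%:C * cis x).
  by rewrite /ga /c rmorphB rmorph1; ring.
have gas t x : 0 <= t <= 1 -> normc (ga t x - z0) <= s.
  move=> /andP[t0 t1]; rewrite gaE; apply: le_trans (ler_normcD _ _) _.
  rewrite !normcM normc_cis !normc_real mulr1 (gtr0_norm s0) !ger0_norm ?subr_ge0//.
  have : (1 - t) * normc (z - z0) <= (1 - t) * s by rewrite ler_wpM2l ?subr_ge0// ltW.
  lra.
have dfg t x : 0 <= t <= 1 -> derivable f (ga t x) 1 by move=> ht; exact/fs/gas.
have cfg t : 0 <= t <= 1 -> continuous (fun x => f (ga t x) * ka x).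
  move=> ht x; apply: cont_cM; last exact: cka.
  apply: cont_comp; first exact/derivablec_continuous/dfg.
  by apply: cont_cD; [exact: cvg_cst|apply: cont_cM; [exact: cvg_cst|exact: cc]].
pose E t := cinto (fun x => f (ga t x) * ka x).
have EE t : 0 < t <= 1 -> E t = E 1.
  move=> /andP[t0 t1]; apply: (@dilation_invariance _ f z (z0 - z) s m t 1) => // t' x /andP[h1 h2].
  by apply: dfg; rewrite h2 (le_trans (ltW t0)).
have -> : cinto (fun x => f (z0 + s%:C * cis x) * (s%:C * cis x / (z0 + s%:C * cis x - z))) = E 1.
  apply: eq_cint => x _; rewrite cE; congr (f _ * _); rewrite /ga mul1r /c; ring.
have -> : cinto (fun x => s%:C * cis x / (z0 + s%:C * cis x - z)) = cinto ka.
  by apply: eq_cint => x _; rewrite cE.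
apply/eqP; rewrite -subr_eq0 -normc_eq0 eq_le normc_ge0 andbT.
apply/ler_addgt0Pr => e e0; rewrite add0r.
set L := 2 * (s / m) * (2 * pi).
have L0 : 0 < L by rewrite !mulr_gt0 ?invr_gt0// pi_gt0.
have cfz : {for z, continuous f} by apply/derivablec_continuous/fs/ltW.
have [d d0 fd] := (contc_normP f z).1 cfz (e / L) ltac:(by rewrite divr_gt0).
pose M := normc (z0 - z) + s.
have M0 : 0 < M by rewrite ltr_wpDl.
have cM x : normc (c x) <= M.
  apply: le_trans (ler_normcD _ _) _.
  by rewrite normcM normc_cis normc_real mulr1 gtr0_norm.
pose t := Num.min 1 (d / (2 * M)).
have t01 : 0 < t <= 1.
  by rewrite lt_min ltr01 divr_gt0 ?mulr_gt0//= ge_min lexx.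
have /andP[t0 t1] := t01.
have t01' : 0 <= t <= 1 by rewrite ltW.
rewrite -(EE _ t01) /E /cinto -cintZ; last by move=> x _; exact: cka.
rewrite -cintB; last 2 first.
- by move=> x _; exact: cfg.
- by move=> x _; apply: cont_cM; [exact: cvg_cst|exact: cka].
rewrite -[leRHS](divfK (lt0r_neq0 L0)).
have -> : e / L * L = 2 * (e / L * (s / m)) * (2 * pi - 0) by rewrite {2}/L; ring.
apply: cint_norm; [by rewrite ltW// pi2_gt0|move=> x _|move=> x _].
  by apply: cont_cB; [exact: cfg|apply: cont_cM; [exact: cvg_cst|exact: cka]].
rewrite -mulrBl normcM; apply: ler_pM => //; apply/ltW/fd.
rewrite /ga addrAC subrr add0r normcM normc_real gtr0_norm//.
have : t * normc (c x) <= d / (2 * M) * M.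
  by apply: ler_pM => //; [exact: ltW|rewrite ge_min lexx orbT].
move=> /le_lt_trans; apply.
have -> : d / (2 * M) * M = d / 2 by field; rewrite gt_eqF.
by rewrite ltr_pdivrMr// ltr_pMr// ltr1n.
Qed.

Lemma normc_conj (z : R[i]) : normc z^* = normc z.
Proof. by case: z => a b /=; rewrite sqrrN. Qed.

Lemma cinto_conj (g : R -> C) : continuous g ->
  cinto (fun x => (g x)^*) = (cinto g)^*.
Proof.
move=> cg; rewrite /cinto /cint /=; congr (_ +i* _).
  by apply: eq_rint => x _; case: (g x).
have : {in `[0, 2 * pi], continuous (fun x => Im (g x))}.
  by apply: cont_Im => x _; exact: cg.
move=> /(@rintZl _ _ _ (-1)); rewrite mulN1r => <-.
by apply: eq_rint => x _; case: (g x) => ? ? /=; rewrite mulN1r.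
Qed.

Lemma cis_conj x : cis x * (cis x)^* = 1 :> C.
Proof.
apply/eqP; rewrite eq_complex/=; apply/andP; split; apply/eqP; last by ring.
rewrite -(cos2Dsin2 x); ring.
Qed.

Lemma cinto1 : cinto (fun=> 1) = (2 * pi)%:C.
Proof. by rewrite /cinto cint_cst// subr0 mul1r. Qed.

(** With u the conjugate of (z - z0) / s, the kernel is the conjugate of 1 / (1 - u cis x). The mean
    of the latter is its value 1 at the centre, by [cauchy_aux] at 0, where the kernel is
    identically 1; no residue or winding number is computed. *)
Lemma cauchy_kernel z z0 s : normc (z - z0) < s ->
  cinto (fun x => s%:C * cis x / (z0 + s%:C * cis x - z)) = (2 * pi)%:C.
Proof.
move=> zs; have s0 : 0 < s by rewrite (le_lt_trans _ zs).
have sC : s%:C != 0 :> C by rewrite -normc_gt0 normc_real gtr0_norm.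
pose u : C := ((z - z0) / s%:C)^*.
have u1 : normc u < 1.
  by rewrite normc_conj normcM normcV normc_real gtr0_norm// ltr_pdivrMr// mul1r.
have den w : normc w <= 1 -> 1 - u * w != 0.
  move=> w1; rewrite -normc_gt0; apply: lt_le_trans (lerB_normc _ _).
  rewrite normc1 subr_gt0 normcM (le_lt_trans _ u1)//.
  by rewrite -[leRHS]mulr1 ler_wpM2l.
pose h w : C := (1 - u * w)^-1.
have dh : derivable_disc h 0 1.
  move=> w; rewrite subr0 => w1; apply/derivablec; eexists.
  by apply: (@is_derivecV _ (fun w => 1 - u * w)); exact: den.
have := cauchy_aux dh (z := 0); rewrite subrr normc0 => /(_ ltr01).
have cisE x : 0 + 1%:C * cis x = cis x :> C by rewrite add0r mul1r.
rewrite (_ : cinto _ = cinto (fun x => h (cis x))); last first.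
  by apply: eq_cint => x _; rewrite cisE subr0 mul1r divff ?cis_neq0// mulr1.
rewrite [X in _ * X](_ : _ = (2 * pi)%:C); last first.
  by rewrite -cinto1; apply: eq_cint => x _; rewrite cisE subr0 mul1r divff ?cis_neq0.
rewrite {2}/h mulr0 subr0 invr1 mul1r => H.
have ch : continuous (fun x => h (cis x)).
  move=> x; apply: cont_comp; last exact: continuous_cis.
  by apply/derivablec_continuous/dh; rewrite subr0 normc_cis.
have := cinto_conj ch; rewrite {}[X in _ = X^*]H.
have -> : ((2 * pi)%:C)^* = (2 * pi)%:C :> C by rewrite /= oppr0.
move=> <-; apply: eq_cint => x _.
have uE : (1 - u * cis x)^* = 1 - (z - z0) / s%:C * (cis x)^* :> C.
  by rewrite rmorphB rmorphM rmorph1/= /u conjcK.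
have cE : z0 + s%:C * cis x - z = s%:C * cis x * (1 - (z - z0) / s%:C * (cis x)^* ) :> C.
  transitivity (s%:C * cis x - (z - z0) * (cis x * (cis x)^* ) : C).
    by rewrite cis_conj mulr1; ring.
  by field.
have -> : (h (cis x))^* = (1 - (z - z0) / s%:C * (cis x)^* )^-1 :> C.
  by rewrite /h conjc_inv; congr (_^-1); exact: uE.
by rewrite cE invfM mulrA divff ?mul1r// mulf_neq0 ?cis_neq0.
Qed.

Lemma cauchy_formula f z z0 s : derivable_disc f z0 s -> normc (z - z0) < s ->
  (2 * pi)%:C * f z =
  cinto (fun x => f (z0 + s%:C * cis x) * (s%:C * cis x / (z0 + s%:C * cis x - z))).
Proof. by move=> fs zs; rewrite (cauchy_aux fs zs) cauchy_kernel// mulrC. Qed.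

Lemma mean_value f z s : 0 < s -> derivable_disc f z s ->
  (2 * pi)%:C * f z = cinto (fun x => f (z + s%:C * cis x)).
Proof.
move=> s0 fs; rewrite (cauchy_formula fs) ?subrr ?normc0//.
apply: eq_cint => x _; rewrite addrAC subrr add0r divff ?mulr1//.
by rewrite mulf_neq0 ?cis_neq0// -normc_gt0 normc_real gtr0_norm.
Qed.

(** The case [z = 0], [a = 0], [s = 1] of [dilation_invariance], where the weight reduces to 1. *)
Lemma cinto_annulus f t1 t2 : 0 < t1 -> t1 <= t2 ->
  (forall w, t1 <= normc w <= t2 -> derivable f w 1) ->
  cinto (fun x => f (t1%:C * cis x)) = cinto (fun x => f (t2%:C * cis x)).
Proof.
move=> t10 t12 df.
have cE x : 0 + 1%:C * cis x = cis x :> C by rewrite add0r mul1r.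
have h1 x : 1 <= normc (0 + 1%:C * cis x : C) by rewrite cE normc_cis.
have h2 t x : t1 <= t <= t2 -> derivable f (0 + t%:C * (0 + 1%:C * cis x)) 1.
  move=> ht; apply: df; have /andP[h _] := ht.
  rewrite cE add0r normcM normc_cis normc_real mulr1 ger0_norm//.
  by rewrite (le_trans (ltW t10)).
have H := dilation_invariance t10 t12 ltr01 h1 h2.
have E t x : f (0 + t%:C * (0 + 1%:C * cis x)) * (1%:C * cis x / (0 + 1%:C * cis x)) =
    f (t%:C * cis x).
  by rewrite cE add0r mul1r divff ?mulr1// cis_neq0.
rewrite /cinto -(eq_cint (fun x _ => E t1 x)) H.
by apply: eq_cint => x _; rewrite E.
Qed.

End Cauchy.

(** * Cauchy-type integrals, Cauchy estimates and removable singularities *)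

Section CauchyKernels.
Variable R : realType.
Local Notation C := (R[i]^o).
Implicit Types (f g : C -> C) (z w : C) (s : R).
Let pi2_ge0 : 0 <= 2 * pi :> R. Proof. exact: ltW (pi2_gt0 R). Qed.

Lemma kernel1 (r u h : C) : u != 0 -> u - h != 0 ->
  r / (u - h) - r / u - r / u ^+ 2 * h = r * h ^+ 2 / (u ^+ 2 * (u - h)).
Proof. by move=> u0 uh0; field; rewrite u0 uh0. Qed.

Lemma kernel2 (r u h : C) : u != 0 -> u - h != 0 ->
  r / (u - h) ^+ 2 - r / u ^+ 2 - 2 * (r / u ^+ 3) * h =
  r * (3 * u - 2 * h) * h ^+ 2 / (u ^+ 3 * (u - h) ^+ 2).
Proof. by move=> u0 uh0; field; rewrite u0 uh0. Qed.

Lemma normc_kernel (r h p q : C) m n :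
  normc (r * h ^+ 2 / (p ^+ m * q ^+ n)) =
  normc r * normc h ^+ 2 / (normc p ^+ m * normc q ^+ n).
Proof. by rewrite normcM normcV (normcM r) (normcM (p ^+ m)) !normcX. Qed.

(** A remainder quadratic in w - w0, uniformly in x, integrates to a quadratic remainder. [kernel1]
    and [kernel2] supply such remainders for the Cauchy kernel and its square. *)
Lemma is_derive_cinto (k : R -> C -> C) (k1 : R -> C) (w0 : C) (B d : R) : 0 < d ->
  (forall w, normc (w - w0) < d -> continuous (fun x => k x w)) ->
  continuous k1 ->
  (forall x w, 0 <= x <= 2 * pi -> normc (w - w0) < d ->
    normc (k x w - k x w0 - k1 x * (w - w0)) <= B * normc (w - w0) ^+ 2) ->
  is_derive w0 1 (fun w => cinto (fun x => k x w)) (cinto k1).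
Proof.
move=> d0 ck ck1 kB; apply/is_derivecP => e e0.
pose L := 2 * `|B| * (2 * pi) + 1.
have L0 : 0 < L by rewrite ltr_wpDl// !mulr_ge0// pi_ge0.
exists (Num.min d (e / L)); first by rewrite lt_min d0 divr_gt0.
move=> w; rewrite lt_min => /andP[wd we].
have w0d : normc (w0 - w0) < d by rewrite subrr normc0.
rewrite mulrC /cinto -cintZ; last by move=> x _; exact: ck1.
rewrite -cintB; [|by move=> x _; exact: ck..].
rewrite -cintB; last 2 first.
- by move=> x _; apply: cont_cB; exact: ck.
- by move=> x _; apply: cont_cM; [exact: cvg_cst|exact: ck1].
apply: (@le_trans _ _ (2 * (`|B| * normc (w - w0) ^+ 2) * (2 * pi - 0))).
  apply: cint_norm => // x hx.
    by apply: cont_cB; [apply: cont_cB; exact: ck|apply: cont_cM; [exact: cvg_cst|exact: ck1]].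
  rewrite mulrC; apply: (le_trans (kB x w hx wd)).
  by rewrite ler_wpM2r ?exprn_ge0// ler_norm.
rewrite subr0 expr2.
have -> : 2 * (`|B| * (normc (w - w0) * normc (w - w0))) * (2 * pi) =
  (2 * `|B| * (2 * pi)) * normc (w - w0) * normc (w - w0) by ring.
rewrite ler_wpM2r//; apply: (@le_trans _ _ (L * normc (w - w0))).
  by rewrite ler_wpM2r// lerDl.
by rewrite mulrC -ler_pdivlMr// ltW.
Qed.

Section CauchyIntegral.
Variables (rho : R -> C) (z0 : C) (s M : R).
Hypotheses (crho : continuous rho) (rhoM : forall x, 0 <= x <= 2 * pi -> normc (rho x) <= M).
Let ze x : C := z0 + s%:C * cis x.

Let ball_s w : normc (w - z0) < s -> exists2 d, 0 < d & forall w',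
  normc (w' - w) < d -> forall x, d <= normc (ze x - w').
Proof.
move=> ws; have s0 : 0 < s by rewrite (le_lt_trans _ ws).
exists ((s - normc (w - z0)) / 2); first by rewrite divr_gt0// subr_gt0.
move=> w' w'd x; apply: le_trans (circle_dist _ _ _ (ltW s0)).
have : normc (w' - z0) <= normc (w' - w) + normc (w - z0).
  by apply: le_trans (ler_normcD _ _); rewrite addrA subrK.
lra.
Qed.

Let cont_kernel n w : (forall x, ze x - w != 0) ->
  continuous (fun x => rho x / (ze x - w) ^+ n).
Proof.
move=> w0 x; apply: cont_cM; first exact: crho.
apply: cont_cV; first by rewrite expf_neq0.
by apply: cont_cX; apply: cont_cB; [exact: cont_circle|exact: cvg_cst].
Qed.

Let ze_neq0 d w : 0 < d -> (forall x, d <= normc (ze x - w)) -> forall x, ze x - w != 0.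
Proof. by move=> d0 dw x; rewrite -normc_gt0 (lt_le_trans d0). Qed.

(** The density [rho] need only be continuous: it is taken to be [boundary f z s] in Cauchy's
    formula and the restriction of [f] to the circle in [divide_root]. *)
Definition cauchy_integral n w := cinto (fun x => rho x / (z0 + s%:C * cis x - w) ^+ n).

Lemma is_derive_cauchy_integral1 w : normc (w - z0) < s ->
  is_derive w 1 (cauchy_integral 1) (cauchy_integral 2 w).
Proof.
move=> ws; have [d d0 dw] := ball_s ws.
have w0 := dw w; rewrite subrr normc0 in w0.
apply: (@is_derive_cinto _ _ w (M / d ^+ 3) d); first exact: d0.
- by move=> w' w'd; apply: cont_kernel; apply: ze_neq0 (dw _ w'd).
- by apply: cont_kernel; apply: ze_neq0 (w0 d0).
- move=> x w' hx w'd; have n1 := ze_neq0 d0 (w0 d0) x; have n2 := ze_neq0 d0 (dw _ w'd) x.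
  rewrite -/(ze x) !expr1.
  have -> : rho x / (ze x - w') - rho x / (ze x - w) - rho x / (ze x - w) ^+ 2 * (w' - w) =
    rho x * (w' - w) ^+ 2 / ((ze x - w) ^+ 2 * (ze x - w')).
    have -> : ze x - w' = (ze x - w) - (w' - w) by ring.
    rewrite kernel1//; by rewrite (_ : ze x - w - (w' - w) = ze x - w') //; ring.
  rewrite -[X in _ / (_ * X)](expr1 (ze x - w')) normc_kernel expr1 [leRHS]mulrAC.
  apply: ler_pM.
  + by rewrite mulr_ge0 ?exprn_ge0.
  + by rewrite invr_ge0 mulr_ge0 ?exprn_ge0.
  + by rewrite ler_wpM2r ?exprn_ge0//; exact: rhoM.
  rewrite lef_pV2 ?posrE ?mulr_gt0 ?exprn_gt0 ?normc_gt0//.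
  rewrite [leLHS]exprSr; apply: ler_pM; rewrite ?exprn_ge0 ?(ltW d0)//; last exact: dw.
  by rewrite lerXn2r ?nnegrE ?(ltW d0)//; exact: w0.
Qed.

Lemma is_derive_cauchy_integral2 w : normc (w - z0) < s ->
  is_derive w 1 (cauchy_integral 2) (2 * cauchy_integral 3 w).
Proof.
move=> ws; have [d d0 dw] := ball_s ws.
have w0 := dw w; rewrite subrr normc0 in w0.
have c3 : continuous (fun x => rho x / (ze x - w) ^+ 3).
  by apply: cont_kernel; apply: ze_neq0 (w0 d0).
have -> : 2 * cauchy_integral 3 w = cinto (fun x => 2 * (rho x / (ze x - w) ^+ 3)).
  by rewrite /cinto cintZ// => x _; exact: c3.
have [D D0 ubD] : exists2 D, 0 < D & forall x w', normc (w' - w) < d ->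
    normc (3 * (ze x - w) - 2 * (w' - w)) <= D.
  exists (3 * (s + normc (z0 - w)) + 2 * d).
    by have := normc_ge0 (z0 - w); have := le_lt_trans (normc_ge0 _) ws; lra.
  move=> x w' w'd; apply: le_trans (ler_normcB _ _) _.
  rewrite !normcM -[3]/(3%:R) -[2]/(2%:R) -!(rmorph_nat (real_complex R)) !normc_real !ger0_norm//.
  have : normc (ze x - w) <= s + normc (z0 - w).
    have -> : ze x - w = s%:C * cis x + (z0 - w) by rewrite /ze; ring.
    apply: le_trans (ler_normcD _ _) _.
    by rewrite normcM normc_cis normc_real mulr1 gtr0_norm// (le_lt_trans _ ws).
  lra.
have M0 : 0 <= M by apply: le_trans (rhoM (x := 0) _) => //; rewrite lexx.
apply: (@is_derive_cinto _ _ w (M * D / d ^+ 5) d); first exact: d0.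
- by move=> w' w'd; apply: cont_kernel; apply: ze_neq0 (dw _ w'd).
- by move=> x; apply: cont_cM; [exact: cvg_cst|exact: c3].
- move=> x w' hx w'd; have n1 := ze_neq0 d0 (w0 d0) x; have n2 := ze_neq0 d0 (dw _ w'd) x.
  rewrite -/(ze x).
  have -> : rho x / (ze x - w') ^+ 2 - rho x / (ze x - w) ^+ 2 - 2 * (rho x / (ze x - w) ^+ 3) * (w' - w) =
    rho x * (3 * (ze x - w) - 2 * (w' - w)) * (w' - w) ^+ 2 / ((ze x - w) ^+ 3 * (ze x - w') ^+ 2).
    have -> : ze x - w' = (ze x - w) - (w' - w) by ring.
    rewrite kernel2//; by rewrite (_ : ze x - w - (w' - w) = ze x - w') //; ring.
  rewrite normc_kernel [leRHS]mulrAC.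
  apply: ler_pM.
  + by rewrite mulr_ge0 ?exprn_ge0.
  + by rewrite invr_ge0 mulr_ge0 ?exprn_ge0.
  + by rewrite ler_wpM2r ?exprn_ge0// normcM; apply: ler_pM => //; [exact: rhoM|exact: ubD].
  rewrite lef_pV2 ?posrE ?mulr_gt0 ?exprn_gt0 ?normc_gt0//.
  rewrite -[5%N]/(3 + 2)%N exprD; apply: ler_pM; rewrite ?exprn_ge0 ?(ltW d0)//.
    by rewrite lerXn2r ?nnegrE ?(ltW d0)//; exact: w0.
  by rewrite lerXn2r ?nnegrE ?(ltW d0)//; exact: dw.
Qed.

End CauchyIntegral.


Lemma circle_bounded (g : R -> C) : continuous g ->
  exists2 M, 0 <= M & forall x, 0 <= x <= 2 * pi -> normc (g x) <= M.
Proof.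
move=> cg; have [|c _ cM] := @EVT_max R (fun x => normc (g x)) 0 (2 * pi) pi2_ge0.
  apply: cont_within => x _; apply: (@continuous_comp _ _ _ g); first exact: cg.
  exact: continuous_normc.
by exists (normc (g c)) => // x hx; apply: cM; rewrite in_itv.
Qed.

Definition boundary f z s (x : R) : C := f (z + s%:C * cis x) * (s%:C * cis x).

Lemma cont_boundary f z s : 0 <= s -> derivable_disc f z s -> continuous (boundary f z s).
Proof. by move=> s0 fs x; apply: cont_cM; [exact: cont_on_circle|exact: cont_scis]. Qed.

Lemma cauchy_integralE f z s w : derivable_disc f z s -> normc (w - z) < s ->
  f w = (2 * pi)%:C^-1 * cauchy_integral (boundary f z s) z s 1 w.
Proof.
move=> fs ws; apply: (mulfI (pi2_neq0 R)); rewrite (cauchy_formula fs ws).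
rewrite mulrA divff ?pi2_neq0// mul1r; apply: eq_cint => x _.
by rewrite /boundary expr1 mulrA.
Qed.

Lemma is_derivecZ (k : C) f z (a : C) : is_derive z 1 f a ->
  is_derive z 1 (fun w => k * f w) (k * a).
Proof.
move=> fa; rewrite -[X in is_derive _ _ _ X]add0r -[X in X + _](mul0r (f z)).
by apply: (@is_derivecM _ (fun=> k) f) fa; exact: is_derive_cst.
Qed.

Lemma cauchy_is_derive f z s w : derivable_disc f z s -> normc (w - z) < s ->
  is_derive w 1 f ((2 * pi)%:C^-1 * cauchy_integral (boundary f z s) z s 2 w).
Proof.
move=> fs ws; have s0 : 0 <= s by rewrite (le_trans _ (ltW ws)).
have cb := cont_boundary s0 fs; have [M M0 bM] := circle_bounded cb.
apply: (@is_derivec_near _ (fun w => (2 * pi)%:C^-1 * cauchy_integral (boundary f z s) z s 1 w)).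
  apply/nbhs_normcP; exists (s - normc (w - z)); first by rewrite subr_gt0.
  move=> w' w'w; rewrite -cauchy_integralE//.
  have : normc (w' - z) <= normc (w' - w) + normc (w - z).
    by apply: le_trans (ler_normcD _ _); rewrite addrA subrK.
  lra.
by apply: is_derivecZ; apply: is_derive_cauchy_integral1 bM _ _.
Qed.

Lemma derive1c f w (a : C) : is_derive w 1 f a -> derive1 f w = a.
Proof. by move=> fa; rewrite derive1E; exact: derive_val. Qed.

Lemma derive1_cauchy f z s w : derivable_disc f z s -> normc (w - z) < s ->
  derive1 f w = (2 * pi)%:C^-1 * cauchy_integral (boundary f z s) z s 2 w.
Proof. by move=> fs ws; apply: derive1c; exact: cauchy_is_derive. Qed.

Lemma derivable_derive1 f z s w : derivable_disc f z s -> normc (w - z) < s ->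
  derivable (derive1 f) w 1.
Proof.
move=> fs ws; have s0 : 0 <= s by rewrite (le_trans _ (ltW ws)).
have cb := cont_boundary s0 fs; have [M M0 bM] := circle_bounded cb.
apply/derivablec; exists ((2 * pi)%:C^-1 * (2 * cauchy_integral (boundary f z s) z s 3 w)).
apply: (@is_derivec_near _ (fun w => (2 * pi)%:C^-1 * cauchy_integral (boundary f z s) z s 2 w)).
  apply/nbhs_normcP; exists (s - normc (w - z)); first by rewrite subr_gt0.
  move=> w' w'w; rewrite -(@derive1_cauchy f)//.
  have : normc (w' - z) <= normc (w' - w) + normc (w - z).
    by apply: le_trans (ler_normcD _ _); rewrite addrA subrK.
  lra.
by apply: is_derivecZ; apply: is_derive_cauchy_integral2 bM _ _.
Qed.

Lemma holomorphic_at_derive1 f z : holomorphic_at f z -> holomorphic_at (derive1 f) z.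
Proof.
move=> /holomorphic_atP[s s0 fs]; apply/holomorphic_atP; exists (s / 2); first by rewrite divr_gt0.
move=> w ws; apply: (derivable_derive1 fs); apply: (le_lt_trans ws).
by rewrite ltr_pdivrMr// ltr_pMr// ltr1n.
Qed.

Lemma normc_pi2V_mul (a : C) M : normc a <= 2 * M * (2 * pi) ->
  normc ((2 * pi)%:C^-1 * a) <= 2 * M.
Proof.
move=> aM; rewrite normcM normcV normc_real gtr0_norm ?pi2_gt0//.
by rewrite ler_pdivrMl ?pi2_gt0// mulrC.
Qed.

Lemma cauchy_estimate f z s M : 0 < s -> derivable_disc f z s ->
  (forall w, normc (w - z) = s -> normc (f w) <= M) ->
  normc (derive1 f z) <= 2 * (M / s).
Proof.
move=> s0 fs fM; rewrite (@derive1_cauchy _ z s)// ?subrr ?normc0//.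
have sC : s%:C != 0 :> C by rewrite -normc_gt0 normc_real gtr0_norm.
apply: normc_pi2V_mul; rewrite -[in leRHS](subr0 (2 * pi)).
have bE x : boundary f z s x / (z + s%:C * cis x - z) ^+ 2 = f (z + s%:C * cis x) / (s%:C * cis x).
  have := cis_neq0 x; rewrite /boundary addrAC subrr add0r; move: (cis x) (f _) => c u c0.
  by field; rewrite c0 sC.
apply: cint_norm => // x _.
  rewrite /=; under eq_fun do rewrite bE.
  apply: cont_cM; first by apply: cont_on_circle => //; exact: ltW.
  by apply: cont_cV; [rewrite mulf_neq0 ?cis_neq0|exact: cont_scis].
rewrite bE normcM normcV normcM normc_cis mulr1 normc_real gtr0_norm//.
by rewrite ler_pM2r ?invr_gt0// fM// normc_circle// ltW.
Qed.

(** A substitute for the maximum principle: one factor 2 comes from [cint_norm], the other from s /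
    |zeta - w| <= 2 on the half disc. *)
Lemma cauchy_bound f z s M w : 0 < s -> derivable_disc f z s ->
  (forall w, normc (w - z) = s -> normc (f w) <= M) ->
  normc (w - z) <= s / 2 -> normc (f w) <= 2 * (M * 2).
Proof.
move=> s0 fs fM ws; have ws' : normc (w - z) < s.
  by apply: (le_lt_trans ws); rewrite ltr_pdivrMr// ltr_pMr// ltr1n.
have s2 x : s / 2 <= normc (z + s%:C * cis x - w).
  by apply: le_trans (circle_dist _ _ _ (ltW s0)); lra.
have n0 x : z + s%:C * cis x - w != 0.
  by rewrite -normc_gt0 (lt_le_trans _ (s2 x))// divr_gt0.
rewrite (cauchy_integralE fs ws'); apply: normc_pi2V_mul.
rewrite -[in leRHS](subr0 (2 * pi)); apply: cint_norm => // x _.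
  apply: cont_cM; first by apply: cont_boundary => //; exact: ltW.
  apply: cont_cV; first by rewrite expf_neq0.
  by apply: cont_cX; apply: cont_cB; [exact: cont_circle|exact: cvg_cst].
rewrite expr1 /boundary normcM normcV !normcM normc_cis mulr1 normc_real gtr0_norm//.
rewrite -mulrA; apply: ler_pM => //; first by rewrite mulr_ge0 ?invr_ge0// ltW.
  by apply: fM; rewrite normc_circle// ltW.
rewrite ler_pdivrMr ?normc_gt0//; have := s2 x; lra.
Qed.

(** The quotient is the mean of f(zeta) / (zeta - w) over the circle. As (w - z) / (zeta - w) =
    (zeta - z) / (zeta - w) - 1, Cauchy's formula and the mean value property give (w - z) g(w) =
    f(w) - f(z). *)
Lemma divide_root f z s : 0 < s -> derivable_disc f z s -> f z = 0 ->
  exists g, [/\ forall w, normc (w - z) < s -> derivable g w 1,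
    forall w, normc (w - z) < s -> f w = (w - z) * g w & g z = derive1 f z].
Proof.
move=> s0 fs fz0; have s0' := ltW s0.
have sC : s%:C != 0 :> C by rewrite -normc_gt0 normc_real gtr0_norm.
pose rho (x : R) := f (z + s%:C * cis x).
have crho : continuous rho by exact: cont_on_circle.
have [M M0 rM] := circle_bounded crho.
pose g w : C := (2 * pi)%:C^-1 * cauchy_integral rho z s 1 w.
have dg w : normc (w - z) < s -> derivable g w 1.
  move=> ws; apply/derivablec; exists ((2 * pi)%:C^-1 * cauchy_integral rho z s 2 w).
  by apply: is_derivecZ; apply: is_derive_cauchy_integral1 rM _ _.
have fE w : normc (w - z) < s -> f w = (w - z) * g w.
  move=> ws; have n0 x : z + s%:C * cis x - w != 0.
    rewrite -normc_gt0 (lt_le_trans _ (circle_dist _ _ _ s0'))// subr_gt0//.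
  apply: (mulfI (pi2_neq0 R)); rewrite mulrCA [X in _ = _ * X]mulrA divff ?pi2_neq0// mul1r.
  have m0 : cinto rho = 0 by rewrite -(mean_value s0 fs) fz0 mulr0.
  rewrite (cauchy_formula fs ws) -[LHS]subr0 -m0 /cinto.
  have ck : continuous (fun x => rho x / (z + s%:C * cis x - w) ^+ 1).
    move=> x; apply: cont_cM; first exact: crho.
    apply: cont_cV; first by rewrite expf_neq0.
    by apply: cont_cX; apply: cont_cB; [exact: cont_circle|exact: cvg_cst].
  have cl : continuous (fun x => f (z + s%:C * cis x) * (s%:C * cis x / (z + s%:C * cis x - w))).
    move=> x; apply: cont_cM; first exact: crho.
    apply: cont_cM; first exact: cont_scis.
    by apply: cont_cV; [|apply: cont_cB; [exact: cont_circle|exact: cvg_cst]].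
  rewrite -cintB; [|by move=> x _; exact: cl|by move=> x _; exact: crho].
  rewrite /cauchy_integral /cinto -cintZ; last by move=> x _; exact: ck.
  apply: eq_cint => x _; rewrite /rho expr1; have := n0 x.
  have -> : z + s%:C * cis x - w = s%:C * cis x - (w - z) by ring.
  by move: (w - z) (s%:C * cis x) (f (z + s%:C * cis x)) => c b a bc; field.
exists g; split => //; apply/esym/derive1c.
have z0 : normc (z - z) < s by rewrite subrr normc0.
have /derivablec[l gl] := dg z z0.
apply: (@is_derivec_near _ (fun w => (w - z) * g w)).
  by apply/nbhs_normcP; exists s => // w ws; rewrite -fE.
have := is_derivecM (is_derivec_shift z z) gl.
by rewrite mul1r subrr mul0r addr0.
Qed.

(** Boundedness makes F = (w - z)^2 f differentiable at [z] with F(z) = F'(z) = 0, so the factor w -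
    z can be divided out twice; the second division halves the radius. *)
Lemma removable_singularity f z s M : 0 < s ->
  (forall w, w != z -> normc (w - z) <= s -> derivable f w 1) ->
  (forall w, w != z -> normc (w - z) <= s -> normc (f w) <= M) ->
  exists g, (forall w, normc (w - z) < s / 2 -> derivable g w 1) /\
    (forall w, w != z -> normc (w - z) < s / 2 -> g w = f w).
Proof.
move=> s0 df fM; pose F w : C := (w - z) ^+ 2 * f w.
have dz : is_derive z 1 F 0.
  apply/is_derivecP => e e0; exists (Num.min s (e / (`|M| + 1))).
    by rewrite lt_min s0 divr_gt0// ltr_wpDl.
  move=> w; rewrite lt_min => /andP[ws we].
  rewrite /F subrr expr0n mul0r subr0 mul0r subr0.
  have [->|wz] := eqVneq w z; first by rewrite subrr normc0 expr0n/= mul0r normc0 mulr0.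
  rewrite normcM normcX expr2 -mulrA mulrC ler_wpM2r//.
  have := fM w wz (ltW ws) => h; apply: (@le_trans _ _ (normc (w - z) * (`|M| + 1))).
    by rewrite ler_wpM2l// (le_trans h)// (le_trans (ler_norm _))// lerDl.
  by rewrite -ler_pdivlMr ?ltW// ltr_wpDl.
have dF : derivable_disc F z s.
  move=> w ws; have [->|wz] := eqVneq w z; first by case: dz.
  have /derivablec[l fl] := df w wz ws.
  apply/derivablec; eexists.
  exact: (is_derivecM (is_derivecX 2 (is_derivec_shift z w)) fl).
have Fz : F z = 0 by rewrite /F subrr expr0n mul0r.
have [g [dg Fg gz]] := divide_root s0 dF Fz.
have s20 : 0 < s / 2 by rewrite divr_gt0.
have dg' : derivable_disc g z (s / 2).
  move=> w ws; apply: dg; apply: (le_lt_trans ws).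
  by rewrite ltr_pdivrMr// ltr_pMr// ltr1n.
have gz0 : g z = 0 by rewrite gz; exact: derive1c.
have [h [dh gh _]] := divide_root s20 dg' gz0.
exists h; split => // w wz ws.
have wz0 : w - z != 0 by rewrite subr_eq0.
have : F w = (w - z) ^+ 2 * h w.
  rewrite Fg ?gh// ?expr2 ?mulrA//; apply: (lt_le_trans ws).
  by rewrite ler_pdivrMr// ler_peMr ?ler1n// ltW.
by rewrite /F => /mulfI; rewrite expf_neq0// => /(_ isT).
Qed.

End CauchyKernels.

(** * Zeros and poles *)

Section PolarCoordinates.
Variable R : realType.
Local Notation C := (R[i]^o).

Lemma unit_cis (a b : R) : a ^+ 2 + b ^+ 2 = 1 ->
  exists2 x : R, 0 <= x < 2 * pi & (a +i* b : C) = cis x.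
Proof.
move=> ab; have aN1 : -1 <= a <= 1.
  rewrite -ler_norml -(@ler_pXn2r _ 2) ?nnegrE// real_normK ?num_real// expr1n -ab.
  by rewrite lerDl sqr_ge0.
have pp := @pi_gt0 R.
have sE : sin (acos a) = `|b|.
  by rewrite sin_acos// -ab [_ + b ^+ 2]addrC addrK sqrtr_sqr.
have [b0|b0] := leP 0 b.
  exists (acos a); first by rewrite acos_ge0//= (le_lt_trans (acos_lepi _))//; lra.
  by rewrite /cis acosK ?in_itv// sE ger0_norm.
exists (2 * pi - acos a).
  have a0 : 0 < acos a.
    rewrite lt_neqAle acos_ge0// andbT; apply/eqP => a0.
    by move: sE; rewrite -a0 sin0 ltr0_norm// => /eqP; rewrite eq_sym oppr_eq0 lt_eqF.
  have := acos_lepi aN1; move: a0; lra.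
rewrite /cis sinB cosB mulr_natl cos2pi sin2pi !mul1r !mul0r acosK ?in_itv// sE.
by rewrite ltr0_norm// addr0 sub0r opprK.
Qed.

Lemma polar_rep (z : C) : exists2 x : R, 0 <= x < 2 * pi & z = (normc z)%:C * cis x.
Proof.
have [->|z0] := eqVneq z 0.
  by exists 0; [rewrite lexx mulr_gt0// pi_gt0|rewrite normc0 mul0r].
have nz : normc z != 0 by rewrite normc_eq0.
case E : (z / (normc z)%:C) => [a b].
have ab1 : a ^+ 2 + b ^+ 2 = 1.
  have : normc (z / (normc z)%:C) = 1.
    by rewrite normcM normcV normc_real ger0_norm ?divff.
  rewrite E /= => /(congr1 (fun x => x ^+ 2)); rewrite expr1n sqr_sqrtr//.
  by rewrite addr_ge0// sqr_ge0.
have [x hx xE] := unit_cis ab1; exists x => //.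
rewrite -xE -E mulrC divfK// -normc_gt0 normc_real normr_gt0//.
Qed.

(** Compactness of a rectangle as an induction principle: [bisection] for the 0-1 indicator of the
    failure of [P], which is subadditive by gluing and locally zero. *)
Lemma rect_induction (P : R -> R -> R -> R -> Prop) (x1 x2 y1 y2 : R) :
  x1 <= x2 -> y1 <= y2 ->
  (forall a b c d, P a ((a + b) / 2) c ((c + d) / 2) -> P ((a + b) / 2) b c ((c + d) / 2) ->
    P a ((a + b) / 2) ((c + d) / 2) d -> P ((a + b) / 2) b ((c + d) / 2) d -> P a b c d) ->
  (forall p q, x1 <= p <= x2 -> y1 <= q <= y2 -> exists2 del, 0 < del &
    forall a b c d, a <= p <= b -> c <= q <= d -> b - a < del -> d - c < del ->
      P a b c d) -> P x1 x2 y1 y2.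
Proof.
move=> x12 y12 Pq Pl; pose N a b c d : R := (~~ `[< P a b c d >])%:R.
have : N x1 x2 y1 y2 <= 0.
  apply: (@bisection _ N) => //.
  - move=> a b c d _ _ _ _ _ _; rewrite /N.
    case: (asboolP (P a b c d)) => [_|nP] /=; first by rewrite !addr_ge0.
    case: asboolP => h1; case: asboolP => h2; case: asboolP => h3; case: asboolP => h4 //=;
      try lra.
    by exfalso; apply: nP; exact: Pq.
  - move=> p q hp hq e e0; have [del del0 H] := Pl p q hp hq; exists del => //.
    move=> a b c d _ ap pb _ _ cq qd _ ba dc; rewrite /N; case: asboolP => [_|[]] /=.
      by rewrite mulr_ge0 ?(ltW e0)// sqr_ge0.
    by apply: H => //; rewrite ?ap ?cq.
by rewrite /N; case: asboolP => //=; rewrite ler10.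
Qed.

(** Compactness of closed annuli, transported from a rectangle by polar coordinates. It yields the
    finiteness of zeros and poles and the boundedness of continuous functions. *)
Lemma annulus_induction (P : set C -> Prop) (s0 s1 : R) : 0 <= s0 -> s0 <= s1 ->
  (forall A B : set C, A `<=` B -> P B -> P A) ->
  (forall A B : set C, P A -> P B -> P (A `|` B)) ->
  (forall z, s0 <= normc z <= s1 -> exists2 d : R, 0 < d & P [set w : C | normc (w - z) < d]) ->
  P [set z : C | s0 <= normc z <= s1].
Proof.
move=> s00 s01 PS PU Pl.
pose im (a b c d : R) : set C := [set z | exists r x, [/\ a <= r <= b, c <= x <= d & z = r%:C * cis x]].
have : P (im s0 s1 0 (2 * pi)).
  apply: (@rect_induction (fun a b c d => P (im a b c d))) => //.
  - exact: ltW (pi2_gt0 R).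
  - move=> a b c d P1 P2 P3 P4; apply: PS (PU _ _ (PU _ _ P1 P2) (PU _ _ P3 P4)).
    move=> z [r [x [/andP[ar rb] /andP[cx xd] zE]]].
    have [hr|hr] := leP r ((a + b) / 2); have [hx|hx] := leP x ((c + d) / 2).
    + by left; left; exists r, x; rewrite ar hr cx hx.
    + by right; left; exists r, x; rewrite ar hr (ltW hx) xd.
    + by left; right; exists r, x; rewrite (ltW hr) rb cx hx.
    + by right; right; exists r, x; rewrite (ltW hr) rb (ltW hx) xd.
  - move=> p q /andP[sp ps] hq; have p0 := le_trans s00 sp.
    have [|d d0 Pd] := Pl (p%:C * cis q).
      by rewrite normcM normc_cis mulr1 normc_real ger0_norm// sp.
    (* Lipschitz constant of polar coordinates at radius p, the 2 being that of [cis_lipschitz]. *)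
    pose L := 1 + 2 * p; have L0 : 0 < L by rewrite ltr_pwDl// mulr_ge0.
    exists (d / (2 * L)); first by rewrite divr_gt0// mulr_gt0.
    move=> a b c e /andP[ap pb] /andP[cq qe] ba ec; apply: PS Pd.
    move=> _ [r [x [/andP[ar rb] /andP[cx xe] ->]]].
    change (normc (r%:C * cis x - p%:C * cis q) < d).
    have -> : r%:C * cis x - p%:C * cis q = (r - p)%:C * cis x + p%:C * (cis x - cis q) :> C.
      by rewrite rmorphB/=; ring.
    apply: le_lt_trans (ler_normcD _ _) _.
    rewrite !normcM normc_cis mulr1 !normc_real (ger0_norm p0).
    have h1 : `|r - p| < d / (2 * L) by rewrite ltr_norml; apply/andP; split; lra.
    have h2 : `|x - q| < d / (2 * L) by rewrite ltr_norml; apply/andP; split; lra.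
    have h3 : p * normc (cis x - cis q) <= 2 * p * (d / (2 * L)).
      rewrite -mulrA mulrCA ler_wpM2l//; apply: (le_trans (cis_lipschitz _ _)).
      by rewrite ler_wpM2l// ltW.
    apply: lt_le_trans (ltr_leD h1 h3) _.
    have -> : d / (2 * L) + 2 * p * (d / (2 * L)) = d / 2.
      have gen (X : R) : X + 2 * p * X = L * X by rewrite /L; ring.
      by rewrite gen; field; rewrite gt_eqF.
    by rewrite ler_pdivrMr// ler_peMr ?ler1n// ltW.
apply: PS => z hz; have [x /andP[x0 x2] zE] := polar_rep z.
by exists (normc z), x; split => //; rewrite x0 ltW.
Qed.

End PolarCoordinates.

(** * Local orders at zeros and poles *)

Section Meromorphic.
Variable R : realType.
Local Notation C := (R[i]^o).
Implicit Types (f g h : C -> C) (z w : C).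

Definition regular f z := holomorphic_at f z /\ f z != 0.

(** The order is a - b. A pair of exponents avoids negative powers; neither is required to vanish,
    and the value of [f] at [z] itself is ignored. *)
Definition has_order f z (a b : nat) := exists2 g, regular g z &
  \forall w \near z^', f w * (w - z) ^+ b = g w * (w - z) ^+ a.

Lemma holomorphic_atM f g z : holomorphic_at f z -> holomorphic_at g z ->
  holomorphic_at (fun w => f w * g w) z.
Proof. by apply: filterS2 => w; exact: derivableM. Qed.

Lemma holomorphic_at_cst (c : C) z : holomorphic_at (fun=> c) z.
Proof. by apply/nbhs_normcP; exists 1 => // w _; exact: derivable_cst. Qed.

Lemma holomorphic_at_shift (c : C) z : holomorphic_at (fun w => w - c) z.
Proof.
by apply/nbhs_normcP; exists 1 => // w _; apply/derivablec; exists 1; exact: is_derivec_shift.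
Qed.

Lemma holomorphic_at_continuous f z : holomorphic_at f z -> {for z, continuous f}.
Proof. by move=> /holomorphic_at_derivable; exact: derivablec_continuous. Qed.

Lemma regular_near_neq0 f z : regular f z -> \forall w \near z, f w != 0.
Proof.
move=> [/holomorphic_at_continuous/contc_normP cf fz0].
have [|d d0 fd] := cf (normc (f z)); first by rewrite normc_gt0.
apply/nbhs_normcP; exists d => // w /fd; apply: contraTneq => ->.
by rewrite sub0r normcN ltxx.
Qed.

Lemma regularV f z : regular f z -> regular (fun w => (f w)^-1) z.
Proof.
move=> rf; have [hf fz0] := rf; split; last by rewrite invr_eq0.
near=> w; apply: derivableV; first by near: w; exact: regular_near_neq0.
by near: w.
Unshelve. all: end_near. Qed.

Lemma regularM f g z : regular f z -> regular g z -> regular (fun w => f w * g w) z.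
Proof.
by move=> [hf f0] [hg g0]; split; [exact: holomorphic_atM|rewrite mulf_neq0].
Qed.

Lemma regular_shift (c : C) z : z != c -> regular (fun w => w - c) z.
Proof. by move=> zc; split; [exact: holomorphic_at_shift|rewrite subr_eq0]. Qed.

Lemma regularX f n z : regular f z -> regular (fun w => f w ^+ n) z.
Proof.
move=> rf; elim: n => [|n IH].
  by split; [exact: holomorphic_at_cst|rewrite oner_neq0].
have [h1 h2] := regularM rf IH; split; last by rewrite exprS.
by apply: filterS h1 => w; under [X in _ -> derivable X _ _]eq_fun do rewrite exprS.
Qed.

Lemma holomorphic_at_near f g z : (\forall w \near z, f w = g w) ->
  holomorphic_at f z -> holomorphic_at g z.
Proof.
move=> /near_join fg; apply: filterS2 fg => w fg /derivablec[l fl].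
by apply/derivablec; exists l; exact: is_derivec_near fl.
Qed.

Lemma regular_near f g z : (\forall w \near z, f w = g w) -> regular f z -> regular g z.
Proof.
move=> fg [hf fz]; split; first exact: holomorphic_at_near hf.
by rewrite -(nbhs_singleton fg).
Qed.

Lemma regular_open f z : regular f z -> \forall w \near z, regular f w.
Proof.
move=> rf; have [/near_join hf _] := rf.
by apply: filterS2 (regular_near_neq0 rf) hf => w; split.
Qed.

(** Gluing the Cauchy-type quotient near [z] to f(w) / (w - z) elsewhere keeps the radius unchanged,
    so that the division can be repeated indefinitely on the same disc. *)
Lemma divide_root_open f z s : 0 < s ->
  (forall w, normc (w - z) < s -> derivable f w 1) -> f z = 0 ->
  exists2 g, (forall w, normc (w - z) < s -> derivable g w 1) &
    (forall w, normc (w - z) < s -> f w = (w - z) * g w).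
Proof.
move=> s0 fs fz; have s20 : 0 < s / 2 by rewrite divr_gt0.
have s2s : s / 2 < s by rewrite ltr_pdivrMr// ltr_pMr// ltr1n.
have fs2 : derivable_disc f z (s / 2) by move=> w ws; apply: fs; exact: le_lt_trans s2s.
have [h [dh fh _]] := divide_root s20 fs2 fz.
pose g w : C := if normc (w - z) < s / 2 then h w else f w / (w - z).
have gE w : w != z -> g w = f w / (w - z).
  move=> wz; rewrite /g; case: ifPn => // ws.
  by rewrite fh// mulrAC divff ?mul1r// subr_eq0.
exists g => w ws.
  have [->|wz] := eqVneq w z.
    have z2 : normc (z - z) < s / 2 by rewrite subrr normc0.
    have /derivablec[l hl] := dh z z2; apply/derivablec; exists l.
    apply: is_derivec_near hl; apply/nbhs_normcP; exists (s / 2) => // w' w's.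
    by rewrite /g w's.
  have wz0 : w - z != 0 by rewrite subr_eq0.
  have : derivable (fun w => f w * (w - z)^-1) w 1.
    apply: derivableM; first exact: fs.
    by apply: derivableV => //; apply/derivablec; exists 1; exact: is_derivec_shift.
  move=> /derivablec[l fl]; apply/derivablec; exists l; apply: is_derivec_near fl.
  apply/nbhs_normcP; exists (normc (w - z)); first by rewrite normc_gt0.
  move=> w' w'w; rewrite gE//; apply: contraTneq w'w => ->.
  by rewrite normcB ltxx.
have [->|wz] := eqVneq w z; first by rewrite fz subrr mul0r.
by rewrite gE// mulrCA divff ?mulr1// subr_eq0.
Qed.

(** If no finite order exists, f = (w - z)^n g_n for every n on a fixed disc. Then [cauchy_bound] on
    the circle of radius s/2 gives |g_n| <= 4 M / (s/2)^n, hence |f| <= 4 M / 2^n for |w - z| < s/4,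
    and f vanishes there. *)
Lemma holomorphic_order f z : holomorphic_at f z ->
  (\forall w \near z, f w = 0) \/
  exists m, exists2 g, regular g z & \forall w \near z, f w = (w - z) ^+ m * g w.
Proof.
move=> /holomorphic_atP[s s0 fs]; have [|nz] := pselect (\forall w \near z, f w = 0); first by left.
right; apply: contrapT => nE; apply: nz.
have H m : exists2 g, (forall w, normc (w - z) < s -> derivable g w 1) &
    (forall w, normc (w - z) < s -> f w = (w - z) ^+ m * g w).
  elim: m => [|m [g dg fg]].
    by exists f => w ws; [apply: fs; exact: ltW|rewrite expr0 mul1r].
  have [gz|gz] := eqVneq (g z) 0.
    have [h dh gh] := divide_root_open s0 dg gz.
    by exists h => // w ws; rewrite fg// gh// mulrA exprSr.
  exfalso; apply: nE; exists m, g; first split => //.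
    by apply/nbhs_normcP; exists s.
  by apply/nbhs_normcP; exists s.
have s20 : 0 < s / 2 by rewrite divr_gt0.
have s2s : s / 2 < s by rewrite ltr_pdivrMr// ltr_pMr// ltr1n.
have fs2 : derivable_disc f z (s / 2) by apply: derivable_discS fs; exact: ltW.
have [M M0 fM] := circle_bounded (cont_on_circle (ltW s20) fs2).
have fM' w : normc (w - z) = s / 2 -> normc (f w) <= M.
  move=> ws; have [x /andP[x0 x2] wE] := polar_rep (w - z).
  have -> : w = z + (s / 2)%:C * cis x by rewrite -ws -wE addrC subrK.
  by apply: fM; rewrite x0 ltW.
apply/nbhs_normcP; exists (s / 4); first by rewrite divr_gt0.
move=> w ws; apply/eqP; rewrite -normc_eq0 eq_le normc_ge0 andbT leNgt.
apply/negP => fw0; have [n] := half_exp_lt (4 * M) fw0; apply/negP; rewrite -leNgt.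
have [g dg fg] := H n.
have gM w' : normc (w' - z) = s / 2 -> normc (g w') <= M / (s / 2) ^+ n.
  move=> w's; rewrite ler_pdivlMr ?exprn_gt0// -w's -normcX -normcM mulrC -fg ?w's//.
  exact: fM'.
have dg2 : derivable_disc g z (s / 2) by move=> w' w's; apply: dg; exact: le_lt_trans s2s.
have gb : normc (g w) <= 2 * (M / (s / 2) ^+ n * 2).
  apply: (cauchy_bound s20 dg2 gM); apply: (le_trans (ltW ws)).
  by rewrite -mulrA -invfM -natrM.
rewrite fg; last by apply: (lt_trans ws); lra.
rewrite normcM normcX.
apply: (@le_trans _ _ ((s / 4) ^+ n * (2 * (M / (s / 2) ^+ n * 2)))).
  apply: ler_pM => //; first by rewrite exprn_ge0.
  by rewrite lerXn2r ?nnegrE ?divr_ge0 ?(ltW s0)// ltW.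
have -> : s / 4 = s / 2 / 2 by rewrite -mulrA -invfM -natrM.
rewrite exprMn exprVn le_eqVlt; apply/orP; left; apply/eqP.
have : (s / 2) ^+ n != 0 by rewrite expf_neq0// gt_eqF.
have : (2 : R) ^+ n != 0 by rewrite expf_neq0.
by move: ((s / 2) ^+ n) (2 ^+ n) => a b b0 a0; field; rewrite a0 b0.
Qed.


Lemma near_dnbhs z (P : set C) : (\forall w \near z, P w) -> \forall w \near z^', P w.
Proof. by move=> /nbhs_normcP[d d0 H]; apply/dnbhs_normcP; exists d => // w _; exact: H. Qed.

Lemma dnbhs_filterI z (P Q : set C) : (\forall w \near z^', P w) ->
  (\forall w \near z^', Q w) -> \forall w \near z^', P w /\ Q w.
Proof.
move=> /dnbhs_normcP[d d0 H] /dnbhs_normcP[e e0 K].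
apply/dnbhs_normcP; exists (Num.min d e); first by rewrite lt_min d0.
by move=> w wz; rewrite lt_min => /andP[/H h /K k]; split; [exact: h|exact: k].
Qed.

Lemma dnbhs_filterS z (P Q : set C) : P `<=` Q -> (\forall w \near z^', P w) ->
  \forall w \near z^', Q w.
Proof.
move=> PQ /dnbhs_normcP[d d0 H]; apply/dnbhs_normcP; exists d => // w wz wd.
by apply: PQ; exact: H.
Qed.

Lemma dnbhs_witness z (P : set C) : (\forall w \near z^', P w) ->
  forall e : R, 0 < e -> exists w, [/\ P w, w != z & normc (w - z) < e].
Proof.
move=> /dnbhs_normcP[d d0 H] e e0.
pose r := Num.min d e / 2; have r0 : 0 < r by rewrite divr_gt0// lt_min d0.
have rm : r < Num.min d e by rewrite ltr_pdivrMr// ltr_pMr ?ltr1n// lt_min d0.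
move: rm; rewrite lt_min => /andP[rd re].
have wr : normc (z + r%:C - z) = r by rewrite addrAC subrr add0r normc_real gtr0_norm.
exists (z + r%:C); split; rewrite ?wr//; last by rewrite -subr_eq0 -normc_gt0 wr.
by apply: H; rewrite ?wr// -subr_eq0 -normc_gt0 wr.
Qed.

Lemma near_pole f z : pole f z -> exists2 s : R, 0 < s &
  forall w, w != z -> normc (w - z) <= s -> derivable f w 1 /\ 1 <= normc (f w).
Proof.
move=> [df /cvgryPge/(_ 1) fy].
have /dnbhs_normcP[d d0 H] := dnbhs_filterI df fy.
exists (d / 2); first by rewrite divr_gt0.
move=> w wz ws; apply: H => //; apply: (le_lt_trans ws).
by rewrite ltr_pdivrMr// ltr_pMr// ltr1n.
Qed.

(** Near a pole 1/f is bounded, so it extends holomorphically and has a zero of finite order m. If m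
    were 0, f would be bounded near [z]. *)
Lemma pole_factor f z : pole f z -> exists m, exists2 g, regular g z &
  (0 < m)%N /\ \forall w \near z^', f w * (w - z) ^+ m = g w.
Proof.
move=> pf; have [s s0 H] := near_pole pf.
pose u w : C := (f w)^-1.
have f0 w : w != z -> normc (w - z) <= s -> f w != 0.
  by move=> wz ws; have [_ f1] := H w wz ws; rewrite -normc_gt0 (lt_le_trans _ f1).
have du w : w != z -> normc (w - z) <= s -> derivable u w 1.
  by move=> wz ws; apply: derivableV; [exact: f0|have [] := H w wz ws].
have uM w : w != z -> normc (w - z) <= s -> normc (u w) <= 1.
  move=> wz ws; rewrite normcV invf_le1; first by have [] := H w wz ws.
  by rewrite normc_gt0 f0.
have [g [dg gu]] := removable_singularity s0 du uM.
have s20 : 0 < s / 2 by rewrite divr_gt0.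
have hg : holomorphic_at g z by apply/nbhs_normcP; exists (s / 2).
have s2 w : normc (w - z) < s / 2 -> normc (w - z) <= s by lra.
have gnz w : w != z -> normc (w - z) < s / 2 -> g w != 0.
  by move=> wz ws; rewrite gu// invr_eq0 f0// s2.
have [g0|[m [k rk gk]]] := holomorphic_order hg.
  have [w [gw0 wz ws]] := dnbhs_witness (near_dnbhs g0) s20.
  by move/eqP: gw0; rewrite (negbTE (gnz w wz ws)).
exists m, (fun w => (k w)^-1); first exact: regularV.
have kE : \forall w \near z^', f w * (w - z) ^+ m = (k w)^-1.
  have /dnbhs_normcP[d d0 K] := dnbhs_filterI (near_dnbhs gk) (near_dnbhs (regular_near_neq0 rk)).
  apply/dnbhs_normcP; exists (Num.min d (s / 2)); first by rewrite lt_min d0.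
  move=> w wz; rewrite lt_min => /andP[wd ws]; have [gE kw0] := K w wz wd.
  have wz0 : w - z != 0 by rewrite subr_eq0.
  have -> : f w = (g w)^-1 by rewrite gu// invrK.
  rewrite gE; move: (k w) kw0 ((w - z) ^+ m) (expf_neq0 m wz0) => a a0 b b0.
  by field; rewrite a0 b0.
split => //; rewrite lt0n; apply/eqP => m0; move: kE; rewrite m0 => kE.
have ck : {for z, continuous (fun w => (k w)^-1)}.
  by apply: holomorphic_at_continuous; have [] := regularV rk.
have [d d0 kd] := (contc_normP _ _).1 ck 1 ltr01.
have [_ /cvgryPgt/(_ (1 + normc (k z)^-1)) fy] := pf.
have [w [[fw kw] wz wd]] := dnbhs_witness (dnbhs_filterI fy kE) d0.
have := kd w wd; rewrite -kw expr0 mulr1 => h.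
have : normc (f w) <= normc (f w - (k z)^-1) + normc (k z)^-1.
  by apply: le_trans (ler_normcD _ _); rewrite subrK.
by move: fw h; lra.
Qed.

(** Extra factors w - z turn a finite limit into 0. Hence the exponent selected in [pole_mult] is
    that of the factorisation. *)
Lemma limit_unique_mult f z (m n : nat) (k l : C) : (m < n)%N ->
  (w - z) ^+ m * f w @[w --> z^'] --> k -> (w - z) ^+ n * f w @[w --> z^'] --> l -> l = 0.
Proof.
move=> mn /cvg_dnbhs_normcP fk /cvg_dnbhs_normcP fl.
apply/eqP; rewrite -normc_eq0 eq_le normc_ge0 andbT; apply/ler_addgt0Pr => e e0.
rewrite add0r; have e20 : 0 < e / 2 by rewrite divr_gt0.
have [d1 d10 h1] := fk 1 ltr01; have [d2 d20 h2] := fl _ e20.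
pose d3 := e / 2 / (1 + normc k).
have d30 : 0 < d3 by rewrite divr_gt0// ltr_pwDl.
have [w [[[[wd1 wd2] wd3] wl] wz _]] : exists w, [/\ (((normc (w - z) < d1) /\ (normc (w - z) < d2)) /\
    normc (w - z) < d3) /\ normc (w - z) < 1, w != z & normc (w - z) < 1].
  apply: (dnbhs_witness _ ltr01); apply/dnbhs_normcP; exists (Num.min (Num.min d1 d2) (Num.min d3 1)).
    by rewrite !lt_min d10 d20 d30/=.
  by move=> w wz; rewrite !lt_min => /andP[/andP[-> ->] /andP[-> ->]].
have a1 := h1 w wz wd1; have a2 := h2 w wz wd2.
have fm : normc ((w - z) ^+ m * f w) <= 1 + normc k.
  have : normc ((w - z) ^+ m * f w) <= normc ((w - z) ^+ m * f w - k) + normc k.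
    by apply: le_trans (ler_normcD _ _); rewrite subrK.
  by move: a1; lra.
have fn : normc ((w - z) ^+ n * f w) <= e / 2.
  rewrite -(subnK mn) addnS -addSn exprD -mulrA normcM normcX.
  apply: (@le_trans _ _ (d3 * (1 + normc k))); last by rewrite divfK// gt_eqF// ltr_pwDl.
  apply: ler_pM => //; first exact: exprn_ge0.
  rewrite exprS; apply: (@le_trans _ _ (d3 * 1)); last by rewrite mulr1.
  by apply: ler_pM => //; [rewrite exprn_ge0|exact: ltW|rewrite exprn_ile1// ltW].
have : normc l <= normc ((w - z) ^+ n * f w) + normc ((w - z) ^+ n * f w - l).
  by rewrite [X in _ <= _ + X]normcB; apply: le_trans (ler_normcD _ _); rewrite addrC subrK.
by move: a2 fn; lra.
Qed.

Lemma cvg_pole_factor f g z m : regular g z ->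
  (\forall w \near z^', f w * (w - z) ^+ m = g w) -> (w - z) ^+ m * f w @[w --> z^'] --> g z.
Proof.
move=> [/holomorphic_at_continuous/contc_normP cg _] fg.
apply/cvg_dnbhs_normcP => e e0; have [d d0 gd] := cg e e0.
have /dnbhs_normcP[d' d'0 H] := fg.
exists (Num.min d d'); first by rewrite lt_min d0.
by move=> w wz; rewrite lt_min => /andP[wd wd']; rewrite mulrC H//; exact: gd.
Qed.

Lemma pole_has_order f z : pole f z -> has_order f z 0 (pole_mult f z).
Proof.
move=> /pole_factor[m [g rg [m0 fg]]]; exists g => //.
have gl := cvg_pole_factor rg fg; have [_ gz0] := rg.
pose S : set nat := [set m : nat | (0 < m)%N /\
    exists2 l : C, l != 0 & (w - z) ^+ m * f w @[w --> z^'] --> l].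
have Sm : S m by split; [exact: m0|exists (g z); [exact: gz0|exact: gl]].
have [n0 [l l0 nl]] : S (pole_mult f z).
  by rewrite /pole_mult; apply: (xgetPex 0%N); exists m; exact: Sm.
have -> : pole_mult f z = m.
  case: (ltngtP (pole_mult f z) m) => // mn.
    by move/eqP: (limit_unique_mult mn nl gl); rewrite (negbTE gz0).
  by move/eqP: (limit_unique_mult mn gl nl); rewrite (negbTE l0).
by apply: dnbhs_filterS fg => w ->; rewrite expr0 mulr1.
Qed.

Definition eventually0 f z := \forall w \near z^', f w = 0.
Definition eventually_neq0 f z := \forall w \near z^', f w != 0.

Lemma eventually_excl f z : eventually0 f z -> eventually_neq0 f z -> False.
Proof.
move=> h k; have [w [[-> /eqP]]] := dnbhs_witness (dnbhs_filterI h k) ltr01.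
by [].
Qed.

(** The centre is included among the points z', so having [P] on a punctured neighbourhood is an
    open condition. *)
Lemma eventually_open (P : set C) z : (\forall w \near z^', P w) ->
  exists2 d : R, 0 < d & forall z', normc (z' - z) < d -> \forall w \near z'^', P w.
Proof.
move=> /dnbhs_normcP[d d0 H]; exists d => // z' z'd.
have [->|z'z] := eqVneq z' z; first by apply/dnbhs_normcP; exists d.
apply/dnbhs_normcP; exists (Num.min (d - normc (z' - z)) (normc (z' - z))).
  by rewrite lt_min subr_gt0 z'd normc_gt0 subr_eq0.
move=> w _; rewrite lt_min => /andP[w1 w2]; apply: H.
  by apply: contraTneq w2 => ->; rewrite normcB ltxx.
have : normc (w - z) <= normc (w - z') + normc (z' - z).
  by apply: le_trans (ler_normcD _ _); rewrite addrA subrK.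
by move: w1; lra.
Qed.

Lemma has_order_neq0 f z a b : has_order f z a b -> eventually_neq0 f z.
Proof.
move=> [g /regular_near_neq0/near_dnbhs g0 fg].
have /dnbhs_normcP[d d0 H] := dnbhs_filterI g0 fg.
apply/dnbhs_normcP; exists d => // w wz wd; have [gw fE] := H w wz wd.
apply: contraNneq gw => fw; move/eqP: fE; rewrite fw mul0r eq_sym mulf_eq0.
by rewrite expf_eq0 subr_eq0 (negbTE wz) andbF orbF.
Qed.

Lemma has_order_regular f z a b : has_order f z a b -> \forall w \near z^', regular f w.
Proof.
move=> ho; have f0 := has_order_neq0 ho; case: ho => g /regular_open/near_dnbhs rg fg.
have /dnbhs_normcP[d d0 H] := dnbhs_filterI rg fg.
have /dnbhs_normcP[e e0 K] := f0.
apply/dnbhs_normcP; exists (Num.min d e); first by rewrite lt_min d0.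
move=> w wz; rewrite lt_min => /andP[wd we]; split; last exact: K.
have [[hg _] _] := H w wz wd.
apply: (@holomorphic_at_near (fun w => g w * ((w - z) ^+ a / (w - z) ^+ b))).
  apply/nbhs_normcP; exists (Num.min (d - normc (w - z)) (normc (w - z))).
    by rewrite lt_min subr_gt0 wd normc_gt0 subr_eq0.
  move=> v; rewrite lt_min => /andP[v1 v2].
  have vz : v != z by apply: contraTneq v2 => ->; rewrite normcB ltxx.
  have vd : normc (v - z) < d.
    have : normc (v - z) <= normc (v - w) + normc (w - z).
      by apply: le_trans (ler_normcD _ _); rewrite addrA subrK.
    by move: v1; lra.
  by have [_ fE] := H v vz vd; rewrite mulrA -fE mulfK// expf_neq0// subr_eq0.
have rz := regular_shift wz.
have [hq _] := regularM (regularX a rz) (regularV (regularX b rz)).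
exact: (holomorphic_atM hg hq).
Qed.

End Meromorphic.

(** * The identity theorem and the removal of zeros and poles *)

Section Identity.
Variable R : realType.
Local Notation C := (R[i]^o).
Implicit Types (f g h : C -> C) (z w : C).

Definition mult_at f z : nat := if `[< pole f z >] then pole_mult f z else 0%N.

Lemma meromorphic_order f z : holomorphic_at f z \/ pole f z ->
  eventually0 f z \/ exists a, has_order f z a (mult_at f z).
Proof.
rewrite /mult_at; case: asboolP => [pf _|npf [hf|//]].
  by right; exists 0%N; exact: pole_has_order.
have [f0|[m [g rg fg]]] := holomorphic_order hf.
  by left; exact: near_dnbhs.
right; exists m, g => //; apply: dnbhs_filterS (near_dnbhs fg) => w ->.
by rewrite expr0 mulr1 mulrC.
Qed.

Lemma open_dnbhs (P : set C) : open [set z : C | \forall w \near z^', P w].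
Proof.
rewrite openE => z Pz; apply/nbhs_normcP.
by have [d d0 H] := eventually_open Pz; exists d.
Qed.

(** At each point [f] is either zero or nonzero on a punctured neighbourhood, and both conditions
    are open. Connectedness of [0, 1] along a path would spread local vanishing everywhere and make
    [f] constant. *)
Lemma identity_theorem f (rho : R) : meromorphic_on (punctured_disc rho) f ->
  ~ constant_on (punctured_disc rho) f ->
  forall z, punctured_disc rho z -> eventually_neq0 f z.
Proof.
move=> mf ncf z2 Dz2.
have dich z : punctured_disc rho z -> eventually0 f z \/ eventually_neq0 f z.
  move=> /mf/meromorphic_order[|[a]]; first by left.
  by move=> /has_order_neq0; right.
apply: contrapT => nz2; have {nz2} lz2 : eventually0 f z2 by case: (dich z2 Dz2).
apply: ncf; exists 0.
suff lz z : punctured_disc rho z -> eventually0 f z.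
  move=> z Dz; have fz := lz z Dz.
  have [hf|[_ /cvgryPgt/(_ 0) fy]] := mf z Dz; last first.
    have [w [[fw0]]] := dnbhs_witness (dnbhs_filterI fy fz) ltr01.
    by move=> fw _ _; move: fw0; rewrite fw normc0 ltxx.
  apply/eqP; rewrite -normc_eq0 eq_le normc_ge0 andbT; apply/ler_addgt0Pr => e e0.
  have [d d0 H] := (contc_normP f z).1 (holomorphic_at_continuous hf) e e0.
  have [w [fw _ wd]] := dnbhs_witness fz d0.
  by have := H w wd; rewrite fw sub0r normcN add0r => /ltW.
move=> Dz1.
have [x1 _ z1E] := polar_rep z; have [x2 _ z2E] := polar_rep z2.
move: Dz1 Dz2; rewrite /punctured_disc /=; set r1 := normc z; set r2 := normc z2.
move=> /andP[r10 r1r] /andP[r20 r2r].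
(* Affine in polar coordinates rather than in the plane: the modulus stays between r1 and r2, so the
   path avoids the puncture. *)
pose ga (t : R) : C := (r1 + t * (r2 - r1))%:C * cis (x1 + t * (x2 - x1)).
have cga : continuous ga.
  have caff (u v : R) : continuous (fun t : R => u + t * v).
    move=> t; apply: cvgD; first exact: cvg_cst.
    by apply: cvgM; [exact: cvg_id|exact: cvg_cst].
  move=> t; apply: (@cont_cM _ (fun t => (r1 + t * (r2 - r1))%:C) (fun t => cis (x1 + t * (x2 - x1)))).
    by apply: (@continuous_RC _ (fun t => r1 + t * (r2 - r1))); exact: caff.
  exact: (continuous_comp (caff x1 (x2 - x1) t) (@continuous_cis R _)).
have Dga t : 0 <= t <= 1 -> punctured_disc rho (ga t).
  move=> /andP[t0 t1]; rewrite /punctured_disc /mkset normcM normc_cis mulr1 normc_real.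
  have m1 := mulr_ge0 t0 (ltW r20).
  have t1' : 0 <= 1 - t by rewrite subr_ge0.
  have m2 := mulr_ge0 t1' (ltW r10).
  have E : r1 + t * (r2 - r1) = (1 - t) * r1 + t * r2 by ring.
  have p0 : 0 < r1 + t * (r2 - r1).
    rewrite E; have [->|tn0] := eqVneq t 0; first by rewrite subr0 mul1r mul0r addr0.
    by rewrite ltr_wpDl// mulr_gt0// lt_neqAle eq_sym tn0.
  rewrite gtr0_norm// p0 /= E.
  have [->|tn0] := eqVneq t 0; first by rewrite subr0 mul1r mul0r addr0.
  have h1 : (1 - t) * r1 <= (1 - t) * rho by rewrite ler_wpM2l// ltW.
  have h2 : t * r2 < t * rho by rewrite ltr_pM2l// lt_neqAle eq_sym tn0.
  have -> : rho = (1 - t) * rho + t * rho by ring.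
  exact: ler_ltD.
have ga0 : ga 0 = z by rewrite /ga !mul0r !addr0 -z1E.
have ga1 : ga 1 = z2 by rewrite /ga !mul1r !(addrC r1) !(addrC x1) !subrK -z2E.
pose B := [set t : R | 0 <= t <= 1 /\ eventually0 f (ga t)].
have BE : B = `[0, 1]%classic.
  apply: (@segment_connected R 0 1).
  - by exists 1; split; [rewrite ler01 lexx|rewrite ga1].
  - exists (ga @^-1` [set z : C | eventually0 f z]).
      by apply: open_comp; [move=> t _; exact: cga|exact: open_dnbhs].
    by apply/seteqP; split=> t; rewrite /B /= in_itv.
  - exists (~` (ga @^-1` [set z : C | eventually_neq0 f z])).
      rewrite closedC; apply: open_comp; [move=> t _; exact: cga|exact: open_dnbhs].
    apply/seteqP; split => t; rewrite /B /= in_itv => -[ht H]; split => //.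
      by move=> /(eventually_excl H).
    by case: (dich _ (Dga t ht)).
have : B 0 by rewrite BE /= in_itv/= lexx ler01.
by case=> _; rewrite ga0.
Qed.

(** At [w = p] the convention x / 0 = 0 would spoil the quotient, so the value of the regular factor
    is inserted by hand. *)
Definition strip f g p a b w : C :=
  if w == p then g p else f w * (w - p) ^+ b / (w - p) ^+ a.

Lemma strip_neq f g p a b w : w != p -> strip f g p a b w = f w * (w - p) ^+ b / (w - p) ^+ a.
Proof. by rewrite /strip => /negbTE ->. Qed.

Lemma near_neq z p : z != p -> \forall w \near z, w != p.
Proof.
move=> zp; apply/nbhs_normcP; exists (normc (p - z)); first by rewrite normc_gt0 subr_eq0 eq_sym.
by move=> w; apply: contraTneq => ->; rewrite ltxx.
Qed.

Lemma strip_regular f g p a b : regular g p ->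
  (\forall w \near p^', f w * (w - p) ^+ b = g w * (w - p) ^+ a) -> regular (strip f g p a b) p.
Proof.
move=> rg /dnbhs_normcP[d d0 fg]; apply: regular_near rg; apply/nbhs_normcP; exists d => // w wd.
rewrite /strip; case: eqVneq => [->//|wp].
by rewrite fg// mulfK// expf_neq0// subr_eq0.
Qed.

Lemma strip_regular_neq f g p a b z : z != p -> regular f z -> regular (strip f g p a b) z.
Proof.
move=> zp rf; apply: (@regular_near _ (fun w => f w * (w - p) ^+ b * ((w - p) ^+ a)^-1)).
  by apply: filterS (near_neq zp) => w wp; rewrite strip_neq.
have rp := regular_shift zp.
exact: (regularM (regularM rf (regularX b rp)) (regularV (regularX a rp))).
Qed.

Lemma strip_has_order f g p a b z a' b' : z != p -> has_order f z a' b' ->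
  has_order (strip f g p a b) z a' b'.
Proof.
move=> zp [k rk fk]; have rp := regular_shift zp.
exists (fun w => k w * (w - p) ^+ b * ((w - p) ^+ a)^-1).
  exact: (regularM (regularM rk (regularX b rp)) (regularV (regularX a rp))).
apply: dnbhs_filterS (dnbhs_filterI fk (near_dnbhs (near_neq zp))) => w [fE wp].
have := expf_neq0 a (_ : w - p != 0); rewrite subr_eq0 => /(_ wp).
rewrite strip_neq// mulrAC [_ * _ * (w - z) ^+ b']mulrAC fE.
by move: (k w) ((w - z) ^+ a') ((w - p) ^+ b) ((w - p) ^+ a) => x y u v v0; ring.
Qed.

(** Points are stripped one at a time. [D] is arbitrary so that the induction can add to it the
    point just stripped; the multiplied-out identity needs no division. *)
Lemma factor_points (ps : seq C) : forall f (za zb : C -> nat) (D : set C), uniq ps ->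
  (forall p, p \in ps -> has_order f p (za p) (zb p)) ->
  (forall z, D z -> z \notin ps -> regular f z) ->
  exists2 h, (forall z, D z \/ z \in ps -> regular h z) &
    (forall w, w \notin ps -> f w * \prod_(p <- ps) (w - p) ^+ zb p =
       h w * \prod_(p <- ps) (w - p) ^+ za p).
Proof.
elim: ps => [|p ps IH] f za zb D.
  move=> _ _ rf; exists f => [z [Dz|//]|w _]; first exact: rf.
  by rewrite !big_nil.
move=> /andP[pps ups] ho rf.
have [g rg fg] := ho p (mem_head _ _).
have [|z Dz zps|h rh fh] := IH (strip f g p (za p) (zb p)) za zb [set z | D z \/ z = p] ups.
- move=> q qps; apply: strip_has_order; first by apply: contraNneq pps => <-.
  by apply: ho; rewrite inE qps orbT.
- have [zp|zp] := eqVneq z p; first by rewrite zp; exact: strip_regular.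
  apply: strip_regular_neq => //; apply: rf; last by rewrite inE negb_or zp.
  by case: Dz => // /eqP; rewrite (negbTE zp).
exists h.
  move=> z [Dz|]; first by apply: rh; left; left.
  by rewrite inE => /orP[/eqP ->|zps]; apply: rh; [left; right|right].
move=> w; rewrite inE negb_or => /andP[wp wps].
rewrite !big_cons; have := fh w wps; rewrite strip_neq// => fE.
have wp0 : (w - p) ^+ za p != 0 by rewrite expf_neq0// subr_eq0.
move: fE wp0; set A := \prod_(_ <- _) _; set B := \prod_(_ <- _) _.
move: ((w - p) ^+ za p) ((w - p) ^+ zb p) => u v fE u0.
have -> : h w * (u * B) = u * (h w * B) by ring.
by rewrite -fE; field.
Qed.

(** Non-regular points are isolated by [has_order_regular], hence finitely many by compactness. *)
Lemma finite_nonregular f (s0 s1 : R) : 0 <= s0 -> s0 <= s1 ->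
  (forall z, s0 <= normc z <= s1 -> exists a, exists b, has_order f z a b) ->
  finite_set [set z : C | s0 <= normc z <= s1 /\ ~ regular f z].
Proof.
move=> s00 s01 ho.
have : finite_set ([set z : C | s0 <= normc z <= s1] `&` [set z | ~ regular f z]).
  apply: (@annulus_induction _ (fun A => finite_set (A `&` [set z | ~ regular f z]))) => //.
  - by move=> A B AB; apply: sub_finite_set; exact: setSI.
  - by move=> A B fA fB; rewrite setIUl finite_setU.
  - move=> z /ho[a [b hz]]; have /dnbhs_normcP[d d0 H] := has_order_regular hz.
    exists d => //; apply: (@sub_finite_set _ _ [set z]); last exact: finite_set1.
    move=> w [wd nr]; apply: contrapT => /eqP wz; apply: nr; exact: H.
by apply: sub_finite_set => z [].
Qed.

End Identity.

(** * Mean values of ln|h| on circles *)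

Section RealDerivatives.
Variable R : realType.
Local Notation C := (R[i]^o).

Lemma is_deriveRP (g : R -> R) (x l : R) : is_derive x 1 g l <->
  forall e : R, 0 < e -> exists2 d : R, 0 < d & forall y, `|y - x| < d ->
    `|g y - g x - l * (y - x)| <= e * `|y - x|.
Proof.
have key : (h^-1 *: (g (h *: 1 + x) - g x) @[h --> (0 : R)^'] --> l) <->
  forall e : R, 0 < e -> exists2 d : R, 0 < d & forall y, `|y - x| < d ->
    `|g y - g x - l * (y - x)| <= e * `|y - x|.
  have E h : h != 0 -> h^-1 *: (g (h *: 1 + x) - g x) - l = h^-1 * (g (h + x) - g x - l * h).
    move=> h0; rewrite -[X in X - l]/(h^-1 * (g (h * 1 + x) - g x)) mulr1.
    by rewrite [RHS]mulrBr [l * h]mulrC mulrA mulVf ?mul1r.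
  split => [/cvgrPdist_lt H e e0|H].
    have /nbhs_ballP[d /= d0 dP] := H e e0; exists d => // y yd.
    have [->|yx] := eqVneq y x; first by rewrite !subrr mulr0 subr0 normr0 mulr0.
    have h0 : y - x != 0 by rewrite subr_eq0.
    have := dP (y - x); rewrite /ball/= sub0r normrN => /(_ yd h0).
    rewrite distrC E// subrK normrM normfV => /ltW.
    by rewrite ler_pdivrMl ?normr_gt0// [_ * e]mulrC.
  apply/cvgrPdist_le => e e0; have [d d0 dP] := H e e0.
  apply/nbhs_ballP; exists d => //= h; rewrite /ball/= sub0r normrN => hd h0.
  have := dP (h + x); rewrite addrK => /(_ hd) gh.
  rewrite distrC E// normrM normfV ler_pdivrMl ?normr_gt0//.
  by rewrite [_ * e]mulrC.
rewrite -key; split => [[dg <-]|gl]; first exact: dg.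
have dg : derivable g x 1 by apply/cvg_ex; exists l.
by split=> //; apply/cvg_lim.
Qed.

(* Derivative of a complex-valued function of a real variable: [C] is not
   available as a normed module over [R]. *)
Definition rcderive (g : R -> C) (x : R) (l : C) :=
  forall e : R, 0 < e -> exists2 d : R, 0 < d & forall y, `|y - x| < d ->
    normc (g y - g x - l * (y - x)%:C) <= e * `|y - x|.

Lemma rcderive_Re g x l : rcderive g x l -> is_derive x 1 (fun t => Re (g t)) (Re l).
Proof.
move=> gl; apply/is_deriveRP => e e0; have [d d0 H] := gl e e0; exists d => // y yd.
apply: le_trans (H y yd); apply: le_trans (ler_Re_normc _).
case: (g y) (g x) l {gl H} => a b [a' b'] [l l']; by simpc.
Qed.

Lemma rcderive_Im g x l : rcderive g x l -> is_derive x 1 (fun t => Im (g t)) (Im l).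
Proof.
move=> gl; apply/is_deriveRP => e e0; have [d d0 H] := gl e e0; exists d => // y yd.
apply: le_trans (H y yd); apply: le_trans (ler_Im_normc _).
case: (g y) (g x) l {gl H} => a b [a' b'] [l l']; by simpc.
Qed.

Lemma rcderive_ReIm (g : R -> C) (x : R) (l : C) : is_derive x 1 (fun t => Re (g t)) (Re l) ->
  is_derive x 1 (fun t => Im (g t)) (Im l) -> rcderive g x l.
Proof.
move=> /is_deriveRP g1 /is_deriveRP g2 e e0; have e20 : 0 < e / 2 by rewrite divr_gt0.
have [d1 d10 H1] := g1 _ e20; have [d2 d20 H2] := g2 _ e20.
exists (Num.min d1 d2); first by rewrite lt_min d10.
move=> y; rewrite lt_min => /andP[/H1 h1 /H2 h2].
apply: le_trans (ler_normc_ReIm _) _; rewrite (splitr e) mulrDl.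
apply: le_trans (lerD h1 h2); case: (g y) (g x) l {g1 g2 H1 H2 h1 h2} => a b [a' b'] [l l'].
by rewrite /= !mulr0 subr0 add0r.
Qed.

Lemma rcderive_comp (h : C -> C) (g : R -> C) x (l h1 : C) :
  is_derive (g x) 1 h h1 -> rcderive g x l -> rcderive (fun t => h (g t)) x (h1 * l).
Proof.
move=> /is_derivecP hh gl e e0.
pose e1 := e / (2 * (normc l + 1)); pose e2 := Num.min 1 (e / (2 * (normc h1 + 1))).
have l1 : 0 < normc l + 1 by rewrite ltr_wpDl.
have h11 : 0 < normc h1 + 1 by rewrite ltr_wpDl.
have e10 : 0 < e1 by rewrite divr_gt0// mulr_gt0.
have e20 : 0 < e2 by rewrite lt_min ltr01 divr_gt0// mulr_gt0.
have [d1 d10 H1] := hh e1 e10; have [d2 d20 H2] := gl e2 e20.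
exists (Num.min d2 (d1 / (normc l + 1))); first by rewrite lt_min d20 divr_gt0.
move=> y; rewrite lt_min => /andP[/H2 yd2 yd1].
have gy : normc (g y - g x) <= (normc l + 1) * `|y - x|.
  have -> : g y - g x = (g y - g x - l * (y - x)%:C) + l * (y - x)%:C by rewrite subrK.
  apply: le_trans (ler_normcD _ _) _; rewrite normcM normc_real mulrDl mul1r addrC.
  rewrite lerD2l; apply: (le_trans yd2); rewrite -[leRHS]mul1r ler_wpM2r//.
  by rewrite ge_min lexx.
have gd : normc (g y - g x) < d1.
  by apply: (le_lt_trans gy); rewrite mulrC -ltr_pdivlMr.
have -> : h (g y) - h (g x) - h1 * l * (y - x)%:C =
  (h (g y) - h (g x) - h1 * (g y - g x)) + h1 * (g y - g x - l * (y - x)%:C) by ring.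
apply: le_trans (ler_normcD _ _) _; rewrite normcM.
have a1 : normc (h (g y) - h (g x) - h1 * (g y - g x)) <= e / 2 * `|y - x|.
  apply: (le_trans (H1 _ gd)); apply: (@le_trans _ _ (e1 * ((normc l + 1) * `|y - x|))).
    by rewrite ler_pM2l.
  have -> : e1 * ((normc l + 1) * `|y - x|) = e / 2 * `|y - x|; last by [].
  by rewrite /e1; field; rewrite gt_eqF.
have a2 : normc h1 * normc (g y - g x - l * (y - x)%:C) <= e / 2 * `|y - x|.
  apply: (@le_trans _ _ ((normc h1 + 1) * (e / (2 * (normc h1 + 1)) * `|y - x|))).
    apply: ler_pM => //; first by rewrite lerDl.
    by apply: (le_trans yd2); rewrite ler_wpM2r// ge_min lexx orbT.
  have -> : (normc h1 + 1) * (e / (2 * (normc h1 + 1)) * `|y - x|) = e / 2 * `|y - x|; last by [].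
  by field; rewrite gt_eqF.
by rewrite (splitr e) mulrDl; apply: lerD.
Qed.

Lemma rcderive_ln (g : R -> C) x (l : C) : g x != 0 -> rcderive g x l ->
  is_derive x 1 (fun t => ln (normc (g t))) (Re (l / g x)).
Proof.
move=> g0 gl; have d1 := rcderive_Re gl; have d2 := rcderive_Im gl.
pose N t := Re (g t) ^+ 2 + Im (g t) ^+ 2.
have NE t : N t = normc (g t) ^+ 2.
  by rewrite /N; case: (g t) => a b /=; rewrite sqr_sqrtr// addr_ge0// sqr_ge0.
have N0 : 0 < N x by rewrite NE exprn_gt0// normc_gt0.
have dN : is_derive x 1 N (2 * (Re (g x) * Re l + Im (g x) * Im l)).
  rewrite /N; apply: is_derive_eq.
  by rewrite /GRing.scale /=; ring.
have dln := is_derive1_ln N0.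
have dc : is_derive x 1 (fun t => 2^-1 * ln (N t)) (2^-1 * ((N x)^-1 * (2 * (Re (g x) * Re l + Im (g x) * Im l)))).
  by apply: (@is_deriveZ _ _ _ (fun t => ln (N t)) 2^-1); exact: is_derive1_comp.
have E : (fun t => ln (normc (g t))) = (fun t => 2^-1 * ln (N t)).
  (* The identity holds also where [g] vanishes: both sides are then 0, since ln 0 = 0. *)
  apply/funext => t; rewrite NE; have [->|gt0] := eqVneq (g t) 0.
    by rewrite normc0 expr0n/= ln0// mulr0.
  by rewrite lnXn ?normc_gt0//; lra.
rewrite E; suff -> : Re (l / g x) = 2^-1 * ((N x)^-1 * (2 * (Re (g x) * Re l + Im (g x) * Im l))) by [].
move: N0; rewrite /N; case: (g x) l {g0 gl d1 d2 dN dc} => a b [c d] /= N0.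
by field; rewrite gt_eqF.
Qed.

Lemma rint_derive (F dF : R -> R -> R) (p q u v a M : R) : u < a -> a < v ->
  (forall x y, u < x -> x < v -> p <= y <= q -> is_derive x 1 (F^~ y) (dF x y)) ->
  (forall x, u < x -> x < v -> {in `[p, q], continuous (F x)}) ->
  (forall x y, u < x -> x < v -> p <= y <= q -> `|dF x y| <= M) ->
  is_derive a 1 (fun x => rint p q (F x)) (rint p q (dF a)).
Proof.
move=> ua av dFF cF dM.
have mB : measurable `[p, q] by exact: measurable_itv.
have Ia : `]u, v[%classic a by rewrite /= in_itv/= ua.
have iF x : `]u, v[%classic x -> (@lebesgue_measure R).-integrable `[p, q] (EFin \o F x).
  by rewrite /= in_itv/= => /andP[ux xv]; apply: cont_integrable; exact: cF.
have dF1 x y : `]u, v[%classic x -> `[p, q]%classic y -> derivable (F^~ y) x 1.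
  by rewrite /= !in_itv/= => /andP[ux xv] hy; have [] := dFF x y ux xv hy.
have G0 (y : R) : 0 <= `|M| by [].
have iG : (@lebesgue_measure R).-integrable `[p, q] (EFin \o (fun=> `|M|)).
  by apply: cont_integrable; exact: cst_continuousP.
have dE x y : u < x -> x < v -> p <= y <= q -> partial1of2 F x y = dF x y.
  by move=> ux xv hy; rewrite partial1of2E; have [] := dFF x y ux xv hy.
have Gub x y : `]u, v[%classic x -> `[p, q]%classic y -> `|partial1of2 F x y| <= `|M|.
  rewrite /= !in_itv/= => /andP[ux xv] hy; rewrite dE//.
  by apply: (le_trans (dM _ _ ux xv hy)); exact: ler_norm.
have D := @derivable_under_integral R _ _ (@lebesgue_measure R) F _ mB a u v Ia iF dF1
  (fun=> `|M|) G0 iG Gub.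
apply: DeriveDef; first exact: D.
rewrite -derive1E (@differentiation_under_integral R _ _ (@lebesgue_measure R) F _ mB a u v Ia iF dF1
  (fun=> `|M|) G0 iG Gub).
apply: eq_Rintegral => y; rewrite inE /= in_itv/= => hy; exact: dE.
Qed.

Lemma bounded_on_annulus (g : C -> R) (s0 s1 : R) : 0 <= s0 -> s0 <= s1 ->
  (forall z, s0 <= normc z <= s1 -> {for z, continuous g}) ->
  exists2 M : R, 0 <= M & forall z, s0 <= normc z <= s1 -> `|g z| <= M.
Proof.
move=> s00 s01 cg.
have [M HM] : exists M : R, forall z, [set z : C | s0 <= normc z <= s1] z -> s0 <= normc z <= s1 -> `|g z| <= M.
  apply: (@annulus_induction _ (fun A => exists M : R, forall z, A z -> s0 <= normc z <= s1 -> `|g z| <= M)) => //.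
  - by move=> A B AB [M HM]; exists M => z /AB; exact: HM.
  - move=> A B [M HM] [N HN]; exists (Num.max M N) => z [/HM|/HN] H /H h.
      by rewrite le_max h.
    by rewrite le_max h orbT.
  - move=> z /cg/(@cvgrPdist_lt _ _ _ (nbhs (z : C))) => /(_ _ ltr01)/nbhs_normcP[d d0 H].
    exists d => //; exists (`|g z| + 1) => w wd _.
    have := H w wd; rewrite distrC => h.
    rewrite -[g w](subrK (g z)) (le_trans (ler_normD _ _))// addrC lerD2l.
    exact: ltW.
by exists `|M| => // z hz; apply: (le_trans (HM z hz hz)); exact: ler_norm.
Qed.

End RealDerivatives.

(** * Logarithmic coordinates and integration by parts *)

Section LogMeans.
Variable R : realType.
Local Notation C := (R[i]^o).
Implicit Types (f g h k : C -> C) (z w : C).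

Definition logc z : R := ln (normc z).

Lemma continuous_logc z : z != 0 -> {for z, continuous logc}.
Proof.
move=> z0; have n0 : 0 < normc z by rewrite normc_gt0.
exact: (continuous_comp (@continuous_normc R z) (continuous_ln n0)).
Qed.

(** z d/dz is differentiation with respect to log z; it is single-valued on an annulus although log
    z is not. *)
Definition zderive k z : C := z * derive1 k z.

Lemma zderive_continuous k z : holomorphic_at k z -> {for z, continuous (zderive k)}.
Proof.
move=> hk; apply: holomorphic_at_continuous; apply: holomorphic_atM.
  by apply/nbhs_normcP; exists 1 => // w _; exact: derivable_id.
exact: holomorphic_at_derive1.
Qed.

Definition logder h z : C := zderive h z / h z.

Lemma holomorphic_at_id z : holomorphic_at id z.
Proof. by apply/nbhs_normcP; exists 1 => // w _; exact: derivable_id. Qed.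

Lemma logder_holomorphic h z : regular h z -> holomorphic_at (logder h) z.
Proof.
move=> rh; have [hh _] := rh; have [hV _] := regularV rh.
apply: holomorphic_atM hV; apply: holomorphic_atM (holomorphic_at_id z) _.
exact: holomorphic_at_derive1.
Qed.

Definition expcis (x phi : R) : C := (expR x)%:C * cis phi.

Lemma normc_expcis x phi : normc (expcis x phi) = expR x.
Proof. by rewrite normcM normc_cis mulr1 normc_real ger0_norm// expR_ge0. Qed.

Lemma continuous_expcis x : continuous (expcis x).
Proof. exact: cont_scis. Qed.

Lemma rcderive_expcis_l phi x : rcderive (expcis ^~ phi) x (expcis x phi).
Proof.
have E : expcis^~ phi = (fun t => (expR t * cos phi) +i* (expR t * sin phi)).
  by apply/funext => t; rewrite /expcis -polarE.
have D (c : R) : is_derive x 1 (fun t : R => expR t * c) (expR x * c).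
  by apply: is_derive_eq; rewrite /GRing.scale/= mulr0 add0r mulrC.
by rewrite /expcis -polarE -/(expcis _ _) E; apply: rcderive_ReIm; exact: D.
Qed.

Lemma rcderive_expcis_r x phi : rcderive (expcis x) phi ('i * expcis x phi).
Proof.
have E : expcis x = (fun t => (expR x * cos t) +i* (expR x * sin t)).
  by apply/funext => t; rewrite /expcis -polarE.
have -> : 'i * expcis x phi = (- (expR x * sin phi)) +i* (expR x * cos phi) :> C.
  by rewrite E; simpc.
rewrite E; apply: rcderive_ReIm => /=.
by rewrite -mulrN; apply: (@is_deriveZ _ _ _ (@cos R) (expR x)).
Qed.

Lemma cont_circleR (g : C -> R) x phi : {for expcis x phi, continuous g} ->
  {for phi, continuous (fun t => g (expcis x t))}.
Proof. by move=> cg; apply: (@continuous_comp _ _ _ (expcis x) g); [exact: continuous_expcis|]. Qed.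

Section IntegrationByParts.
Variables (h k : C -> C) (s0 s1 : R).
Hypothesis s00 : 0 <= s0.
Hypothesis rh : forall z, s0 < normc z < s1 -> regular h z.
Hypothesis hk : forall z, s0 < normc z < s1 -> holomorphic_at k z.

Let contRe (g : C -> C) z : {for z, continuous g} -> {for z, continuous (fun w => Re (g w))}.
Proof. by move=> cg; apply: (@continuous_comp _ _ _ g); [|exact: continuousRe]. Qed.

Let contIm (g : C -> C) z : {for z, continuous g} -> {for z, continuous (fun w => Im (g w))}.
Proof. by move=> cg; apply: (@continuous_comp _ _ _ g); [|exact: continuousIm]. Qed.

Let contlog z : s0 < normc z < s1 -> {for z, continuous (fun w => logc (h w))}.
Proof.
move=> hz; have [hh h0] := rh hz.
apply: (@continuous_comp _ _ _ h); first exact: holomorphic_at_continuous.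
exact: continuous_logc.
Qed.

Let contG z : s0 < normc z < s1 -> {for z, continuous (logder h)}.
Proof. by move=> hz; exact/holomorphic_at_continuous/logder_holomorphic/rh. Qed.

Let contk z : s0 < normc z < s1 -> {for z, continuous k}.
Proof. by move=> hz; exact/holomorphic_at_continuous/hk. Qed.

Let contk1 z : s0 < normc z < s1 -> {for z, continuous (zderive k)}.
Proof. by move=> hz; exact/zderive_continuous/hk. Qed.

Let contMR (g1 g2 : C -> R) z : {for z, continuous g1} -> {for z, continuous g2} ->
  {for z, continuous (fun w => g1 w * g2 w)}.
Proof. by move=> c1 c2; exact: (cvgM c1 c2). Qed.

Let contDR (g1 g2 : C -> R) z : {for z, continuous g1} -> {for z, continuous g2} ->
  {for z, continuous (fun w => g1 w + g2 w)}.
Proof. by move=> c1 c2; exact: (cvgD c1 c2). Qed.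

Let contNR (g : C -> R) z : {for z, continuous g} -> {for z, continuous (fun w => - g w)}.
Proof. by move=> c; exact: (cvgN c). Qed.

Let contMC (g1 g2 : C -> C) z : {for z, continuous g1} -> {for z, continuous g2} ->
  {for z, continuous (fun w => g1 w * g2 w)}.
Proof. by move=> c1 c2; apply: (@cvgM C _ (nbhs z)); [exact: c1|exact: c2]. Qed.

Let dF z : R := Re (logder h z) * Re (k z) + logc (h z) * Re (zderive k z).

Let contdF z : s0 < normc z < s1 -> {for z, continuous dF}.
Proof.
move=> hz; apply: contDR; apply: contMR.
- by apply: contRe; exact: contG.
- by apply: contRe; exact: contk.
- exact: contlog.
- by apply: contRe; exact: contk1.
Qed.

Let derk z : s0 < normc z < s1 -> is_derive z 1 k (derive1 k z).
Proof. by move=> /hk/holomorphic_at_derivable/derivableP; rewrite derive1E. Qed.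

Let derh z : s0 < normc z < s1 -> is_derive z 1 h (derive1 h z).
Proof. by move=> /rh[/holomorphic_at_derivable/derivableP + _]; rewrite derive1E. Qed.

Let logh_x (x phi : R) : s0 < expR x < s1 ->
  is_derive x 1 (fun t => logc (h (expcis t phi))) (Re (logder h (expcis x phi))).
Proof.
rewrite -(normc_expcis x phi) => hz; have [_ h0] := rh hz.
have := rcderive_ln h0 (@rcderive_comp R h (expcis^~ phi) x _ _ (derh hz) (rcderive_expcis_l phi x)).
by rewrite [derive1 h _ * _]mulrC.
Qed.

Let logh_phi (x phi : R) : s0 < expR x < s1 ->
  is_derive phi 1 (fun t => logc (h (expcis x t))) (- Im (logder h (expcis x phi))).
Proof.
rewrite -(normc_expcis x phi) => hz; have [_ h0] := rh hz.
have := rcderive_ln h0 (rcderive_comp (derh hz) (rcderive_expcis_r x phi)).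
rewrite mulrCA -mulrA [derive1 h _ * _]mulrC -/(zderive h _) -/(logder h _).
by case: (logder h _) => a b; simpc.
Qed.

Let rek_x (x phi : R) : s0 < expR x < s1 ->
  is_derive x 1 (fun t => Re (k (expcis t phi))) (Re (zderive k (expcis x phi))).
Proof.
rewrite -(normc_expcis x phi) => hz.
have := rcderive_Re (@rcderive_comp R k (expcis^~ phi) x _ _ (derk hz) (rcderive_expcis_l phi x)).
by rewrite [derive1 k _ * _]mulrC.
Qed.

Let imk_phi (x phi : R) : s0 < expR x < s1 ->
  is_derive phi 1 (fun t => Im (k (expcis x t))) (Re (zderive k (expcis x phi))).
Proof.
rewrite -(normc_expcis x phi) => hz.
have := rcderive_Im (rcderive_comp (derk hz) (rcderive_expcis_r x phi)).
rewrite mulrCA [derive1 k _ * _]mulrC -/(zderive k _).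
by case: (zderive k _) => a b; simpc.
Qed.

Let inann x phi : s0 < expR x < s1 -> s0 < normc (expcis x phi) < s1.
Proof. by rewrite normc_expcis. Qed.

Let parts (x : R) : s0 < expR x < s1 ->
  rint 0 (2 * pi) (fun phi => - Im (logder h (expcis x phi)) * Im (k (expcis x phi)) +
    logc (h (expcis x phi)) * Re (zderive k (expcis x phi))) = 0.
Proof.
move=> hx; pose W phi := logc (h (expcis x phi)) * Im (k (expcis x phi)).
have D phi : 0 <= phi <= 2 * pi -> is_derive phi 1 W (- Im (logder h (expcis x phi)) * Im (k (expcis x phi)) +
    logc (h (expcis x phi)) * Re (zderive k (expcis x phi))).
  move=> _; have d1 := logh_phi phi hx; have d2 := imk_phi phi hx.
  rewrite addrC [_ * Im _]mulrC; exact: (is_deriveM d1 d2).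
have cD : {in `[0, 2 * pi], continuous (fun phi => - Im (logder h (expcis x phi)) * Im (k (expcis x phi)) +
    logc (h (expcis x phi)) * Re (zderive k (expcis x phi)))}.
  move=> phi _; have hz := inann phi hx.
  apply: (@cont_circleR (fun z => - Im (logder h z) * Im (k z) + logc (h z) * Re (zderive k z))).
  apply: contDR; apply: contMR.
  + by apply: contNR; apply: contIm; exact: contG.
  + by apply: contIm; exact: contk.
  + exact: contlog.
  + by apply: contRe; exact: contk1.
rewrite (rint_FTC (ltW (pi2_gt0 R)) D cD).
have E : expcis x (2 * pi) = expcis x 0 by rewrite /expcis cis2pi.
by rewrite /W E subrr.
Qed.

(* With G = z h'/h, the partial derivatives of ln|h(e^(x + i phi))| in x and
   phi are Re G and - Im G; the term in Im G is integrated by parts in phi. *)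
Lemma log_parts (x : R) : s0 < expR x < s1 ->
  is_derive x 1 (fun x => rint 0 (2 * pi) (fun phi => logc (h (expcis x phi)) * Re (k (expcis x phi))))
    (Re (cinto (fun phi => logder h (expcis x phi) * k (expcis x phi))) +
     2 * rint 0 (2 * pi) (fun phi => logc (h (expcis x phi)) * Re (zderive k (expcis x phi)))).
Proof.
move=> hx; have /andP[h1 h2] := hx.
have ep : 0 < expR x by exact: expR_gt0.
pose eu := (s0 + expR x) / 2; pose ev := (expR x + s1) / 2.
have eu0 : 0 < eu by rewrite divr_gt0// ltr_wpDl.
have ev0 : 0 < ev by rewrite divr_gt0// addr_gt0// (lt_trans ep).
pose u := ln eu; pose v := ln ev.
have uE : expR u = eu by rewrite /u lnK.
have vE : expR v = ev by rewrite /v lnK.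
have ux : u < x by rewrite -ltr_expR uE /eu; lra.
have xv : x < v by rewrite -ltr_expR vE /ev; lra.
have uv y : u < y -> y < v -> s0 < expR y < s1.
  rewrite -ltr_expR -[y < v]ltr_expR uE vE /eu /ev; lra.
have [||M M0 HM] := @bounded_on_annulus R dF eu ev (ltW eu0).
- by rewrite /eu /ev; lra.
- by move=> z /andP[z1 z2]; apply: contdF; rewrite /eu /ev in z1 z2; lra.
have cw (g : C -> R) : (forall z, s0 < normc z < s1 -> {for z, continuous g}) ->
    forall y, s0 < expR y < s1 -> {in `[0, 2 * pi], continuous (fun phi => g (expcis y phi))}.
  by move=> cg y hy phi _; apply: cont_circleR; apply: cg; exact: inann.
have := @rint_derive R (fun x phi => logc (h (expcis x phi)) * Re (k (expcis x phi)))
  (fun x phi => dF (expcis x phi)) 0 (2 * pi) u v x M ux xv.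
have D1 y phi : u < y -> y < v -> 0 <= phi <= 2 * pi ->
    is_derive y 1 (fun x => logc (h (expcis x phi)) * Re (k (expcis x phi))) (dF (expcis y phi)).
  move=> uy yv _; have hy := uv y uy yv.
  have d1 := logh_x phi hy; have d2 := rek_x phi hy.
  rewrite /dF addrC [Re _ * Re _]mulrC; exact: (is_deriveM d1 d2).
have D2 y : u < y -> y < v ->
    {in `[0, 2 * pi], continuous (fun phi => logc (h (expcis y phi)) * Re (k (expcis y phi)))}.
  move=> uy yv; apply: (cw (fun z => logc (h z) * Re (k z))); last exact: uv.
  by move=> z hz; apply: contMR; [exact: contlog|apply: contRe; exact: contk].
have D3 y phi : u < y -> y < v -> 0 <= phi <= 2 * pi -> `|dF (expcis y phi)| <= M.
  move=> uy yv _; apply: HM; rewrite normc_expcis -uE -vE !ler_expR.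
  by rewrite (ltW uy) (ltW yv).
move=> /(_ D1 D2 D3); suff -> : rint 0 (2 * pi) (fun phi => dF (expcis x phi)) =
  Re (cinto (fun phi => logder h (expcis x phi) * k (expcis x phi))) +
  2 * rint 0 (2 * pi) (fun phi => logc (h (expcis x phi)) * Re (zderive k (expcis x phi))) by [].
have cA := cw (fun z => logc (h z) * Re (zderive k z)) (fun z hz => contMR (contlog hz) (contRe (contk1 hz))) x hx.
have cB := cw (fun z => Re (logder h z * k z))
  (fun z hz => contRe (contMC (contG hz) (contk hz))) x hx.
have cC : {in `[0, 2 * pi], continuous (fun phi => - Im (logder h (expcis x phi)) * Im (k (expcis x phi)) +
    logc (h (expcis x phi)) * Re (zderive k (expcis x phi)))}.
  apply: (cw (fun z => - Im (logder h z) * Im (k z) + logc (h z) * Re (zderive k z))) hx => z hz.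
  apply: contDR; apply: contMR.
  + by apply: contNR; apply: contIm; exact: contG.
  + by apply: contIm; exact: contk.
  + exact: contlog.
  + by apply: contRe; exact: contk1.
have cD := cw _ contdF x hx.
have cA2 : {in `[0, 2 * pi], continuous (fun phi => 2 * (logc (h (expcis x phi)) * Re (zderive k (expcis x phi))))}.
  exact: cont_rZl.
transitivity (rint 0 (2 * pi) (fun phi => dF (expcis x phi)) +
  rint 0 (2 * pi) (fun phi => - Im (logder h (expcis x phi)) * Im (k (expcis x phi)) +
    logc (h (expcis x phi)) * Re (zderive k (expcis x phi)))); first by rewrite (parts hx) addr0.
rewrite -(rintD cD cC) /cinto /cint/= -(rintZl 2 cA) -(rintD cB cA2).
apply: eq_rint => phi _; rewrite /dF.
case: (logder h _) (k _) (zderive k _) => a b [c d] [e f] /=; ring.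
Qed.

End IntegrationByParts.

End LogMeans.

(** * Means of ln|h| and of ln|z - a| over circles *)

Section Jensen.
Variable R : realType.
Local Notation C := (R[i]^o).
Implicit Types (f g h k : C -> C) (z w : C).
Let pi2_ge0 : 0 <= 2 * pi :> R. Proof. exact: ltW (pi2_gt0 R). Qed.

Lemma expcis_ln (s : R) phi : 0 < s -> expcis (ln s) phi = s%:C * cis phi.
Proof. by move=> s0; rewrite /expcis lnK. Qed.

Definition logmean h (s : R) : R := rint 0 (2 * pi) (fun phi => logc (h (s%:C * cis phi))).

Lemma derive1_cstc (c : C) z : derive1 (fun _ : C => c) z = 0.
Proof. by apply: derive1c; exact: is_derive_cst. Qed.

Lemma annulus_circle_const g (s0 s1 s t : R) : 0 <= s0 ->
  (forall z, s0 < normc z < s1 -> holomorphic_at g z) ->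
  s0 < s < s1 -> s0 < t < s1 ->
  cinto (fun phi => g (s%:C * cis phi)) = cinto (fun phi => g (t%:C * cis phi)).
Proof.
move=> s00 hg; wlog st : s t / s <= t => [H hs ht|/andP[s0s _] /andP[_ ts1]].
  by have /orP[/H|/H H'] := le_total s t; [exact|rewrite H'].
apply: cinto_annulus => //; first exact: le_lt_trans s0s.
move=> w /andP[sw wt]; apply: holomorphic_at_derivable; apply: hg.
by rewrite (lt_le_trans s0s)//= (le_lt_trans wt).
Qed.

(** By [log_parts] with k = 1, the derivative of the mean in ln s is the real part of the integral
    of z h'/h, which does not depend on s by Cauchy's theorem. The slope need not vanish, as [h] may
    wind around 0. *)
Lemma logmean_affine h (s0 s1 t0 : R) : 0 <= s0 ->
  (forall z, s0 < normc z < s1 -> regular h z) -> s0 < t0 < s1 ->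
  exists c, forall s t, s0 < s < s1 -> s0 < t < s1 ->
    logmean h s - logmean h t = c * (ln s - ln t).
Proof.
move=> s00 rh ht0.
pose c := Re (cinto (fun phi => logder h (t0%:C * cis phi))).
exists c => s t hs ht; wlog st : s t hs ht / t <= s => [H|].
  have /orP[/(H _ _ ht hs) E|] := le_total s t; last exact: H.
  by rewrite -opprB E -mulrN opprB.
have /andP[s0s ss1] := hs; have /andP[s0t ts1] := ht.
have sp := le_lt_trans s00 s0s; have tp := le_lt_trans s00 s0t.
pose F x := rint 0 (2 * pi) (fun phi => logc (h (expcis x phi)) * Re ((fun=> 1 : C) (expcis x phi))).
have FE u : 0 < u -> F (ln u) = logmean h u.
  by move=> u0; apply: eq_rint => phi _; rewrite expcis_ln// mulr1.
have dF x : s0 < expR x < s1 -> is_derive x 1 F c.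
  move=> hx; have := log_parts s00 rh (fun z _ => holomorphic_at_cst 1 z) hx.
  rewrite [X in _ + 2 * X](_ : _ = 0) ?mulr0 ?addr0; last first.
    rewrite -[RHS](mul0r (2 * pi - 0)) -rint_cst//.
    by apply: eq_rint => phi _; rewrite /zderive derive1_cstc mulr0 mulr0.
  suff -> : c = Re (cinto (fun phi => logder h (expcis x phi) * 1)) by [].
  rewrite /c -(@annulus_circle_const (logder h) s0 s1 (expR x) t0)//.
    by congr Re; apply: eq_cint => phi _; rewrite mulr1.
  by move=> z hz; apply: logder_holomorphic; exact: rh.
rewrite -FE// -FE//.
have lts : ln t <= ln s by rewrite ler_ln ?posrE.
have inr x : ln t <= x <= ln s -> s0 < expR x < s1.
  move=> /andP[tx xs]; rewrite -[X in _ < X](lnK (_ : expR x \in Num.pos)) ?posrE ?expR_gt0// expRK.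
  have h1 : t <= expR x by rewrite -[leLHS]lnK ?posrE// ler_expR.
  have h2 : expR x <= s by rewrite -[leRHS]lnK ?posrE// ler_expR.
  by rewrite (lt_le_trans s0t)//= (le_lt_trans h2).
have [||xi _ ->//] := @MVT_segment R F (fun=> c) (ln t) (ln s) lts.
- by move=> x; rewrite in_itv/= => /andP[/ltW h1 /ltW h2]; apply/dF/inr; rewrite h1.
- apply: cont_within => x; rewrite in_itv/= => /inr/dF[+ _].
  by move=> /derivable1_diffP; exact: differentiable_continuous.
Qed.

(* The mean of ln|t zeta cis phi - a| does not depend on t in [0, 1]. *)
Lemma log_mean_linear (zeta a : C) : normc zeta < normc a ->
  rint 0 (2 * pi) (fun phi => logc (zeta * cis phi - a)) = ln (normc a) * (2 * pi).
Proof.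
move=> za; have a0 : 0 < normc a by apply: le_lt_trans za.
have [->|z0] := eqVneq zeta 0.
  transitivity (rint 0 (2 * pi) (fun=> ln (normc a))); last by rewrite rint_cst// subr0.
  by apply: eq_rint => phi _; rewrite mul0r sub0r /logc normcN.
have nz0 : 0 < normc zeta by rewrite normc_gt0.
pose q := normc a / normc zeta; have q1 : 1 < q by rewrite ltr_pdivlMr// mul1r.
(* The scale t ranges over ]-1, v[ with v > 1, so that [0, 1] is interior and derivatives at its
   ends are two-sided; t < q keeps the argument of the logarithm away from 0. *)
pose v := (1 + q) / 2; have v1 : 1 < v by rewrite /v; lra.
have vq : v < q by rewrite /v; lra.
pose m := normc a - v * normc zeta.
have m0 : 0 < m by rewrite subr_gt0 -ltr_pdivlMr.
have den (t : R) (w : C) : -1 < t -> t < v -> normc w <= 1 -> m <= normc (t%:C * (zeta * w) - a).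
  move=> t1 tv w1; rewrite normcB; apply: le_trans (lerB_normc _ _); rewrite lerD2l lerN2.
  rewrite normcM normc_real; apply: ler_pM => //.
    by rewrite ler_norml; apply/andP; split; lra.
  by rewrite normcM -[leRHS]mulr1 ler_wpM2l.
have den0 (t : R) (w : C) : -1 < t -> t < v -> normc w <= 1 -> t%:C * (zeta * w) - a != 0.
  by move=> t1 tv w1; rewrite -normc_gt0 (lt_le_trans m0)// den.
have c1 phi : normc (cis phi : C) <= 1 by rewrite normc_cis.
pose F t := rint 0 (2 * pi) (fun phi => logc (t%:C * (zeta * cis phi) - a)).
pose dF (t phi : R) : R := Re (zeta * cis phi / (t%:C * (zeta * cis phi) - a)).
pose den_fun (t : R) : R -> C := fun x : R => (t%:C * (zeta * cis x) - a : C).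
have contden (t phi : R) : {for phi, continuous (den_fun t)}.
  apply: cont_cB; last exact: cvg_cst.
  by apply: cont_cM; [exact: cvg_cst|exact: cont_scis].
have derF t : -1 < t -> t < v -> is_derive t 1 F 0.
  move=> t1 tv.
  have -> : 0 = rint 0 (2 * pi) (dF t).
    pose g w : C := zeta * w / (t%:C * (zeta * w) - a).
    have dg : derivable_disc g 0 1.
      move=> w; rewrite subr0 => w1; have hn := den0 t w t1 tv w1.
      apply: derivableM; first by apply: derivableM; [exact: derivable_cst|exact: derivable_id].
      by apply: derivableV.
    have := mean_value ltr01 dg; rewrite /g mulr0 mul0r mulr0 => /(congr1 (@complex.Re R)).
    move=> E; rewrite -[LHS]/(Re (0 : C)) E; apply: (@eq_rint R) => phi _.
    by rewrite add0r mul1r.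
  apply: (@rint_derive R (fun t phi => logc (t%:C * (zeta * cis phi) - a)) dF 0 (2 * pi) (-1) v t (normc zeta / m)) => //.
  - move=> y phi y1 yv _.
    apply: (@rcderive_ln R (fun t => t%:C * (zeta * cis phi) - a)); first exact: den0.
    move=> e e0; exists 1 => // u _.
    have -> : u%:C * (zeta * cis phi) - a - (y%:C * (zeta * cis phi) - a) - zeta * cis phi * (u - y)%:C = 0.
      by rewrite rmorphB/=; ring.
    by rewrite normc0 mulr_ge0// ltW.
  - move=> y y1 yv phi _.
    have cl : {for den_fun y phi, continuous (@logc R)} by apply: continuous_logc; exact: den0.
    exact: (continuous_comp (contden y phi) cl).
  - move=> y phi y1 yv _; apply: (le_trans (ler_Re_normc _)).
    rewrite normcM normcV normcM normc_cis mulr1 ler_pM2l//.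
    by rewrite lef_pV2 ?posrE//; [exact: den|rewrite normc_gt0 den0].
have [||xi _] := @MVT_segment R F (fun=> 0) 0 1 ler01.
- by move=> x; rewrite in_itv/= => /andP[x0 x1]; apply: derF; lra.
- apply: cont_within => x; rewrite in_itv/= => /andP[x0 x1].
  have [+ _] : is_derive x 1 F 0 by apply: derF; lra.
  by move=> /derivable1_diffP; exact: differentiable_continuous.
rewrite mul0r => /eqP; rewrite subr_eq0 => /eqP FE.
have -> : rint 0 (2 * pi) (fun phi => logc (zeta * cis phi - a)) = F 1.
  by apply: eq_rint => phi _; rewrite mul1r.
rewrite FE; transitivity (rint 0 (2 * pi) (fun=> ln (normc a))); last by rewrite rint_cst// subr0.
by apply: eq_rint => phi _; rewrite mul0r sub0r /logc normcN.
Qed.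

(** For |a| < s, reflection gives |s cis phi - a| = |conj(a) cis phi - s|, which exchanges the roles
    of s and |a| and reduces to [log_mean_linear]. *)
Lemma log_mean_shift (s : R) (a : C) : 0 < s -> s != normc a ->
  logmean (fun z => z - a) s = ln (Num.max s (normc a)) * (2 * pi).
Proof.
move=> s0 sa; have [h|h] := leP s (normc a).
  by apply: log_mean_linear; rewrite normc_real gtr0_norm// lt_neqAle sa.
have E : normc s%:C = s by rewrite normc_real gtr0_norm.
transitivity (rint 0 (2 * pi) (fun phi => logc ((a^* : C) * cis phi - s%:C))).
  apply: eq_rint => phi _; rewrite /logc; congr ln.
  rewrite -(normc_conj (s%:C * cis phi - a)) -[LHS]mulr1 -(normc_cis phi) -normcM normcB.
  congr normc; have cc := cis_conj phi.
  have -> : (s%:C * cis phi - a)^* = s%:C * (cis phi)^* - a^* :> C.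
    by rewrite rmorphB rmorphM/= oppr0.
  rewrite mulrBl -mulrA [(cis phi)^* * _]mulrC cc mulr1; ring.
by rewrite log_mean_linear ?normc_conj ?E.
Qed.

Lemma rint_mul_le (v w : R -> R) (c : R) : 0 <= c ->
  {in `[0, 2 * pi], continuous v} -> {in `[0, 2 * pi], continuous w} ->
  (forall x, 0 <= x <= 2 * pi -> `|w x| <= c) ->
  `|rint 0 (2 * pi) (fun x => v x * w x)| <= c * rint 0 (2 * pi) (fun x => `|v x|).
Proof.
move=> c0 cv cw wc.
have cvw : {in `[0, 2 * pi], continuous (fun x => v x * w x)}.
  by move=> x hx; apply: cvgM; [exact: cv|exact: cw].
have cnv : {in `[0, 2 * pi], continuous (fun x => `|v x|)}.
  by move=> x hx; apply: (@continuous_comp _ _ _ v (fun y => `|y|)); [exact: cv|exact: norm_continuous].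
have b x : 0 <= x <= 2 * pi -> `|v x * w x| <= c * `|v x|.
  by move=> hx; rewrite normrM mulrC ler_wpM2r// wc.
rewrite ler_norml -rintZl//; apply/andP; split; last first.
  by apply: le_rint => //; [exact: cont_rZl|move=> x /b; rewrite ler_norml => /andP[]].
rewrite lerNl -[X in X <= _]mulN1r -rintZl//; apply: le_rint.
- exact: cont_rZl.
- exact: cont_rZl.
- by move=> x /b; rewrite mulN1r -normrN => /(le_trans (ler_norm _)).
Qed.

End Jensen.

(** * Pointwise bound for z h'/h by means of |ln|h|| *)

Section LogderBound.
Variable R : realType.
Local Notation C := (R[i]^o).
Implicit Types (f g h k : C -> C) (z w : C).
Let pi2_ge0 : 0 <= 2 * pi :> R. Proof. exact: ltW (pi2_gt0 R). Qed.

Lemma cont_on_annulus_circle g (s0 s1 s : R) : 0 <= s0 ->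
  (forall z, s0 < normc z < s1 -> holomorphic_at g z) -> s0 < s < s1 ->
  continuous (fun phi => g (s%:C * cis phi)).
Proof.
move=> s00 hg /andP[ss0 ss1] phi; apply: (@cont_comp R g (fun phi => s%:C * cis phi)).
  apply: holomorphic_at_continuous; apply: hg.
  by rewrite normcM normc_cis mulr1 normc_real gtr0_norm ?ss0// (le_lt_trans s00).
exact: cont_scis.
Qed.

Lemma holomorphic_atB_cst g (c z : C) : holomorphic_at g z -> holomorphic_at (fun w => g w - c) z.
Proof.
move=> hg; rewrite /holomorphic_at; near=> w; apply: derivableB; last exact: derivable_cst.
by near: w; exact: hg.
Unshelve. all: by end_near. Qed.

(** If Q is the difference quotient of [g] at [z0], filled in there, then w Q(w) is holomorphic on
    the annulus and has the same integral over both circles. The kernel w / (w - z0) integrates to 0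
    over the inner circle and to 2 pi over the outer one. *)
Lemma cauchy_annulus g (s0 s1 s t : R) z0 : 0 <= s0 ->
  (forall z, s0 < normc z < s1 -> holomorphic_at g z) ->
  s0 < s -> s < normc z0 -> normc z0 < t -> t < s1 ->
  (2 * pi)%:C * g z0 =
    cinto (fun phi => g (t%:C * cis phi) * (t%:C * cis phi / (t%:C * cis phi - z0))) -
    cinto (fun phi => g (s%:C * cis phi) * (s%:C * cis phi / (s%:C * cis phi - z0))).
Proof.
move=> s00 hg s0s sz zt ts1; have sp := le_lt_trans s00 s0s.
have z0z : 0 < normc z0 by apply: lt_trans sz.
have tp := lt_trans z0z zt.
have hz0 : holomorphic_at (fun w => g w - g z0) z0.
  have hgz := hg z0; rewrite (lt_trans s0s sz) (lt_trans zt ts1) in hgz.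
  exact: holomorphic_atB_cst (hgz isT).
have [d d0 dU] := (holomorphic_atP _ _).1 hz0.
have [||q dq qE] := @divide_root_open R (fun w => g w - g z0) z0 d d0.
- by move=> w /ltW; exact: dU.
- by rewrite subrr.
pose Q w : C := if w == z0 then q z0 else (g w - g z0) * (w - z0)^-1.
have hQ z : s0 < normc z < s1 -> holomorphic_at Q z.
  move=> hz; have [->|zz0] := eqVneq z z0.
    apply: (@holomorphic_at_near R q); last first.
      apply/holomorphic_atP; exists (d / 2); first by rewrite divr_gt0.
      move=> w h; apply: dq; apply: le_lt_trans h _; lra.
    apply/nbhs_normcP; exists d => // w wd; rewrite /Q; case: eqVneq => [->//|wz].
    by rewrite qE// mulrAC divff ?mul1r// subr_eq0.
  apply: (@holomorphic_at_near R (fun w => (g w - g z0) * (w - z0)^-1)).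
    by near=> w; rewrite /Q ifN//; near: w; exact: near_neq.
  apply: holomorphic_atM; last by have [] := regularV (regular_shift zz0).
  exact: holomorphic_atB_cst (hg z hz).
pose P w : C := w * Q w.
have hP z : s0 < normc z < s1 -> holomorphic_at P z.
  by move=> hz; apply: holomorphic_atM; [exact: holomorphic_at_id|exact: hQ].
have ann_s : s0 < s < s1 by rewrite s0s (lt_trans (lt_trans sz zt)).
have ann_t : s0 < t < s1 by rewrite ts1 (lt_trans (lt_trans s0s sz)).
have nc u phi : 0 < u -> normc (u%:C * cis phi : C) = u.
  by move=> u0; rewrite normcM normc_cis mulr1 normc_real gtr0_norm.
have PE u : 0 < u -> s0 < u < s1 -> u != normc z0 ->
    cinto (fun phi => P (u%:C * cis phi)) =
    cinto (fun phi => g (u%:C * cis phi) * (u%:C * cis phi / (u%:C * cis phi - z0))) -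
    g z0 * cinto (fun phi => u%:C * cis phi / (u%:C * cis phi - z0)).
  move=> u0 hu uz.
  have nz phi : u%:C * cis phi - z0 != 0.
    by rewrite subr_eq0; apply: contra uz => /eqP <-; rewrite nc.
  have cK : continuous (fun phi => (u%:C * cis phi / (u%:C * cis phi - z0) : C)).
    move=> phi; apply: cont_cM; first exact: cont_scis.
    apply: cont_cV; first exact: nz.
    by apply: cont_cB; [exact: cont_scis|exact: cvg_cst].
  have cg := cont_on_annulus_circle s00 hg hu.
  rewrite -cintZ; last by move=> phi _; exact: cK.
  rewrite -cintB; first last.
  - by move=> phi _; apply: cont_cM; [exact: cvg_cst|exact: cK].
  - by move=> phi _; apply: cont_cM; [exact: cg|exact: cK].
  apply: eq_cint => phi _; rewrite /P /Q ifN; last by rewrite -subr_eq0.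
  by rewrite mulrCA mulrBl.
have := annulus_circle_const s00 hP ann_s ann_t.
rewrite (PE s)// ?(PE t) ?(lt_eqF sz) ?(gt_eqF zt)//.
have -> : cinto (fun phi => s%:C * cis phi / (s%:C * cis phi - z0)) = 0.
  pose K w : C := w / (w - z0).
  have dK : derivable_disc K 0 s.
    move=> w; rewrite subr0 => ws; apply: derivableM; first exact: derivable_id.
    apply: derivableV; last by apply: derivableB; [exact: derivable_id|exact: derivable_cst].
    by rewrite subr_eq0; apply: contraTneq ws => ->; rewrite leNgt sz.
  have := mean_value sp dK; rewrite /K mul0r mulr0 => E; rewrite [RHS]E.
  by apply: eq_cint => phi _; rewrite add0r.
have -> : cinto (fun phi => t%:C * cis phi / (t%:C * cis phi - z0)) = (2 * pi)%:C.
  rewrite -(@cauchy_kernel R z0 0 t) ?subr0//.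
  by apply: eq_cint => phi _; rewrite add0r.
by rewrite mulr0 subr0 => ->; rewrite mulrC opprB addrC subrK.
Unshelve. all: by end_near.
Qed.

Lemma ln2_ge : 2^-1 <= ln (2 : R).
Proof.
have h : -1 < - 2^-1 :> R by lra.
have := le_ln1Dx h; have -> : 1 + - 2^-1 = 2^-1 :> R by lra.
by rewrite lnV ?posrE// lerN2.
Qed.

(** As 1 / L <= 2, |J| is at most 2 |A1 - A2| + 2 |B|, that is 8 M + 4 M. *)
Lemma mvt_arith (A1 A2 B J L M : R) : 2^-1 <= L -> `|A1| <= 2 * M -> `|A2| <= 2 * M ->
  `|B| <= 2 * M -> A1 - A2 = (J + 2 * B) * L -> `|J| <= 12 * M.
Proof.
move=> L2; have L0 : 0 < L by lra.
rewrite ler_norml => /andP[u1 u2]; rewrite ler_norml => /andP[v1 v2].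
rewrite ler_norml => /andP[b1 b2] E.
have M0 : 0 <= M by lra.
have E1 : (J + 2 * B) * L <= 4 * M by rewrite -E; lra.
have E2 : - (4 * M) <= (J + 2 * B) * L by rewrite -E; lra.
have F1 : J + 2 * B <= 8 * M by rewrite -(ler_pM2r L0) (le_trans E1)//; nra.
have F2 : - (8 * M) <= J + 2 * B by rewrite -(ler_pM2r L0) (le_trans _ E2)//; nra.
by rewrite ler_norml; apply/andP; split; lra.
Qed.

Lemma Re_circle_bound h k (s0 s1 a M J : R) : 0 <= s0 ->
  (forall z, s0 < normc z < s1 -> regular h z) ->
  (forall z, s0 < normc z < s1 -> holomorphic_at k z) ->
  s0 < a -> 2 * a < s1 ->
  (forall s, a <= s <= 2 * a -> rint 0 (2 * pi) (fun phi => `|logc (h (s%:C * cis phi))|) <= M) ->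
  (forall z, a <= normc z <= 2 * a -> normc (k z) <= 2) ->
  (forall z, a <= normc z <= 2 * a -> normc (zderive k z) <= 2) ->
  (forall s, s0 < s < s1 -> Re (cinto (fun phi => logder h (s%:C * cis phi) * k (s%:C * cis phi))) = J) ->
  `|J| <= 12 * M.
Proof.
move=> s00 rh hk s0a as1 hM k2 zk2 hJ; have a0 := le_lt_trans s00 s0a.
have a20 : 0 < 2 * a by rewrite mulr_gt0.
have l2 : ln a <= ln (2 * a) by rewrite ler_ln ?posrE//; lra.
pose A x := rint 0 (2 * pi) (fun phi => logc (h (expcis x phi)) * Re (k (expcis x phi))).
pose B x := rint 0 (2 * pi) (fun phi => logc (h (expcis x phi)) * Re (zderive k (expcis x phi))).
have inr x : ln a <= x <= ln (2 * a) -> a <= expR x <= 2 * a.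
  move=> /andP[h1 h2]; rewrite -[X in X <= _ <= _](@lnK _ a) ?posrE//.
  by rewrite -[X in _ <= _ <= X](@lnK _ (2 * a)) ?posrE// !ler_expR h1.
have inr' x : ln a <= x <= ln (2 * a) -> s0 < expR x < s1.
  by move=> /inr/andP[h1 h2]; rewrite (lt_le_trans s0a)// (le_lt_trans h2).
have dA x : ln a <= x <= ln (2 * a) -> is_derive x 1 A (J + 2 * B x).
  move=> hx; have := log_parts s00 rh hk (inr' x hx).
  by rewrite (hJ (expR x)) ?inr'.
have bnd g x : ln a <= x <= ln (2 * a) -> (forall z, s0 < normc z < s1 -> {for z, continuous g}) ->
    (forall z, a <= normc z <= 2 * a -> normc (g z) <= 2) ->
    `|rint 0 (2 * pi) (fun phi => logc (h (expcis x phi)) * Re (g (expcis x phi)))| <= 2 * M.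
  move=> hx cg g2.
  apply: (@le_trans _ _ (2 * rint 0 (2 * pi) (fun phi => `|logc (h (expcis x phi))|))).
    apply: (@rint_mul_le R (fun phi => logc (h (expcis x phi)))) => //.
    - move=> phi _; apply: (@cont_circleR R (fun z => logc (h z)) x phi).
      have [hh h0] : regular h (expcis x phi) by apply: rh; rewrite normc_expcis inr'.
      by apply: continuous_comp; [exact: holomorphic_at_continuous|exact: continuous_logc].
    - move=> phi _; apply: (@cont_circleR R (fun z => Re (g z))).
      apply: (@continuous_comp _ _ _ g); last exact: continuousRe.
      by apply: cg; rewrite normc_expcis inr'.
    - by move=> phi _; rewrite (le_trans (ler_Re_normc _))// g2// normc_expcis inr.
  by rewrite ler_pM2l//; apply: hM; exact: inr.
have bA x (hx : ln a <= x <= ln (2 * a)) : `|A x| <= 2 * M.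
  by apply: bnd => // z /hk; exact: holomorphic_at_continuous.
have bB x (hx : ln a <= x <= ln (2 * a)) : `|B x| <= 2 * M.
  by apply: (bnd (zderive k)) => // z /hk; exact: zderive_continuous.
have [||xi] := @MVT_segment R A (fun x => J + 2 * B x) _ _ l2.
- by move=> x; rewrite in_itv/= => /andP[/ltW h1 /ltW h2]; apply: dA; rewrite h1.
- apply: cont_within => x; rewrite in_itv/= => /dA[+ _].
  by move=> /derivable1_diffP; exact: differentiable_continuous.
rewrite in_itv/= => hxi; have -> : ln (2 * a) - ln a = ln 2 by rewrite lnM ?posrE// addrK.
have := bA (ln a); have := bA (ln (2 * a)); have := bB xi hxi; rewrite !lexx l2 => + /(_ isT) + /(_ isT).
by move=> b3 b2 b1 E; exact: (mvt_arith ln2_ge b2 b1 b3 E).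
Qed.

(** The imaginary part of the integral is the real part for the kernel -i k, which satisfies the
    same bounds; so 24 = 12 + 12. *)
Lemma circle_bound h k (s0 s1 a M : R) : 0 <= s0 ->
  (forall z, s0 < normc z < s1 -> regular h z) ->
  (forall z, s0 < normc z < s1 -> holomorphic_at k z) ->
  s0 < a -> 2 * a < s1 ->
  (forall s, a <= s <= 2 * a -> rint 0 (2 * pi) (fun phi => `|logc (h (s%:C * cis phi))|) <= M) ->
  (forall z, a <= normc z <= 2 * a -> normc (k z) <= 2) ->
  (forall z, a <= normc z <= 2 * a -> normc (zderive k z) <= 2) ->
  normc (cinto (fun phi => logder h (a%:C * cis phi) * k (a%:C * cis phi))) <= 24 * M.
Proof.
move=> s00 rh hk s0a as1 hM k2 zk2.
have a0 := le_lt_trans s00 s0a.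
have haa : s0 < a < s1 by rewrite s0a; lra.
have hG z : s0 < normc z < s1 -> holomorphic_at (fun w => logder h w * k w) z.
  move=> hz; apply: holomorphic_atM; last exact: hk.
  by apply: logder_holomorphic; exact: rh.
set J := cinto _.
have hJ s : s0 < s < s1 -> cinto (fun phi => logder h (s%:C * cis phi) * k (s%:C * cis phi)) = J.
  by move=> hs; apply: (annulus_circle_const s00 hG).
apply: (le_trans (ler_normc_ReIm _)).
have -> : 24 * M = 12 * M + 12 * M by lra.
apply: lerD.
  apply: (@Re_circle_bound h k s0 s1 a M _ s00 rh hk s0a as1 hM k2 zk2).
  by move=> s /hJ ->.
pose k' w : C := - 'i * k w.
have ni : normc (- 'i : C) = 1 by rewrite normcN /= expr0n expr1n add0r sqrtr1.
have hk' z : s0 < normc z < s1 -> holomorphic_at k' z.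
  by move=> hz; apply: holomorphic_atM; [exact: holomorphic_at_cst|exact: hk].
have anz z : a <= normc z <= 2 * a -> s0 < normc z < s1.
  by move=> /andP[h1 h2]; rewrite (lt_le_trans s0a)// (le_lt_trans h2).
apply: (@Re_circle_bound h k' s0 s1 a M _ s00 rh hk' s0a as1 hM).
- by move=> z hz; rewrite normcM ni mul1r k2.
- move=> z hz; suff E : derive1 k' z = - 'i * derive1 k z.
    by rewrite /zderive E mulrCA normcM ni mul1r zk2.
  apply: derive1c; apply: is_derivecZ; rewrite derive1E; apply: derivableP.
  by apply: holomorphic_at_derivable; apply: hk; exact: anz.
- move=> s hs; transitivity (Re (- 'i * J)).
    rewrite -(hJ s hs) /cinto -cintZ; last first.
      by move=> phi _; exact: (cont_on_annulus_circle s00 hG hs).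
    by congr Re; apply: eq_cint => phi _; rewrite /k' mulrCA.
  by case: (J) => x y /=; ring.
Qed.

(* For G = z h'/h and K = z / (z - z0), the integral J(s) of G K over |z| = s is
   constant on either side of |z0|, and 2 pi G(z0) is the difference of the two
   constants.  By [log_parts], Re J = A'(ln s) - 2 B(ln s) with A and B bounded
   by means of |ln|h||; the mean value theorem on [ln a, ln (2a)] bounds J. *)
Lemma logder_bound h (r M : R) z0 : 0 < r ->
  (forall z, r / 32 < normc z < 16 * r -> regular h z) ->
  (forall s, r / 16 <= s <= 8 * r -> rint 0 (2 * pi) (fun phi => `|logc (h (s%:C * cis phi))|) <= M) ->
  r / 4 <= normc z0 <= 2 * r -> normc (logder h z0) <= 12 * M.
Proof.
move=> r0 rh hM /andP[z1 z2].
have zz : 0 < normc z0 by lra.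
have hG z : r / 32 < normc z < 16 * r -> holomorphic_at (logder h) z.
  by move=> hz; apply: logder_holomorphic; exact: rh.
have r32 : 0 <= r / 32 by lra.
(* For |z0| in [r/4, 2r], the annuli [r/16, r/8] and [4r, 8r] stay a factor 2 away from |z0|; this
   gives the bound 2 for K and for z K'. *)
have := @cauchy_annulus (logder h) (r / 32) (16 * r) (r / 16) (4 * r) z0 r32 hG.
move=> /(_ ltac:(lra) ltac:(lra) ltac:(lra) ltac:(lra)) E.
pose K w : C := w / (w - z0).
have hK z : z != z0 -> holomorphic_at K z.
  move=> zn; apply: holomorphic_atM; first exact: holomorphic_at_id.
  by have [] := regularV (regular_shift zn).
have dK z : z != z0 -> zderive K z = K z * (- z0 / (z - z0)).
  move=> zn; have d0 : z - z0 != 0 by rewrite subr_eq0.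
  suff E1 : derive1 K z = - z0 / (z - z0) ^+ 2 by rewrite /zderive E1 /K; field.
  apply: derive1c.
  have D := is_derivecB (is_derive_id z (1 : C)) (is_derive_cst z0 z 1).
  have D2 := @is_derivecV R (fun w => w - z0) z _ d0 D.
  have D3 := is_derivecM (is_derive_id z (1 : C)) D2.
  suff -> : - z0 / (z - z0) ^+ 2 = 1 / (z - z0) + z * (- (1 - 0) / (z - z0) ^+ 2) :> C by exact: D3.
  by field.
have M1 s : r / 16 <= s -> s <= 8 * r -> rint 0 (2 * pi) (fun phi => `|logc (h (s%:C * cis phi))|) <= M.
  by move=> ? ?; apply: hM; apply/andP.
have dist z : `|normc z - normc z0| <= normc (z - z0).
  rewrite ler_norml lerB_normc andbT lerNl opprB normcB; exact: lerB_normc.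
have J2 : normc (cinto (fun phi => logder h ((4 * r)%:C * cis phi) * K ((4 * r)%:C * cis phi))) <= 24 * M.
  apply: (@circle_bound h K (normc z0) (16 * r)).
  - exact: ltW.
  - by move=> z /andP[h1 h2]; apply: rh; apply/andP; split; lra.
  - by move=> z /andP[h1 _]; apply: hK; apply: contraTneq h1 => ->; rewrite ltxx.
  - lra.
  - lra.
  - by move=> s /andP[h1 h2]; apply: M1; lra.
  - move=> z /andP[h1 h2]; rewrite normcM normcV.
    have := dist z; rewrite ler_norml => /andP[_ d1].
    rewrite ler_pdivrMr; lra.
  - move=> z /andP[h1 h2]; have := dist z; rewrite ler_norml => /andP[_ d1].
    rewrite dK; last by apply: contraTneq h1 => ->; rewrite -ltNge; lra.
    rewrite !normcM !normcV normcN.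
    have D : 0 < normc (z - z0) by lra.
    have q1 : normc z / normc (z - z0) <= 2 by rewrite ler_pdivrMr; lra.
    have q2 : normc z0 / normc (z - z0) <= 1 by rewrite ler_pdivrMr; lra.
    by rewrite -[leRHS]mulr1; apply: ler_pM => //; rewrite divr_ge0.
have J1 : normc (cinto (fun phi => logder h ((r / 16)%:C * cis phi) * K ((r / 16)%:C * cis phi))) <= 24 * M.
  apply: (@circle_bound h K (r / 32) (normc z0)).
  - exact: r32.
  - by move=> z /andP[h1 h2]; apply: rh; apply/andP; split; lra.
  - by move=> z /andP[_ h1]; apply: hK; apply: contraTneq h1 => ->; rewrite ltxx.
  - lra.
  - lra.
  - by move=> s /andP[h1 h2]; apply: M1; lra.
  - move=> z /andP[h1 h2]; rewrite normcM normcV.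
    have := dist z; rewrite ler_norml => /andP[d1 _].
    rewrite ler_pdivrMr; lra.
  - move=> z /andP[h1 h2]; have := dist z; rewrite ler_norml => /andP[d1 _].
    rewrite dK; last by apply: contraTneq h2 => ->; rewrite -ltNge; lra.
    rewrite !normcM !normcV normcN.
    have D : 0 < normc (z - z0) by lra.
    have q1 : normc z / normc (z - z0) <= 1 by rewrite ler_pdivrMr; lra.
    have q2 : normc z0 / normc (z - z0) <= 2 by rewrite ler_pdivrMr; lra.
    by rewrite -[leRHS]mul1r; apply: ler_pM => //; rewrite divr_ge0.
have := congr1 (@normc R) E; rewrite normcM normc_real (gtr0_norm (pi2_gt0 R)).
set u := normc (logder h z0) => E'.
have u0 : 0 <= u by exact: normc_ge0.
have U : 2 * pi * u <= 48 * M.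
  rewrite E'; apply: (le_trans (ler_normcB _ _)).
  have -> : 48 * M = 24 * M + 24 * M by lra.
  exact: lerD.
have p2 := pi_ge2 R; nra.
Qed.

End LogderBound.

(** * Jensen's formula and the growth of f *)

Section PowerBounds.
Variable R : realType.
Local Notation C := (R[i]^o).
Implicit Types (r a b tau : R) (f : C -> C).

Lemma powR_neg_ge1 r a : 0 < r -> r <= 1 -> 0 <= a -> 1 <= r `^ (- a).
Proof.
move=> r0 r1 a0; rewrite powRN -powR_inv1 ?powR_ge0// -powRrM mulrN1.
by rewrite /powR gt_eqF// -expR0 ler_expR mulNr oppr_ge0 mulr_ge0_le0// ln_le0.
Qed.

Lemma powR_neg_le r a b : 0 < r -> r <= 1 -> a <= b -> r `^ (- a) <= r `^ (- b).
Proof.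
move=> r0 r1 ab; rewrite /powR gt_eqF// ler_expR.
by rewrite !mulNr lerN2 ler_wnM2r// ln_le0.
Qed.

(** Constants are traded for exponent: r^-(b - a) outgrows any [c] as r -> 0. *)
Lemma powR_absorb (c a b : R) : a < b -> exists2 r0 : R, 0 < r0 <= 1 &
  forall r, 0 < r -> r < r0 -> c * r `^ (- a) <= r `^ (- b).
Proof.
move=> ab; have ba : 0 < b - a by rewrite subr_gt0.
(* With M >= 1 the logarithm is nonnegative, so the threshold is at most 1 whatever the sign of
   [c]. *)
pose M := Num.max 1 c; have M1 : 1 <= M by rewrite /M le_max lexx.
have M0 : 0 < M by lra.
have cM : c <= M by rewrite /M le_max lexx orbT.
exists (expR (- ln M / (b - a))).
  rewrite expR_gt0/= -expR0 ler_expR mulNr oppr_le0 divr_ge0 ?ln_ge0//.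
  exact: ltW.
move=> r r0 h; have lr : ln r < - ln M / (b - a).
  by rewrite -(@ltr_expR R) lnK.
have -> : - b = - a - (b - a) by ring.
rewrite powRD; last by rewrite (gt_eqF r0) implybT.
rewrite mulrC ler_wpM2l ?powR_ge0//; apply: (le_trans cM).
rewrite /powR gt_eqF// -[leLHS](@lnK R M) ?posrE// ler_expR.
by rewrite mulNr -mulrN mulrC -ler_pdivrMr// -lerN2 opprK -mulNr ltW.
Qed.

Lemma ln_absorb eta r : 0 < eta -> 0 < r -> - ln r <= eta^-1 * r `^ (- eta).
Proof.
move=> e0 r0; rewrite -(ler_pM2l e0) mulrA divff ?mul1r ?gt_eqF// mulrN -mulNr -ln_powR.
by apply: ltW; apply: ln_sublinear; rewrite powR_gt0.
Qed.

Lemma order_at0_ge0 (R' sigma : R) f : order_at0 R' f = sigma%:E -> 0 <= sigma.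
Proof.
move=> E; rewrite -lee_fin -E; apply: le_ereal_inf_tmp => _ [V V0 <-].
have [d d0 Vd] : exists2 d : R, 0 < d & forall r, 0 < r -> r < d -> V r.
  have [d /= d0 H] := V0; exists d => // r r0 rd; apply: H => //=.
  by rewrite sub0r normrN gtr0_norm.
pose r := Num.min (d / 2) (1 / 2).
have r0 : 0 < r by rewrite lt_min; apply/andP; split; lra.
have rd : r < d by rewrite gt_min; apply/orP; left; lra.
have r1 : r < 1 by rewrite gt_min; apply/orP; right; lra.
apply: (@le_trans _ _ (lnpe (T0 r R' f) * (- ln r)^-1%:E)%E).
  rewrite mule_ge0//; first by rewrite /lnpe le_max lexx.
  by rewrite lee_fin invr_ge0 oppr_ge0 ln_le0// ltW.
by apply: ereal_sup_ubound; exists r => //; exact: Vd.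
Qed.

Lemma T0_bound (R' sigma tau : R) f : order_at0 R' f = sigma%:E -> sigma < tau ->
  exists2 r0 : R, 0 < r0 & forall r, 0 < r -> r < r0 -> (T0 r R' f <= (r `^ (- tau))%:E)%E.
Proof.
move=> E st; have : (order_at0 R' f < tau%:E)%E by rewrite E lte_fin.
move=> /ereal_inf_lt[_ [V V0 <-] sV].
have [d d0 Vd] : exists2 d : R, 0 < d & forall r, 0 < r -> r < d -> V r.
  have [d /= d0 H] := V0; exists d => // r r0 rd; apply: H => //=.
  by rewrite sub0r normrN gtr0_norm.
exists (Num.min d 1) => [|r r0]; first by rewrite lt_min d0 ltr01.
rewrite lt_min => /andP[rd r1].
have lr : 0 < - ln r by rewrite oppr_gt0 ln_lt0// r0.
have : (lnpe (T0 r R' f) * (- ln r)^-1%:E < tau%:E)%E.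
  by apply: le_lt_trans sV; apply: ereal_sup_ubound; exists r => //; exact: Vd.
rewrite lte_pdivrMr// -EFinM /lnpe.
case: (T0 r R' f) => [x| |]/=; last by rewrite leNye.
- have [x0 _|x0] := leP x 0; first by rewrite lee_fin (le_trans x0)// powR_ge0.
  move=> h; have : ((ln x)%:E < (tau * - ln r)%:E)%E by apply: le_lt_trans h; rewrite le_max lexx orbT.
  rewrite lte_fin lee_fin => h2; rewrite /powR gt_eqF//.
  by rewrite -[leLHS](@lnK R x) ?posrE// ler_expR mulNr -mulrN ltW.
- by rewrite ltNge le_max !leey orbT.
Qed.

End PowerBounds.

(** * Jensen's formula on an annulus *)

Section JensenFormula.
Variable R : realType.
Local Notation C := (R[i]^o).
Implicit Types (f g h k : C -> C) (z w p : C) (ps : seq C) (za zb : C -> nat).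
Let pi2_ge0 : 0 <= 2 * pi :> R. Proof. exact: ltW (pi2_gt0 R). Qed.

Lemma normc_circle0 (s phi : R) : 0 <= s -> normc (s%:C * cis phi : C) = s.
Proof. by move=> s0; rewrite normcM normc_cis mulr1 normc_real ger0_norm. Qed.

Lemma circle_neq (s phi : R) p : 0 < s -> normc p != s -> s%:C * cis phi != p.
Proof. by move=> s0; apply: contra => /eqP <-; rewrite normc_circle0// ltW. Qed.

Lemma cont_logc_circle g (s phi : R) : regular g (s%:C * cis phi) ->
  {for phi, continuous (fun t => logc (g (s%:C * cis t)))}.
Proof.
move=> [hg g0].
have c1 : {for phi, continuous (fun t : R => (s%:C * cis t : C))} by exact: cont_scis.
have c2 := cont_comp (holomorphic_at_continuous hg) c1.
have c3 : {for g (s%:C * cis phi), continuous (@logc R)} by exact: continuous_logc.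
exact: (continuous_comp c2 c3).
Qed.

Lemma cont_logc_linear (s phi : R) p : 0 < s -> normc p != s ->
  {for phi, continuous (fun t => logc (s%:C * cis t - p))}.
Proof.
by move=> s0 ps; apply: (@cont_logc_circle (fun z => z - p)); apply: regular_shift; exact: circle_neq.
Qed.

Lemma rint_log_sum (c : C -> R) ps (s : R) : 0 < s -> (forall p, p \in ps -> normc p != s) ->
  (forall phi, {for phi, continuous (fun t : R => \sum_(p <- ps) c p * logc (s%:C * cis t - p))}) /\
  rint 0 (2 * pi) (fun t => \sum_(p <- ps) c p * logc (s%:C * cis t - p)) =
  \sum_(p <- ps) c p * (ln (Num.max s (normc p)) * (2 * pi)).
Proof.
move=> s0; elim: ps => [_|p ps IH hps].
  split; last first.
    rewrite big_nil -[RHS](mul0r (2 * pi - 0)) -rint_cst//.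
    by apply: eq_rint => phi _; rewrite big_nil.
  suff -> : (fun t : R => \sum_(p <- [::]) c p * logc (s%:C * cis t - p)) = fun=> 0.
    by move=> phi; exact: cvg_cst.
  by apply/funext => t; rewrite big_nil.
have [cps ips] := IH (fun q hq => hps q (mem_behead (s := p :: ps) hq)).
have ps0 := hps p (mem_head _ _).
have c1 phi : {for phi, continuous (fun t => c p * logc (s%:C * cis t - p))}.
  by apply: cvgM; [exact: cvg_cst|exact: cont_logc_linear].
split.
  suff -> : (fun t : R => \sum_(q <- p :: ps) c q * logc (s%:C * cis t - q)) =
    fun t => c p * logc (s%:C * cis t - p) + \sum_(q <- ps) c q * logc (s%:C * cis t - q).
    by move=> phi; apply: cvgD; [exact: c1|exact: cps].
  by apply/funext => t; rewrite big_cons.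
rewrite big_cons -ips -log_mean_shift 1?eq_sym// -rintZl//; last first.
  by move=> phi _; exact: cont_logc_linear.
rewrite -rintD; first by apply: eq_rint => phi _; rewrite big_cons.
- by move=> phi _; exact: c1.
- by move=> phi _; exact: cps.
Qed.

(** Separates the mean of ln|z - p| into ln s, which joins the affine term, and ln+(|p| / s), the
    contribution of [p] to an integrated counting function. *)
Lemma ln_max (s t : R) : 0 < s -> ln (Num.max s t) = ln s + lnp (t / s).
Proof.
move=> s0; have [ts|st] := leP t s; rewrite /lnp.
  rewrite (max_idPl _) ?addr0//; apply: ln_le0.
  by rewrite ler_pdivrMr// mul1r.
have t0 := lt_trans s0 st.
rewrite (max_idPr _); first by rewrite ln_div ?posrE//; ring.
by rewrite ln_ge0// ler_pdivlMr// mul1r ltW.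
Qed.

Lemma lnp_ge0 (x : R) : 0 <= lnp x. Proof. by rewrite /lnp le_max lexx. Qed.

Definition weight za zb p : R := (za p)%:R - (zb p)%:R.

Lemma logc_prod ps (n : C -> nat) w : w \notin ps ->
  normc (\prod_(p <- ps) (w - p) ^+ n p) != 0 /\
  logc (\prod_(p <- ps) (w - p) ^+ n p) = \sum_(p <- ps) (n p)%:R * logc (w - p).
Proof.
elim: ps => [_|p ps IH]; first by rewrite !big_nil normc1 /logc normc1 ln1 oner_eq0.
rewrite inE negb_or => /andP[wp /IH[n0 E]].
have wp0 : 0 < normc (w - p) by rewrite normc_gt0 subr_eq0.
have wpn : 0 < normc (w - p) ^+ n p by rewrite exprn_gt0.
rewrite !big_cons; split; first by rewrite normcM normcX mulf_neq0// gt_eqF.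
rewrite -E /logc normcM normcX lnM ?posrE//; last by rewrite lt_neqAle eq_sym n0 normc_ge0.
by rewrite lnXn// mulr_natl.
Qed.

Lemma logc_factor f h za zb ps w : w \notin ps -> h w != 0 ->
  f w * \prod_(p <- ps) (w - p) ^+ zb p = h w * \prod_(p <- ps) (w - p) ^+ za p ->
  logc (f w) = logc (h w) + \sum_(p <- ps) weight za zb p * logc (w - p).
Proof.
move=> wps h0 E; have [a0 aE] := logc_prod za wps; have [b0 bE] := logc_prod zb wps.
have pos x : normc (x : C) != 0 -> 0 < normc x by move=> x0; rewrite lt_neqAle eq_sym x0 normc_ge0.
have h0' : normc (h w) != 0 by rewrite gt_eqF// normc_gt0.
have f0 : normc (f w) != 0.
  apply: contra h0' => /eqP f0; have := congr1 (@normc R) E; rewrite !normcM f0 mul0r => /esym/eqP.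
  by rewrite mulf_eq0 (negPf a0) orbF.
have : logc (f w * \prod_(p <- ps) (w - p) ^+ zb p) = logc (h w * \prod_(p <- ps) (w - p) ^+ za p).
  by rewrite E.
rewrite {1 2}/logc !normcM !lnM ?posrE ?pos// -!/(logc _) aE bE => E2.
under eq_bigr do rewrite /weight mulrBl.
by rewrite sumrB addrA -E2 addrK.
Qed.

Lemma logmean_factor f h za zb ps (s : R) : 0 < s -> (forall p, p \in ps -> normc p != s) ->
  (forall w, normc w = s -> regular h w) ->
  (forall w, w \notin ps ->
    f w * \prod_(p <- ps) (w - p) ^+ zb p = h w * \prod_(p <- ps) (w - p) ^+ za p) ->
  logmean f s = logmean h s +
    \sum_(p <- ps) weight za zb p * (ln s + lnp (normc p / s)) * (2 * pi).
Proof.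
move=> s0 ns rh E; have [cps ips] := rint_log_sum (weight za zb) s0 ns.
have ns' phi : s%:C * cis phi \notin ps.
  by apply/negP => /ns; rewrite normc_circle0 ?eqxx// ltW.
have rc phi : regular h (s%:C * cis phi) by apply: rh; rewrite normc_circle0// ltW.
under eq_bigr do rewrite -mulrA -ln_max//.
rewrite -ips -rintD; last first.
- by move=> phi _; exact: cps.
- by move=> phi _; exact: cont_logc_circle.
by apply: eq_rint => phi _; apply: logc_factor => //; [exact: (rc phi).2|exact: E].
Qed.

(* The zero-free annulus ]t1, t2[ makes c and d independent of s0. *)
Lemma jensen f (t1 t2 : R) : 0 < t1 -> t1 < t2 ->
  (forall z, t1 < normc z < t2 -> regular f z) ->
  exists c d : R, forall s0 ps za zb, 0 < s0 -> s0 < t1 -> uniq ps ->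
    (forall p, p \in ps -> has_order f p (za p) (zb p)) ->
    (forall p, p \in ps -> normc p <= t1) ->
    (forall z, s0 < normc z < t2 -> z \notin ps -> regular f z) ->
    forall s, s0 < s < t2 -> (forall p, p \in ps -> normc p != s) ->
    logmean f s = c * ln s + d + 2 * pi * \sum_(p <- ps) weight za zb p * lnp (normc p / s).
Proof.
move=> t10 t12 rf; pose u := t1 + (t2 - t1) / 3; pose v := t1 + (t2 - t1) * (2 / 3).
have hu : t1 < u < t2 by rewrite /u; apply/andP; split; lra.
have hv : t1 < v < t2 by rewrite /v; apply/andP; split; lra.
have uv : u < v by rewrite /u /v; lra.
have [c hc] := logmean_affine (ltW t10) rf hu.
exists c, (logmean f u - c * ln u) => s0 ps za zb s00 s0t ups ord lps reg s hs ns.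
have [h rh E] := factor_points (D := [set z : C | s0 < normc z < t2]) ups ord reg.
have rh' z : s0 < normc z < t2 -> regular h z by move=> hz; apply: rh; left.
have ann t : t1 < t < t2 -> s0 < t < t2 by move=> /andP[h1 ->]; rewrite (lt_trans s0t).
have [ch hch] := logmean_affine (ltW s00) rh' (ann _ hu).
pose W := \sum_(p <- ps) weight za zb p.
have F t : s0 < t < t2 -> (forall p, p \in ps -> normc p != t) ->
    logmean f t = logmean h t + (2 * pi) * (W * ln t) +
      2 * pi * \sum_(p <- ps) weight za zb p * lnp (normc p / t).
  move=> ht nt; have /andP[h1 h2] := ht; have t0 := lt_trans s00 h1.
  rewrite (logmean_factor t0 nt _ E); last by move=> w wt; apply: rh'; rewrite wt.
  rewrite -addrA; congr (_ + _); rewrite -mulrDr /W mulr_suml -big_split/= mulr_sumr.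
  by apply: eq_bigr => p _; ring.
have lt0 p t : p \in ps -> t1 < t < t2 -> normc p < t.
  by move=> /lps h1 /andP[h2 _]; exact: le_lt_trans h2.
have G t : t1 < t < t2 -> logmean f t = logmean h t + (2 * pi) * (W * ln t).
  move=> ht; rewrite F; last 2 first.
  - exact: ann.
  - by move=> p hp; rewrite lt_eqF// lt0.
  rewrite big_seq big1 ?mulr0 ?addr0// => p hp.
  rewrite /lnp (max_idPl _) ?mulr0//; apply: ln_le0.
  have /andP[h1 _] := ht; rewrite ler_pdivrMr ?(lt_trans t10)// mul1r.
  by apply: ltW; exact: lt0.
(* On the zero-free annulus both means are affine in ln s, so two radii there are enough to compare
   the slope of [f] with that of [h]. *)
have luv : ln v - ln u != 0.
  by rewrite subr_eq0 gt_eqF// ltr_ln ?posrE//; lra.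
have cE : c = ch + 2 * pi * W.
  apply: (mulIf luv); rewrite -hc// !G// [RHS]mulrDl.
  by rewrite -(hch v u (ann _ hv) (ann _ hu)); ring.
rewrite F// (G u hu) cE; have := hch s u hs (ann _ hu) => /eqP; rewrite subr_eq => /eqP ->; ring.
Qed.

End JensenFormula.

(** * Comparison of N_0 and m_0 with sums and circle means *)

Section CountingIntegral.
Variable R : realType.
Local Notation C := (R[i]^o).
Local Notation mu := (@lebesgue_measure R).
Implicit Types (f g h k : C -> C) (z w p : C) (ps : seq C).
Let pi2_ge0 : 0 <= 2 * pi :> R. Proof. exact: ltW (pi2_gt0 R). Qed.

(** The integral of a nonnegative function is a supremum over the simple functions below it, hence
    monotone without measurability; in particular [pole_count] need not be shown measurable. *)
Lemma ge0_le_integral_any (D : set R) (g1 g2 : R -> \bar R) :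
  (forall x, D x -> (0 <= g1 x)%E) -> (forall x, D x -> (g1 x <= g2 x)%E) ->
  (\int[mu]_(x in D) g1 x <= \int[mu]_(x in D) g2 x)%E.
Proof.
move=> g10 g12; have g20 x : D x -> (0 <= g2 x)%E.
  by move=> Dx; apply: le_trans (g12 x Dx); exact: g10.
rewrite !ge0_integralE//; apply: ereal_sup_le => _ [h hg <-].
exists h => // x; apply: (le_trans (hg x)); rewrite /patch; case: ifPn => // /set_mem.
exact: g12.
Qed.

Lemma cont_invr (a b : R) : 0 < a -> {in `[a, b], continuous (fun x : R => x^-1)}.
Proof.
move=> a0 x; rewrite in_itv/= => /andP[ax _].
by apply: cvgV; [rewrite gt_eqF// (lt_le_trans a0)|exact: cvg_id].
Qed.

Lemma integral_invr (a b : R) : 0 < a -> a <= b ->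
  (\int[mu]_(x in `[a, b]) (x^-1)%:E)%E = (ln b - ln a)%:E.
Proof.
move=> a0 ab.
have ci := cont_invr (b := b) a0.
have D (x : R) : a <= x <= b -> is_derive x 1 (@ln R) x^-1.
  by move=> /andP[ax _]; exact/is_derive1_ln/(lt_le_trans a0).
rewrite -(rint_FTC ab D ci).
by rewrite /rint /Rintegral fineK//; apply: integrable_fin_num => //; exact: cont_integrable.
Qed.

Lemma integral_counting (s b t : R) (m : nat) : 0 < s -> t <= b ->
  ((m%:R * lnp (t / s))%:E <= \int[mu]_(x in `[s, b]) ((m%:R * (\1_(`]-oo, t]%classic) x * x^-1))%:E))%E.
Proof.
move=> s0 tb; have pos x : `[s, b]%classic x -> (0 <= ((m%:R : R) * (\1_(`]-oo, t]%classic) x * x^-1))%:E)%E.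
  rewrite /= in_itv/= => /andP[sx _]; rewrite lee_fin !mulr_ge0// ?invr_ge0 ?(le_trans (ltW s0))//.
have [st|ts] := leP s t; last first.
  rewrite /lnp (max_idPl _) ?mulr0; first exact: integral_ge0.
  by apply: ln_le0; rewrite ler_pdivrMr// mul1r ltW.
have t0 := lt_le_trans s0 st.
have -> : lnp (t / s) = ln t - ln s.
  rewrite /lnp (max_idPr _) ?ln_div ?posrE//.
  by rewrite -subr_ge0 subr0 subr_ge0 ler_ln ?posrE.
apply: (@le_trans _ _ (\int[mu]_(x in `[s, t]) ((m%:R * x^-1)%:E))%E).
  under eq_integral do rewrite EFinM.
  rewrite ge0_integralZl_EFin//.
  - by rewrite integral_invr// EFinM.
  - move=> x /=; rewrite in_itv/= => /andP[sx _]; rewrite lee_fin invr_ge0.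
    exact: le_trans (ltW s0) sx.
  - apply/measurable_EFinP; apply: subspace_continuous_measurable_fun => //.
    exact/cont_within/cont_invr.
rewrite [leLHS]integral_mkcond [leRHS]integral_mkcond; apply: ge0_le_integral_any => [x _|x _].
  rewrite /patch; case: ifPn => // /set_mem /=; rewrite in_itv/= => /andP[sx _].
  by rewrite lee_fin mulr_ge0// invr_ge0 (le_trans (ltW s0)).
rewrite /patch; case: ifPn => [/set_mem /=|_]; last first.
  by case: ifPn => // /set_mem; exact: pos.
rewrite in_itv/= => /andP[sx xt].
rewrite ifT; last by apply/mem_set; rewrite /= in_itv/= sx (le_trans xt).
by rewrite indicE mem_set ?mul1r//= in_itv.
Qed.

Lemma pole_count_ge f (t R' : R) ps : uniq ps -> (forall p, p \in ps -> normc p <= R') ->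
  ((\sum_(p <- ps) (mult_at f p)%:R * \1_(`]-oo, normc p]%classic) t)%:E <= pole_count t R' f)%E.
Proof.
move=> ups lps; apply: esum_ge.
pose qs := [seq p <- ps | (t <= normc p) && `[< pole f p >]].
exists [set` qs].
  split; first exact: finite_seq.
  by move=> p /=; rewrite mem_filter => /andP[/andP[tp /asboolP pp] /lps pR]; rewrite tp.
rewrite -fsbig_seq ?filter_uniq// sumEFin lee_fin /qs big_filter [leRHS]big_mkcond/=.
apply: ler_sum => p _; rewrite indicE mem_setE in_itv/= /mult_at.
by case: (t <= normc p); case: asboolP; rewrite /= ?mulr0 ?mulr1 ?mul0r.
Qed.

(** This inequality suffices: T_0 bounds N_0 from above, and poles outside [ps] are simply
    dropped. *)
Lemma N0_ge f (s R' : R) ps : 0 < s -> uniq ps -> (forall p, p \in ps -> normc p <= R') ->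
  ((\sum_(p <- ps) (mult_at f p)%:R * lnp (normc p / s))%:E <= N0 s R' f)%E.
Proof.
move=> s0 ups lps.
pose u p (x : R) : \bar R := ((mult_at f p)%:R * (\1_(`]-oo, normc p]%classic) x * x^-1))%:E.
apply: (@le_trans _ _ (\int[mu]_(x in `[s, R']) \sum_(p <- ps) u p x)%E).
  rewrite ge0_integral_sum//.
  - rewrite -sumEFin big_seq [leRHS]big_seq; apply: lee_sum => p pps.
    by apply: integral_counting => //; exact: lps.
  - move=> p; apply/measurable_EFinP; apply: measurable_funM => //.
    apply: measurable_funM; first exact: measurable_indic.
    apply: subspace_continuous_measurable_fun => //.
    exact/cont_within/cont_invr.
  - move=> p x /=; rewrite in_itv/= => /andP[sx _].
    by rewrite lee_fin !mulr_ge0// invr_ge0 (le_trans (ltW s0)).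
apply: ge0_le_integral_any => x /=; rewrite in_itv/= => /andP[sx _];
    have x0 := lt_le_trans s0 sx.
  by apply: sume_ge0 => p _; rewrite lee_fin !mulr_ge0// invr_ge0 ltW.
apply: (@le_trans _ _ ((\sum_(p <- ps) (mult_at f p)%:R * \1_(`]-oo, normc p]%classic) x)%:E * (x^-1)%:E)%E).
  by rewrite -EFinM sumEFin lee_fin mulr_suml; apply: ler_sum => p _; rewrite mulrA.
by apply: lee_wpmul2r; [rewrite lee_fin invr_ge0 ltW|exact: pole_count_ge].
Qed.

Lemma N0_ge0 f (s R' : R) : 0 < s -> (0 <= N0 s R' f)%E.
Proof. by move=> s0; apply: le_trans (@N0_ge f s R' [::] s0 isT _) => //; rewrite big_nil. Qed.

Lemma m0_ge0 f (s : R) : (0 <= m0 s f)%E.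
Proof.
apply: mule_ge0; first by rewrite lee_fin invr_ge0.
by apply: integral_ge0 => x _; rewrite lee_fin lnp_ge0.
Qed.

Lemma cont_lnp_circle f (s phi : R) : regular f (s%:C * cis phi) ->
  {for phi, continuous (fun t => lnp (normc (f (s%:C * cis t))))}.
Proof.
move=> rf; have c := cont_logc_circle rf.
exact: (@continuous_max R _ (fun=> 0) _ phi (cvg_cst _) c).
Qed.

Lemma m0_rint f (s : R) : 0 < s -> (forall w, normc w = s -> regular f w) ->
  m0 s f = ((2 * pi)^-1 * rint 0 (2 * pi) (fun t => lnp (normc (f (s%:C * cis t)))))%:E.
Proof.
move=> s0 rf; rewrite /m0 EFinM; congr (_ * _)%E.
under eq_integral do rewrite polarE.
rewrite /rint /Rintegral fineK//; apply: integrable_fin_num => //.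
apply: (@cont_integrable R) => x _.
by apply: (@cont_lnp_circle f); apply: rf; rewrite normc_circle0// ltW.
Qed.

(** With this form the mean of |ln|f|| needs no proximity function of 1/f: m_0 controls the term in
    ln+, Jensen's formula the term in ln. *)
Lemma normr_lnp (x : R) : `|ln x| = 2 * lnp x - ln x.
Proof.
rewrite /lnp; have [h|h] := leP 0 (ln x).
  by rewrite ger0_norm//; ring.
by rewrite ltr0_norm//; ring.
Qed.

Lemma logmean_norm f (s : R) : 0 < s -> (forall w, normc w = s -> regular f w) ->
  rint 0 (2 * pi) (fun t => `|logc (f (s%:C * cis t))|) =
  2 * rint 0 (2 * pi) (fun t => lnp (normc (f (s%:C * cis t)))) - logmean f s /\
  logmean f s <= rint 0 (2 * pi) (fun t => lnp (normc (f (s%:C * cis t)))).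
Proof.
move=> s0 rf.
have cl : {in `[0, 2 * pi], continuous (fun t => logc (f (s%:C * cis t)))}.
  by move=> x _; apply: (@cont_logc_circle R); apply: rf; rewrite normc_circle0// ltW.
have cp : {in `[0, 2 * pi], continuous (fun t => lnp (normc (f (s%:C * cis t))))}.
  by move=> x _; apply: cont_lnp_circle; apply: rf; rewrite normc_circle0// ltW.
split.
  rewrite -rintZl// -rintB//; last by apply: cont_rZl.
  by apply: eq_rint => x _; rewrite normr_lnp.
by apply: le_rint => // x _; rewrite /lnp le_max lexx orbT.
Qed.

End CountingIntegral.

(** * Growth of the zeros, the poles and the mean of |ln|f|| *)

Section Growth.
Variable R : realType.
Local Notation C := (R[i]^o).
Implicit Types (f g h k : C -> C) (z w p : C) (ps : seq C).
Let pi2_ge0 : 0 <= 2 * pi :> R. Proof. exact: ltW (pi2_gt0 R). Qed.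

Definition zero_at f p : nat := xget 0%N [set a : nat | has_order f p a (mult_at f p)].

Lemma has_order_multP f p : (exists a, has_order f p a (mult_at f p)) ->
  has_order f p (zero_at f p) (mult_at f p).
Proof. by move=> ex; exact: (xgetPex 0%N ex). Qed.

(** Supplies annuli and circles free of zeros and poles, [l] being a list of moduli. *)
Lemma avoid_seq (l : seq R) (a b : R) : a < b -> exists t1 t2,
  [/\ a <= t1, t1 < t2, t2 <= b & forall x, x \in l -> ~ (t1 < x < t2)].
Proof.
elim: l => [|x l IH] ab; first by exists a, b.
have [t1 [t2 [at1 t12 t2b H]]] := IH ab.
have [/andP[h1 h2]|h] := boolP (t1 < x < t2).
  exists t1, x; split=> //; first by apply: ltW; exact: lt_le_trans t2b.
  move=> y; rewrite inE => /predU1P[->|/H K /andP[k1 k2]]; first by rewrite ltxx andbF.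
  by apply: K; rewrite k1 (lt_trans k2).
by exists t1, t2; split=> // y; rewrite inE => /predU1P[->|/H//]; exact/negP.
Qed.

(** [has_order] says nothing about the value at [p]: holomorphy forces it to be that of the regular
    factor, and a pole is excluded because that factor is bounded. *)
Lemma has_order0_regular f p : holomorphic_at f p \/ pole f p -> has_order f p 0 0 -> regular f p.
Proof.
move=> fp [g [hg g0]]; under eq_near do rewrite !expr0 !mulr1.
move=> fg; have cg := holomorphic_at_continuous hg.
case: fp => [hf|[_ pf]].
  have E : f p = g p.
    have cf := holomorphic_at_continuous hf.
    apply/eqP; rewrite -subr_eq0 -normc_eq0 -(negbK (_ == 0)); apply/negP => n0.
    have e0 : 0 < normc (f p - g p) / 2.
      by rewrite divr_gt0// lt_neqAle eq_sym n0 normc_ge0.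
    have [d1 d10 H1] := (contc_normP _ _).1 cf _ e0.
    have [d2 d20 H2] := (contc_normP _ _).1 cg _ e0.
    have d0 : 0 < Num.min d1 d2 by rewrite lt_min d10.
    have [w [fw wp]] := dnbhs_witness fg d0.
    rewrite lt_min => /andP[/H1 k1 /H2 k2]; rewrite fw in k1.
    have : normc (f p - g p) <= normc (g w - g p) + normc (g w - f p).
      have -> : f p - g p = (g w - g p) - (g w - f p) by ring.
      exact: ler_normcB.
    by lra.
  by split=> //; rewrite E.
exfalso; have [d1 d10 H1] := (contc_normP _ _).1 cg 1 ltr01.
have /dnbhs_normcP[d2 d20 H2] : \forall w \near p^', normc (g p) + 1 < normc (f w).
  by move: pf => /cvgryPgt; apply.
have d0 : 0 < Num.min d1 d2 by rewrite lt_min d10.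
have [w [fw wp]] := dnbhs_witness fg d0.
rewrite lt_min => /andP[/H1 k1 k2]; have := H2 _ wp k2; rewrite fw.
have : normc (g w) <= normc (g w - g p) + normc (g p).
  by rewrite -[X in normc X <= _](subrK (g p)); exact: ler_normcD.
by lra.
Qed.

Lemma nonregular_order f p : holomorphic_at f p \/ pole f p ->
  has_order f p (zero_at f p) (mult_at f p) -> ~ regular f p ->
  (1 <= zero_at f p + mult_at f p)%N.
Proof.
move=> fp ord nr; rewrite lt0n; apply/negP; rewrite addn_eq0 => /andP[/eqP a0 /eqP b0].
by apply: nr; apply: has_order0_regular => //; move: ord; rewrite a0 b0.
Qed.

Section Meromorphic.
Variables (rho R' sigma tau : R) (f : C -> C).
Hypothesis R'0 : 0 < R'.
Hypothesis R'rho : R' < rho.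
Hypothesis mf : meromorphic_on (punctured_disc rho) f.
Hypothesis ncf : ~ constant_on (punctured_disc rho) f.
Hypothesis ordf : order_at0 R' f = sigma%:E.
Hypothesis sigma_tau : sigma < tau.

Lemma mero_has_order z : 0 < normc z < rho -> has_order f z (zero_at f z) (mult_at f z).
Proof.
move=> hz; apply: has_order_multP; have [e0|//] := meromorphic_order (mf hz).
by have := eventually_excl e0 (identity_theorem mf ncf hz).
Qed.

Lemma mero_nonregular (s t : R) : 0 < s -> t < rho ->
  exists ps : seq C, [/\ uniq ps,
    forall p, p \in ps -> [/\ s <= normc p, normc p <= t & ~ regular f p] &
    forall z, s <= normc z <= t -> z \notin ps -> regular f z].
Proof.
move=> s0 trho; have [st|ts] := leP s t; last first.
  by exists [::]; split=> // z /andP[h1 h2]; have := le_trans h1 h2; rewrite leNgt ts.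
have [|ps psE] := (finite_seqP _).1 (finite_nonregular (f := f) (ltW s0) st _).
  move=> z /andP[h1 h2]; exists (zero_at f z), (mult_at f z); apply: mero_has_order.
  by rewrite (lt_le_trans s0)// (le_lt_trans h2).
exists (undup ps); split; first exact: undup_uniq.
- move=> p; rewrite mem_undup => pp; have : [set` ps] p by [].
  by rewrite -psE => -[/andP[]].
- move=> z hz; rewrite mem_undup => zn; apply: contrapT => nr; move/negP: zn; apply.
  by have : [set z : C | s <= normc z <= t /\ ~ regular f z] z by []; rewrite psE.
Qed.

(** Integrated counting function of zeros and poles together: the analogue of N_0 for 1/f plus that
    for f, restricted to [ps]. *)
Definition ord_sum ps (s : R) := \sum_(p <- ps) (zero_at f p + mult_at f p)%:R * lnp (normc p / s).

(** Jensen's formula evaluates zeros minus poles. Poles are bounded by N_0 and the mean of ln|f|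
    from above by m_0, so the zeros are bounded as well, and then the mean of |ln|f||. The zero-free
    annulus between t1 and t2 is fixed once, which makes the constants independent of s0. *)
Lemma growth : exists2 t1 : R, 0 < t1 < R' & exists c r0 : R, [/\ 0 < c, 0 < r0 <= t1 &
  forall s0, 0 < s0 -> s0 < r0 -> exists ps, [/\ uniq ps,
    forall p, p \in ps -> [/\ s0 <= normc p, normc p <= t1 & ~ regular f p],
    forall z, s0 <= normc z <= t1 -> z \notin ps -> regular f z &
    forall s, s0 < s < r0 -> (forall p, p \in ps -> normc p != s) ->
      ord_sum ps s <= c * s `^ (- tau) /\
      rint 0 (2 * pi) (fun t => `|logc (f (s%:C * cis t))|) <= c * s `^ (- tau)]].
Proof.
have tau0 : 0 < tau by apply: le_lt_trans sigma_tau; exact: order_at0_ge0 ordf.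
have R0 := R'0; have Rrho := R'rho.
have R40 : 0 < R' / 4 by lra.
have R2rho : R' / 2 < rho by lra.
have [qs [_ _ qsreg]] := mero_nonregular R40 R2rho.
have R42 : R' / 4 < R' / 2 by lra.
have [t1 [t2 [at1 t12 t2b H]]] := avoid_seq [seq normc p | p <- qs] R42.
have t10 : 0 < t1 by lra.
have rf12 z : t1 < normc z < t2 -> regular f z.
  move=> hz; apply: qsreg; first by have /andP[h1 h2] := hz; apply/andP; split; lra.
  by apply/negP => zq; apply: (H (normc z)) => //; exact: map_f.
have [c [d J]] := jensen t10 t12 rf12.
have [r1 r10 hT] := T0_bound ordf sigma_tau.
exists t1; first by rewrite t10; lra.
(* 6 pi collects 4 pi from twice the mean of ln+|f| and 2 pi from the poles; |c| / tau comes from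
   -ln s <= s^-tau / tau, and |d| from s^-tau >= 1; the last 1 bounds the sum over the poles in the
   count. *)
pose K := 6 * pi + `|c| / tau + `|d| + 1.
have pi0 : 0 < pi :> R := pi_gt0 R.
have K0 : 0 < K.
  have := normr_ge0 d; have : 0 <= `|c| / tau by rewrite divr_ge0// ltW.
  by rewrite /K; lra.
pose r0 := Num.min r1 (Num.min t1 1).
exists K, r0; split=> //; first by rewrite /r0 !lt_min r10 t10 ltr01 !ge_min lexx/= orbT.
move=> s0 s00 s0r; have s0t1 : s0 < t1 by move: s0r; rewrite /r0 !lt_min => /and3P[].
have t1rho : t1 < rho by lra.
have [ps [ups hps reg]] := mero_nonregular s00 t1rho.
exists ps; split=> // s /andP[s0s sr] ns.
have sp := lt_trans s00 s0s.
move: sr; rewrite /r0 !lt_min => /and3P[sr1 st1 s1].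
have reg' z : s0 < normc z < t2 -> z \notin ps -> regular f z.
  move=> /andP[h1 h2] zn; have [h3|h3] := leP (normc z) t1.
    by apply: reg => //; rewrite (ltW h1).
  by apply: rf12; rewrite h3.
have rs w : normc w = s -> regular f w.
  move=> ws; apply: reg'; first by rewrite ws s0s (lt_trans st1).
  by apply/negP => /ns; rewrite ws eqxx.
have ordp p : p \in ps -> has_order f p (zero_at f p) (mult_at f p).
  by move=> /hps[h1 h2 _]; apply: mero_has_order; rewrite (lt_le_trans s00)// (le_lt_trans h2).
have lpt p : p \in ps -> normc p <= t1 by move=> /hps[].
have hst : s0 < s < t2 by rewrite s0s (lt_trans st1).
have := J s0 ps (zero_at f) (mult_at f) s00 s0t1 ups ordp lpt reg' s hst ns.
pose SA := \sum_(p <- ps) (zero_at f p)%:R * lnp (normc p / s).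
pose SB := \sum_(p <- ps) (mult_at f p)%:R * lnp (normc p / s).
have -> : \sum_(p <- ps) weight (zero_at f) (mult_at f) p * lnp (normc p / s) = SA - SB.
  by rewrite /SA /SB -sumrB; apply: eq_bigr => p _; rewrite /weight mulrBl.
have -> : ord_sum ps s = SA + SB.
  by rewrite /ord_sum /SA /SB -big_split; apply: eq_bigr => p _; rewrite natrD mulrDl.
have SA0 : 0 <= SA by apply: sumr_ge0 => p _; rewrite mulr_ge0// lnp_ge0.
have SB0 : 0 <= SB by apply: sumr_ge0 => p _; rewrite mulr_ge0// lnp_ge0.
have [-> Lm] := logmean_norm sp rs; move: Lm.
set P := rint _ _ _; set X := s `^ (- tau); move=> Lm LE.
have X1 : 1 <= X by apply: powR_neg_ge1 => //; [exact: ltW|exact: ltW].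
have hX : (T0 s R' f <= X%:E)%E by exact: hT.
have SBX : SB <= X.
  rewrite -lee_fin; apply: le_trans hX; rewrite /T0 -[leLHS]add0e; apply: leeD; first exact: m0_ge0.
  by apply: N0_ge => // p /lpt; lra.
have PX : P <= 2 * pi * X.
  have : (((2 * pi)^-1 * P)%:E <= X%:E)%E.
    by apply: le_trans hX; rewrite -m0_rint// /T0 leeDl// N0_ge0.
  by rewrite lee_fin mulrC ler_pdivrMr ?pi2_gt0// mulrC.
have cX : `|c * ln s| <= `|c| / tau * X.
  have ls : ln s <= 0 by apply: ln_le0; exact: ltW.
  by rewrite normrM (ler0_norm ls) -mulrA ler_wpM2l//; exact: ln_absorb.
have dX : `|d| <= `|d| * X by rewrite ler_peMr.
have := pi_ge2 R => p2.
move: cX; rewrite ler_norml => /andP[c1 c2].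
have dd1 := ler_norm d; have dd2 := ler_norm (- d); rewrite normrN in dd2.
have pS : 0 <= pi * SB by rewrite mulr_ge0// ltW.
have pA : SA <= pi * SA by rewrite ler_peMl//; lra.
have pB : pi * SB <= pi * X by rewrite ler_pM2l.
have KE : K * X = 6 * (pi * X) + `|c| / tau * X + `|d| * X + X by rewrite /K; ring.
rewrite -mulrA in PX.
have LE' : logmean f s = c * ln s + d + 2 * (pi * SA - pi * SB) by rewrite LE; ring.
rewrite KE; move: (logmean f s) (c * ln s) (pi * SA) (pi * SB) (pi * X) (`|c| / tau * X) (`|d| * X)
  LE' Lm PX c1 c2 pS pA pB dX => L cl A B Y u v LE' Lm PX c1 c2 pS pA pB dX.
by split; lra.
Qed.

End Meromorphic.
End Growth.

(** * Logarithmic derivatives near a circle *)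

Section LocalEstimate.
Variable R : realType.
Local Notation C := (R[i]^o).
Implicit Types (f g h k : C -> C) (z w p : C) (ps cs : seq C).
Let pi2_ge0 : 0 <= 2 * pi :> R. Proof. exact: ltW (pi2_gt0 R). Qed.

Lemma holomorphic_is_derive1 f z : holomorphic_at f z -> is_derive z 1 f (derive1 f z).
Proof. by move=> hf; rewrite derive1E; apply: derivableP; exact: holomorphic_at_derivable. Qed.

Lemma log_circle_derive h x phi : regular h (expcis x phi) ->
  is_derive x 1 (fun t : R => logc (h (expcis t phi))) (Re (logder h (expcis x phi))).
Proof.
move=> [hh h0]; have D := @rcderive_comp R h (fun t => expcis t phi) x _ _ (holomorphic_is_derive1 hh) (rcderive_expcis_l phi x).
have := @rcderive_ln R (fun t => h (expcis t phi)) x _ h0 D.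
by rewrite /logder /zderive [derive1 h _ * _]mulrC.
Qed.

Lemma log_circle_lipschitz h (s0 s1 a b : R) : 0 <= s0 -> s0 < a -> a <= b -> b < s1 ->
  (forall z, s0 < normc z < s1 -> regular h z) ->
  exists2 L : R, 0 <= L & forall s t phi, a <= s -> s <= t -> t <= b ->
    `|logc (h (t%:C * cis phi)) - logc (h (s%:C * cis phi))| <= L * (ln t - ln s).
Proof.
move=> s00 s0a ab bs1 rh; have a0 := le_lt_trans s00 s0a.
have [|L L0 HL] := @bounded_on_annulus R (fun z => Re (logder h z)) a b (ltW a0) ab.
  move=> z /andP[az zb]; apply: (@continuous_comp _ _ _ (logder h)); last exact: continuousRe.
  apply: holomorphic_at_continuous; apply: logder_holomorphic; apply: rh.
  by rewrite (lt_le_trans s0a)// (le_lt_trans zb).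
exists L => // s t phi as_ st tb; have sp := lt_le_trans a0 as_; have tp := lt_le_trans sp st.
have lst : ln s <= ln t by rewrite ler_ln.
have inr x : ln s <= x <= ln t -> a <= normc (expcis x phi) <= b.
  move=> /andP[h1 h2]; rewrite normc_expcis; apply/andP; split.
    by apply: (le_trans as_); rewrite -[leLHS]lnK ?posrE// ler_expR.
  by apply: le_trans tb; rewrite -[leRHS]lnK ?posrE// ler_expR.
have D x : ln s <= x <= ln t -> is_derive x 1 (fun t : R => logc (h (expcis t phi))) (Re (logder h (expcis x phi))).
  move=> /inr/andP[h1 h2]; apply: log_circle_derive; apply: rh.
  by rewrite (lt_le_trans s0a)// (le_lt_trans h2).
have [||xi hxi] := @MVT_segment R (fun t : R => logc (h (expcis t phi))) (fun x => Re (logder h (expcis x phi))) _ _ lst.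
- by move=> x; rewrite in_itv/= => /andP[/ltW h1 /ltW h2]; apply: D; rewrite h1.
- apply: cont_within => x; rewrite in_itv/= => /D[+ _].
  by move=> /derivable1_diffP; exact: differentiable_continuous.
rewrite !expcis_ln// => ->; rewrite normrM [`|ln t - ln s|]ger0_norm ?subr_ge0//.
rewrite ler_wpM2r ?subr_ge0//; apply: HL; apply: inr.
by move: hxi; rewrite in_itv.
Qed.

(** [growth] speaks only of circles free of zeros and poles of [f]. As [h] is regular, its mean is
    continuous in the radius, and the bound passes to the finitely many missing radii from the
    right. *)
Lemma log_circle_bound_all h (l : seq R) (s0 s1 a b M : R) : 0 <= s0 -> s0 < a -> a < b -> b < s1 ->
  (forall z, s0 < normc z < s1 -> regular h z) ->
  (forall s, a < s < b -> s \notin l -> rint 0 (2 * pi) (fun phi => `|logc (h (s%:C * cis phi))|) <= M) ->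
  forall s, a <= s < b -> rint 0 (2 * pi) (fun phi => `|logc (h (s%:C * cis phi))|) <= M.
Proof.
move=> s00 s0a ab bs1 rh hM s /andP[as_ sb]; have a0 := le_lt_trans s00 s0a.
have [L L0 HL] := log_circle_lipschitz s00 s0a (ltW ab) bs1 rh.
have sp := lt_le_trans a0 as_.
have cn t : a <= t <= b -> {in `[0, 2 * pi], continuous (fun phi => `|logc (h (t%:C * cis phi))|)}.
  move=> /andP[h1 h2] phi _; have rt : regular h (t%:C * cis phi).
    apply: rh; rewrite normc_circle0 ?(le_trans (ltW a0))//.
    by rewrite (lt_le_trans s0a)// (le_lt_trans h2).
  exact: (continuous_comp (cont_logc_circle rt) (@norm_continuous _ _ _)).
apply/ler_addgt0Pr => e e0.
(* Lipschitz constant of the mean at radius s, from ln t - ln s <= (t - s) / s; the 1 makes it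
   positive. *)
pose K := L * (2 * pi) / s + 1; 
have K1 : 0 <= L * (2 * pi) / s.
  by apply: divr_ge0; [apply: mulr_ge0; [exact: L0|exact: pi2_ge0]|exact: ltW].
have K0 : 0 < K by rewrite /K; lra.
have sb' : s < Num.min b (s + e / K) by rewrite lt_min sb ltrDl divr_gt0.
have [t1 [t2 [st1 t12 t2b H]]] := avoid_seq l sb'.
pose t := (t1 + t2) / 2; have t1t : t1 < t by rewrite /t; lra.
have tt2 : t < t2 by rewrite /t; lra.
have st : s < t by lra.
move: t2b; rewrite le_min => /andP[t2b t2e]; have tb : t < b by lra.
have tl : t \notin l by apply/negP => tl; apply: (H t tl); rewrite t1t.
have Mt : rint 0 (2 * pi) (fun phi => `|logc (h (t%:C * cis phi))|) <= M.
  by apply: hM => //; rewrite tb (le_lt_trans as_).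
have lts : ln t - ln s <= (t - s) / s.
  rewrite -ln_div ?posrE//; last exact: lt_trans st.
  have -> : t / s = 1 + (t - s) / s by field; rewrite gt_eqF.
  have q0 : 0 <= (t - s) / s by rewrite divr_ge0 ?subr_ge0//; exact: ltW.
  by apply: le_ln1Dx; lra.
apply: (@le_trans _ _ (rint 0 (2 * pi) (fun phi => `|logc (h (t%:C * cis phi))| + L * (ln t - ln s)))).
  apply: le_rint => [|phi hphi|phi _].
  - by apply: cn; rewrite as_ ltW.
  - by apply: cvgD; [apply: cn => //; rewrite (le_trans as_ (ltW st)) ltW|exact: cvg_cst].
  - have := HL s t phi as_ (ltW st) (ltW tb).
    move: (logc (h (s%:C * cis phi))) (logc (h (t%:C * cis phi))) => x y hxy.
    have := ler_normB y (y - x); have -> : y - (y - x) = x by ring.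
    by lra.
rewrite rintD; last 2 first.
- by apply: cn; rewrite (le_trans as_ (ltW st)) ltW.
- by move=> phi _; exact: cvg_cst.
rewrite rint_cst// subr0 lerD//.
apply: (@le_trans _ _ ((L * (2 * pi) / s) * (t - s))).
  have -> : L * (2 * pi) / s * (t - s) = L * ((t - s) / s) * (2 * pi) by ring.
  by rewrite ler_wpM2r// ler_wpM2l.
apply: (@le_trans _ _ (K * (t - s))).
  by rewrite ler_wpM2r ?subr_ge0 ?(ltW st)// /K lerDl.
rewrite mulrC -ler_pdivlMr//; lra.
Qed.

Lemma logder_near f g z : (\forall w \near z, f w = g w) -> regular f z -> logder g z = logder f z.
Proof.
move=> fg rf; have := derive1c (is_derivec_near fg (holomorphic_is_derive1 rf.1)).
by rewrite /logder /zderive => ->; rewrite (nbhs_singleton fg).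
Qed.

Lemma logderM f g z : regular f z -> regular g z ->
  logder (fun w => f w * g w) z = logder f z + logder g z.
Proof.
move=> [hf f0] [hg g0].
have := derive1c (is_derivecM (holomorphic_is_derive1 hf) (holomorphic_is_derive1 hg)).
rewrite /logder /zderive => ->.
move: (derive1 f z) (derive1 g z) (f z) (g z) f0 g0 => a b u v u0 v0.
by field; rewrite u0 v0.
Qed.

Lemma logderX p n z : z != p -> logder (fun w => (w - p) ^+ n) z = n%:R * (z / (z - p)).
Proof.
move=> zp; have zp0 : z - p != 0 by rewrite subr_eq0.
have := derive1c (@is_derivecX R (fun w => w - p) n z 1 (is_derivec_shift p z)).
rewrite /logder /zderive => ->; case: n => [|n]; first by rewrite !mul0r mulr0 mul0r.
by rewrite mulr1 exprS/=; field; rewrite zp0 expf_neq0.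
Qed.

Lemma logder_prod ps (n : C -> nat) z : z \notin ps ->
  regular (fun w => \prod_(p <- ps) (w - p) ^+ n p) z /\
  logder (fun w => \prod_(p <- ps) (w - p) ^+ n p) z = \sum_(p <- ps) (n p)%:R * (z / (z - p)).
Proof.
elim: ps => [_|p ps IH].
  have -> : (fun w => \prod_(p <- [::]) (w - p) ^+ n p) = (fun=> 1 : C).
    by apply/funext => w; rewrite big_nil.
  rewrite big_nil /logder /zderive derive1_cstc mulr0 mul0r; split=> //.
  by split; [exact: holomorphic_at_cst|exact: oner_neq0].
rewrite inE negb_or => /andP[zp /IH[r E]].
have -> : (fun w => \prod_(q <- p :: ps) (w - q) ^+ n q) =
    (fun w => (w - p) ^+ n p * \prod_(q <- ps) (w - q) ^+ n q).
  by apply/funext => w; rewrite big_cons.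
have rp := regularX (n p) (regular_shift zp).
by split; [exact: regularM|rewrite logderM// logderX// E big_cons].
Qed.

Lemma notin_near ps z : z \notin ps -> \forall w \near z, w \notin ps.
Proof.
elim: ps => [_|p ps IH]; first by near=> w; rewrite in_nil.
rewrite inE negb_or => /andP[zp /IH zps].
by near=> w; rewrite inE negb_or; apply/andP; split; near: w; [exact: near_neq|exact: zps].
Unshelve. all: by end_near. Qed.

Lemma logder_factor f h ps (za zb : C -> nat) z : regular f z -> regular h z -> z \notin ps ->
  (forall w, w \notin ps ->
    f w * \prod_(p <- ps) (w - p) ^+ zb p = h w * \prod_(p <- ps) (w - p) ^+ za p) ->
  normc (logder f z) <= normc (logder h z) +
    \sum_(p <- ps) (za p + zb p)%:R * (normc z / normc (z - p)).
Proof.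
move=> rf rh zps E.
have [ra aE] := logder_prod za zps; have [rb bE] := logder_prod zb zps.
have : logder f z + \sum_(p <- ps) (zb p)%:R * (z / (z - p)) =
    logder h z + \sum_(p <- ps) (za p)%:R * (z / (z - p)).
  rewrite -aE -bE -!logderM//; apply: logder_near; last exact: regularM.
  by near=> w; apply/esym/E; near: w; exact: notin_near.
move/eqP; rewrite eq_sym -subr_eq eq_sym => /eqP.
have -> : \sum_(p <- ps) (za p + zb p)%:R * (normc z / normc (z - p)) =
    \sum_(p <- ps) normc ((za p)%:R * (z / (z - p)) : C) + \sum_(p <- ps) normc ((zb p)%:R * (z / (z - p)) : C).
  rewrite -big_split; apply: eq_bigr => p _ /=.
  have nn (n : nat) : normc (n%:R : C) = n%:R.
    by rewrite -[n%:R : C](rmorph_nat (@real_complex R)) normc_real ger0_norm.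
  by rewrite !normcM !nn normcV natrD mulrDl.
move=> ->; apply: (le_trans (ler_normcB _ _)).
rewrite addrA lerD ?ler_normc_sum//; apply: (le_trans (ler_normcD _ _)).
by rewrite lerD2l ler_normc_sum.
Unshelve. all: by end_near. Qed.

End LocalEstimate.

(** * The estimate of f'/f on one annulus *)

Section LocalLogder.
Variable R : realType.
Local Notation C := (R[i]^o).
Implicit Types (f g h k : C -> C) (z w p : C) (ps cs : seq C).
Let pi2_ge0 : 0 <= 2 * pi :> R. Proof. exact: ltW (pi2_gt0 R). Qed.

Lemma powR_neg_anti (a b tau : R) : 0 <= tau -> 0 < a -> a <= b -> b `^ (- tau) <= a `^ (- tau).
Proof.
move=> t0 a0 ab; rewrite /powR !gt_eqF ?(lt_le_trans a0)// ler_expR !mulNr lerN2.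
by rewrite ler_wpM2l// ler_ln ?posrE// (lt_le_trans a0).
Qed.

Lemma normr_weight f p : `|weight (zero_at f) (mult_at f) p : R| <= (zero_at f p + mult_at f p)%:R.
Proof.
by rewrite /weight natrD; apply: (le_trans (ler_normB _ _)); rewrite !normr_nat.
Qed.

(** For s and |p| at most 1/2 every ln|w - p| is nonpositive, so its absolute value is its opposite,
    whose mean is known exactly: it is at most -ln r per point. *)
Lemma log_circle_factor f h ps (r s M : R) : 0 < r -> r <= s -> s <= 1 / 2 ->
  (forall p, p \in ps -> normc p <= 1 / 2) ->
  (forall p, p \in ps -> normc p != s) ->
  (forall w, normc w = s -> regular f w) ->
  (forall w, normc w = s -> regular h w) ->
  (forall w, w \notin ps -> f w * \prod_(p <- ps) (w - p) ^+ mult_at f p =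
     h w * \prod_(p <- ps) (w - p) ^+ zero_at f p) ->
  rint 0 (2 * pi) (fun t => `|logc (f (s%:C * cis t))|) <= M ->
  rint 0 (2 * pi) (fun t => `|logc (h (s%:C * cis t))|) <=
    M + 2 * pi * ((\sum_(p <- ps) (zero_at f p + mult_at f p)%:R) * - ln r).
Proof.
move=> r0 rs s2 p2 ns rf rh E fM; have s0 := lt_le_trans r0 rs.
pose n p : R := (zero_at f p + mult_at f p)%:R.
have [cps ips] := rint_log_sum (fun p => - n p) s0 ns.
have nw t : normc (s%:C * cis t : C) = s by rewrite normc_circle0// ltW.
have nps t : s%:C * cis t \notin ps by apply/negP => /ns; rewrite nw eqxx.
have cf : {in `[0, 2 * pi], continuous (fun t => `|logc (f (s%:C * cis t))|)}.
  by move=> t _; exact: (continuous_comp (cont_logc_circle (rf _ (nw t))) (@norm_continuous _ _ _)).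
have ch : {in `[0, 2 * pi], continuous (fun t => `|logc (h (s%:C * cis t))|)}.
  by move=> t _; exact: (continuous_comp (cont_logc_circle (rh _ (nw t))) (@norm_continuous _ _ _)).
apply: (@le_trans _ _ (rint 0 (2 * pi) (fun t => `|logc (f (s%:C * cis t))| +
    \sum_(p <- ps) - n p * logc (s%:C * cis t - p)))).
  apply: le_rint => // [t ht|t _]; first by apply: cvgD; [exact: cf|exact: cps].
  have := logc_factor (nps t) (rh _ (nw t)).2 (E _ (nps t)); set w := s%:C * cis t.
  move=> LE; have -> : logc (h w) = logc (f w) - \sum_(p <- ps) weight (zero_at f) (mult_at f) p * logc (w - p).
    by rewrite LE addrK.
  apply: (le_trans (ler_normB _ _)); rewrite lerD2l.
  apply: (le_trans (ler_norm_sum _ _ _)); rewrite big_seq [leRHS]big_seq; apply: ler_sum => p pps.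
  have l0 : logc (w - p) <= 0.
    apply: ln_le0; apply: (le_trans (ler_normcB _ _)); rewrite nw.
    by have := p2 p pps; lra.
  by rewrite normrM (ler0_norm l0) mulNr -mulrN ler_wpM2r ?oppr_ge0// normr_weight.
rewrite rintD//; last by move=> t _; exact: cps.
rewrite ips lerD// mulr_suml mulr_sumr big_seq [leRHS]big_seq; apply: ler_sum => p pps.
rewrite mulNr -mulrN -mulNr mulrA [leRHS]mulrC ler_wpM2r//.
rewrite ler_wpM2l// lerN2 ler_ln ?posrE//; first by rewrite le_max rs.
by rewrite lt_max s0.
Qed.

Section Meromorphic.
Variables (rho R' sigma tau : R) (f : C -> C).
Hypothesis R'0 : 0 < R'.
Hypothesis R'rho : R' < rho.
Hypothesis mf : meromorphic_on (punctured_disc rho) f.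
Hypothesis ncf : ~ constant_on (punctured_disc rho) f.
Hypothesis ordf : order_at0 R' f = sigma%:E.
Hypothesis sigma_tau : sigma < tau.

Lemma annulus_arith (r s r0 : R) : 0 < r -> 64 * r <= r0 -> 64 * r <= 1 -> r / 16 < s < 9 * r ->
  [/\ r / 64 <= s <= 32 * r, r / 32 < s < 16 * r, r / 256 < s < r0 & s <= 1 / 2].
Proof.
by move=> rp h1 h2 /andP[h3 h4]; split; try (apply/andP; split); lra.
Qed.

(** Nested annuli: dividing out the zeros and poles with r/64 <= |p| <= 32 r makes [h] regular on
    the range r/32 < |z| < 16 r required by [logder_bound], while [growth] is used down to r/256 to
    leave room for a counting circle. *)
Lemma local_factor : exists c r0 : R, [/\ 0 < c, 0 < r0 &
  forall r, 0 < r -> 64 * r <= r0 -> 64 * r <= 1 ->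
  exists ps, [/\ uniq ps,
    forall p, p \in ps -> [/\ ~ regular f p, 0 < normc p < rho & normc p <= 1],
    \sum_(p <- ps) (zero_at f p + mult_at f p)%:R <= 2 * c * (r / 256) `^ (- tau) &
    forall z, r / 4 <= normc z <= 2 * r -> z \notin ps -> regular f z /\
      normc (derive1 f z / f z) <=
        48 / r * (c * (r / 256) `^ (- tau) * (1 + 4 * pi * - ln (r / 16))) +
        \sum_(p <- ps) (zero_at f p + mult_at f p)%:R / normc (z - p)]].
Proof.
have tau0 : 0 <= tau by apply: ltW; apply: le_lt_trans sigma_tau; exact: order_at0_ge0 ordf.
have [t1 /andP[t10 t1R] [c [r0 [c0 /andP[r00 r0t] H]]]] := growth R'0 R'rho mf ncf ordf sigma_tau.
exists c, r0; split=> // r rp r64 r48.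
have r32 : 32 * r <= 1 / 2 by lra.
have [b1 b2 b3 b4] : [/\ r / 32 < r / 16, r / 16 < 9 * r, 9 * r < 16 * r & 8 * r < 9 * r].
  by split; lra.
have ann s : r / 16 < s < 9 * r ->
    [/\ r / 64 <= s <= 32 * r, r / 32 < s < 16 * r, r / 256 < s < r0 & s <= 1 / 2].
  exact: annulus_arith.
have ann2 s : r / 4 <= s <= 2 * r -> r / 16 < s < 9 * r.
  by move=> /andP[h1 h2]; apply/andP; split; lra.
have Rrho := R'rho.
have s0p : 0 < r / 256 by lra.
have s0r : r / 256 < r0 by lra.
have [ps [ups hps reg gr]] := H _ s0p s0r.
set Y := (r / 256) `^ (- tau).
pose n p : R := (zero_at f p + mult_at f p)%:R.
pose qs := [seq p <- ps | r / 64 <= normc p <= 32 * r].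
have qsP p : p \in qs -> p \in ps /\ r / 64 <= normc p <= 32 * r.
  by rewrite mem_filter => /andP[].
have uqs : uniq qs by rewrite filter_uniq.
have regq z : r / 64 <= normc z <= 32 * r -> z \notin qs -> regular f z.
  move=> hz; rewrite mem_filter hz /= => zps; apply: reg => //.
  by have /andP[h1 h2] := hz; apply/andP; split; lra.
have nq : \sum_(p <- qs) n p <= 2 * c * Y.
  (* On a circle of radius s <= r/128 <= |p| / 2 each point contributes ln(|p| / s) >= ln 2 >= 1/2;
     hence the factor 2 in the count. *)
  have lts : r / 256 < r / 128 by lra.
  have [u1 [u2 [su1 u12 u2s hu]]] := avoid_seq [seq normc p | p <- ps] lts.
  pose s := (u1 + u2) / 2.
  have hs : r / 256 < s < r0 by rewrite /s; apply/andP; split; lra.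
  have sp : 0 < s by rewrite /s; lra.
  have ns p : p \in ps -> normc p != s.
    move=> pps; apply/eqP => E; apply: (hu s); last by rewrite /s; apply/andP; split; lra.
    by rewrite -E; exact: map_f.
  have [gs _] := gr s hs ns.
  have sY : s `^ (- tau) <= Y by apply: powR_neg_anti => //; have /andP[/ltW] := hs.
  have : \sum_(p <- qs) n p * 2^-1 <= ord_sum f ps s.
    rewrite /qs big_filter /ord_sum big_mkcond/= big_seq [leRHS]big_seq.
    apply: ler_sum => p pps; case: ifP => [/andP[h1 _]|_]; last by rewrite mulr_ge0// lnp_ge0.
    rewrite ler_wpM2l// /lnp le_max; apply/orP; right.
    apply: (le_trans (ln2_ge R)); rewrite ler_ln ?posrE//; last first.
      by rewrite divr_gt0//; lra.
    by rewrite ler_pdivlMr// /s; lra.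
  rewrite -mulr_suml => h1.
  have : c * s `^ (- tau) <= c * Y by rewrite ler_wpM2l// ltW.
  by lra.
exists qs; split=> //.
  move=> p /qsP[/hps[_ _ nr] /andP[h1 h2]]; split=> //; last by lra.
  by apply/andP; split; lra.
have ordq p : p \in qs -> has_order f p (zero_at f p) (mult_at f p).
  move=> /qsP[_ /andP[h1 h2]]; apply: (mero_has_order (rho := rho)) => //.
  by apply/andP; split; lra.
have [h rh E] := factor_points (D := [set z : C | r / 64 <= normc z <= 32 * r]) uqs ordq regq.
have rh' z : r / 32 < normc z < 16 * r -> regular h z.
  by move=> /andP[h1 h2]; apply: rh; left => /=; apply/andP; split; lra.
pose l := - ln (r / 16).
have l0 : 0 <= l by rewrite oppr_ge0 ln_le0//; lra.
pose M := c * Y * (1 + 4 * pi * l).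
have Y0 : 0 <= Y by exact: powR_ge0.
have hM s : r / 16 < s < 9 * r -> s \notin [seq normc p | p <- ps] ->
    rint 0 (2 * pi) (fun phi => `|logc (h (s%:C * cis phi))|) <= M.
  move=> hs16 sps; have [a1 a2 hs s12] := ann s hs16; have /andP[h1 h2] := hs16.
  have ns p : p \in ps -> normc p != s.
    by move=> pps; apply: contra sps => /eqP <-; exact: map_f.
  have [_ gs] := gr s hs ns.
  have sY : s `^ (- tau) <= Y by apply: powR_neg_anti => //; have /andP[/ltW] := hs.
  have cY : c * s `^ (- tau) <= c * Y by rewrite ler_wpM2l// ltW.
  have r16 : 0 < r / 16 by rewrite divr_gt0.
  have := @log_circle_factor f h qs (r / 16) s (c * Y) r16 (ltW h1).
  have nwq w : normc w = s -> w \notin qs by move=> ws; apply/negP => /qsP[/ns]; rewrite ws eqxx.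
  move=> /(_ _ _ _ _ _ E (le_trans gs cY)) K; apply: le_trans (K _ _ _ _ _) _.
  - exact: s12.
  - by move=> p /qsP[_ /andP[_ h3]]; exact: le_trans h3 r32.
  - by move=> p /qsP[/ns].
  - by move=> w ws; apply: regq (nwq _ ws); rewrite ws.
  - by move=> w ws; apply: rh'; rewrite ws.
  have -> : M = c * Y + 2 * pi * (2 * c * Y * l) by rewrite /M; ring.
  by rewrite lerD2l ler_wpM2l// ler_wpM2r.
have hMa s : r / 16 <= s <= 8 * r -> rint 0 (2 * pi) (fun phi => `|logc (h (s%:C * cis phi))|) <= M.
  move=> /andP[h1 h2]; apply: (log_circle_bound_all _ b1 b2 b3 rh' hM).
    by rewrite divr_ge0// ltW.
  by rewrite h1 (le_lt_trans h2).
move=> z hz zq.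
have zp : 0 < normc z by have /andP[z1 _] := hz; apply: lt_le_trans z1; rewrite divr_gt0.
have [z3 z4 _ _] : [/\ r / 64 <= normc z <= 32 * r, r / 32 < normc z < 16 * r,
    r / 256 < normc z < r0 & normc z <= 1 / 2].
  exact/ann/ann2.
have rfz : regular f z by exact: regq.
have rhz : regular h z by exact: rh'.
split=> //.
have := logder_factor rfz rhz zq E.
have := logder_bound rp rh' hMa hz => B L.
have -> : normc (derive1 f z / f z) = normc (logder f z) / normc z.
  have -> : logder f z = z * (derive1 f z / f z) by rewrite /logder /zderive mulrA.
  by rewrite [in RHS]normcM mulrAC divff ?mul1r// gt_eqF.
have zn : normc z != 0 by rewrite gt_eqF.
have key : normc (logder f z) / normc z <= normc (logder h z) / normc z +
    \sum_(p <- qs) (zero_at f p + mult_at f p)%:R / normc (z - p).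
  rewrite ler_pdivrMr// [leRHS]mulrDl divfK//; apply: (le_trans L); rewrite lerD2l mulr_suml.
  by apply: ler_sum => p _; rewrite mulrA mulrAC.
apply: (le_trans key); apply: lerD => //; rewrite ler_pdivrMr//; apply: (le_trans B).
rewrite -/Y -/l -/M.
have /andP[z1 _] := hz.
(* 48 = 12 * 4: the bound 12 M on z h'/h is divided by |z| >= r/4. *)
have q1 : 1 <= 4 * normc z / r by rewrite ler_pdivlMr// mul1r -ler_pdivrMl// mulrC.
have M0 : 0 <= 12 * M.
  have pl : 0 <= 4 * pi * l by apply: mulr_ge0 => //; apply: mulr_ge0 => //; exact: pi_ge0.
  have cY0 : 0 <= c * Y by apply: mulr_ge0 => //; exact: ltW.
  have l1 : 0 <= 1 + 4 * pi * l by apply: addr_ge0.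
  by apply: mulr_ge0 => //; exact: mulr_ge0.
suff -> : 48 / r * M * normc z = 12 * M * (4 * normc z / r) by exact: ler_peMr.
by move: (M) (normc z) => m y; ring.
Qed.

Lemma local_logder (tau' : R) : tau < tau' -> exists2 r1 : R, 0 < r1 <= 1 &
  forall r, 0 < r -> r < r1 -> exists cs, [/\ (size cs)%:R <= r `^ (- tau'),
    forall c, c \in cs -> normc c <= 1 &
    forall z, r / 4 <= normc z <= 2 * r -> z \notin cs -> regular f z /\
      normc (derive1 f z / f z) <= r `^ (- (tau' + 1)) + \sum_(c <- cs) (normc (z - c))^-1].
Proof.
move=> tt; have [c [r0 [c0 r00 H]]] := local_factor.
(* Half of the gap pays for the logarithm, the other half for the constants. *)
pose eta := (tau' - tau) / 2; have eta0 : 0 < eta by rewrite /eta; lra.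
pose B : R := (256^-1) `^ (- tau); pose D : R := eta^-1 * (16^-1) `^ (- eta).
have [r1 /andP[r10 r11] H1] := powR_absorb (2 * c * B) tt.
have te : tau + eta < tau' by rewrite /eta; lra.
have [r2 /andP[r20 r21] H2] := powR_absorb (48 * c * B * (1 + 4 * pi * D)) te.
have B0 : 0 <= B by exact: powR_ge0.
have pi0 : 0 < pi :> R := pi_gt0 R.
exists (Num.min (Num.min r1 r2) (Num.min (r0 / 64) 64^-1)).
  rewrite !lt_min r10 r20 /= !ge_min r11/= andbT.
  by apply/andP; split; lra.
move=> r rp; rewrite !lt_min => /andP[/andP[rr1 rr2] /andP[rr0 r48]].
have [||ps [ups nr nps hz]] := H r rp; [lra|lra|].
have YE : (r / 256) `^ (- tau) = B * r `^ (- tau).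
  by rewrite [r / 256]mulrC; apply: powRM; [rewrite invr_ge0 ler0n|exact: ltW].
(* Each point is repeated as often as its total multiplicity, so that weighted sums become plain
   ones. *)
pose cs := flatten [seq nseq (zero_at f p + mult_at f p) p | p <- ps].
have csum (F : C -> R) : \sum_(c <- cs) F c = \sum_(p <- ps) (zero_at f p + mult_at f p)%:R * F p.
  rewrite /cs big_flatten big_map; apply: eq_bigr => p _.
  by rewrite big_nseq iter_addr_0 mulr_natl.
exists cs; split.
  have -> : (size cs)%:R = \sum_(c <- cs) (1 : R) by rewrite big_const_seq count_predT iter_addr_0.
  rewrite csum; under eq_bigr do rewrite mulr1.
  apply: (le_trans nps); rewrite YE mulrA; exact: H1.
  move=> c' /flattenP[_ /mapP[p /nr[_ _ p1] ->]]; rewrite mem_nseq => /andP[_ /eqP ->]; exact: p1.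
move=> z z1 zcs; have zps : z \notin ps.
  (* A point of [ps] is not regular, so its multiplicity is positive and it does occur in [cs]. *)
  apply: contra zcs => zps; have [nrz zrho _] := nr z zps.
  have : (1 <= zero_at f z + mult_at f z)%N.
    by apply: nonregular_order => //; [exact: mf|exact: (mero_has_order (rho := rho))].
  move=> n1; apply/flattenP; exists (nseq (zero_at f z + mult_at f z) z).
    exact: (map_f (fun p => nseq (zero_at f p + mult_at f p) p) zps).
  by rewrite mem_nseq eqxx n1.
have [rz Lz] := hz z z1 zps; split=> //.
apply: (le_trans Lz); rewrite csum; apply: lerD => //.
rewrite YE.
have r1' : r <= 1 by lra.
have lD : - ln (r / 16) <= D * r `^ (- eta).
  apply: (le_trans (ln_absorb eta0 _)); first by lra.
  have -> : (r / 16) `^ (- eta) = r `^ (- eta) * (16^-1) `^ (- eta).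
    by apply: powRM; [exact: ltW|rewrite invr_ge0 ler0n].
  by rewrite /D -[leRHS]mulrA [r `^ _ * _]mulrC.
have X1 : 1 <= r `^ (- eta) by apply: powR_neg_ge1 => //; exact: ltW.
have rn : r != 0 by rewrite gt_eqF.
have -> : r `^ (- (tau' + 1)) = r `^ (- tau') / r.
  by rewrite opprD powRD ?rn ?implybT// powR_inv1// ltW.
have := H2 r rp rr2; rewrite opprD powRD ?rn ?implybT//.
set X := r `^ (- eta) in X1 lD *; set Z := r `^ (- tau) => K.
have Z0 : 0 <= Z by exact: powR_ge0.
rewrite [48 / r * _]mulrAC ler_pM2r ?invr_gt0//; apply: le_trans K.
have -> : 48 * c * B * (1 + 4 * pi * D) * (Z * X) = 48 * (c * (B * Z) * (X + 4 * pi * (D * X))) by ring.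
have cBZ : 0 <= c * (B * Z) by apply: mulr_ge0; [exact: ltW|exact: mulr_ge0].
have p4 : 0 < 4 * pi :> R by apply: mulr_gt0.
by rewrite ler_pM2l//; apply: ler_wpM2l => //; apply: lerD => //; rewrite ler_pM2l.
Qed.

End Meromorphic.
End LocalLogder.

(** * Higher derivatives *)

Section HigherDerivatives.
Variable R : realType.
Local Notation C := (R[i]^o).
Implicit Types (f g h : C -> C) (z w v p : C) (k : nat).

Lemma holomorphic_at_derive1n f k z : holomorphic_at f z -> holomorphic_at (derive1n k f) z.
Proof.
by move=> hf; elim: k => [//|k IH]; rewrite derive1nS; exact: holomorphic_at_derive1.
Qed.

Lemma rcderive_segment z v x : rcderive (fun t : R => z + t%:C * v) x v.
Proof.
move=> e e0; exists 1 => // y _.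
have -> : z + y%:C * v - (z + x%:C * v) - v * (y - x)%:C = 0.
  by rewrite rmorphB/=; ring.
by rewrite normc0 mulr_ge0// ltW.
Qed.

Lemma logder_segment f z v (K : R) :
  (forall t : R, 0 <= t <= 1 -> regular f (z + t%:C * v) /\
     normc (derive1 f (z + t%:C * v) / f (z + t%:C * v)) <= K) ->
  logc (f (z + v)) - logc (f z) <= K * normc v.
Proof.
move=> H; have D (t : R) : 0 <= t <= 1 -> is_derive t 1 (fun t : R => logc (f (z + t%:C * v)))
    (Re (derive1 f (z + t%:C * v) * v / f (z + t%:C * v))).
  move=> /H[[hf f0] _]; apply: (@rcderive_ln R (fun t : R => f (z + t%:C * v))) => //.
  apply: (@rcderive_comp R f (fun t : R => z + t%:C * v)); last exact: rcderive_segment.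
  exact: holomorphic_is_derive1.
have [||xi hxi] := @MVT_segment R (fun t : R => logc (f (z + t%:C * v)))
  (fun t => Re (derive1 f (z + t%:C * v) * v / f (z + t%:C * v))) 0 1 ler01.
- by move=> x; rewrite in_itv/= => /andP[/ltW h1 /ltW h2]; apply: D; rewrite h1.
- apply: cont_within => x; rewrite in_itv/= => /D[+ _].
  by move=> /derivable1_diffP; exact: differentiable_continuous.
rewrite mul1r mul0r addr0 subr0 mulr1 => ->.
have [_ b] : regular f (z + xi%:C * v) /\ normc (derive1 f (z + xi%:C * v) / f (z + xi%:C * v)) <= K.
  by apply: H; rewrite in_itv/= in hxi.
apply: (le_trans (ler_norm _)); apply: (le_trans (ler_Re_normc _)).
by rewrite mulrAC normcM ler_wpM2r.
Qed.

Lemma expR4_le2 : expR (4^-1 : R) <= 2.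
Proof.
rewrite -[leRHS](@lnK R) ?posrE// ler_expR; apply: le_trans (ln2_ge R); lra.
Qed.

Lemma logder_disc f z (A : R) : 0 < A ->
  (forall w, normc (w - z) <= (8 * A)^-1 -> regular f w /\ normc (derive1 f w / f w) <= 2 * A) ->
  forall w, normc (w - z) <= (8 * A)^-1 -> normc (f w) <= 2 * normc (f z).
Proof.
move=> A0 H w wz; have A8 : 0 < 8 * A by rewrite mulr_gt0.
have rz : regular f z by apply: (H z _).1; rewrite subrr normc0 invr_ge0 ltW.
have [rw _] := H w wz.
have fz0 : 0 < normc (f z) by rewrite normc_gt0; exact: rz.2.
have fw0 : 0 < normc (f w) by rewrite normc_gt0; exact: rw.2.
have : logc (f (z + (w - z))) - logc (f z) <= 2 * A * normc (w - z).
  apply: logder_segment => t /andP[t0 t1]; apply: H.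
  rewrite addrC addKr normcM normc_real ger0_norm//; apply: le_trans wz.
  by rewrite ler_piMl.
have -> : z + (w - z) = w by rewrite addrC subrK.
move=> h; have h4 : logc (f w) - logc (f z) <= 4^-1.
  apply: (le_trans h); apply: (@le_trans _ _ (2 * A * (8 * A)^-1)).
    by rewrite ler_pM2l// mulr_gt0.
  by rewrite invfM mulrACA divff ?gt_eqF// mulr1; lra.
rewrite -[leLHS](@lnK R) ?posrE//; apply: (@le_trans _ _ (expR (logc (f z) + 4^-1))).
  by rewrite ler_expR /logc in h4 *; lra.
by rewrite expRD lnK ?posrE// mulrC ler_pM2r// expR4_le2.
Qed.

(** Each derivative costs one Cauchy estimate at radius rho / k, so after k of them the disc has
    shrunk exactly to its centre. *)
Lemma iterated_cauchy f z (rho B : R) k : 0 < rho -> (0 < k)%N ->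
  (forall w, normc (w - z) <= rho -> holomorphic_at f w /\ normc (f w) <= B) ->
  forall j, (j <= k)%N -> forall w, normc (w - z) <= rho - j%:R * (rho / k%:R) ->
    normc (derive1n j f w) <= B * (2 * (k%:R / rho)) ^+ j.
Proof.
move=> rho0 k0 H; have kp : 0 < k%:R :> R by rewrite ltr0n.
have d0 : 0 < rho / k%:R by rewrite divr_gt0.
elim=> [_ w|j IH jk w wz]; first by rewrite mul0r subr0 expr0 mulr1 => /H[].
have inn u : normc (u - w) <= rho / k%:R -> normc (u - z) <= rho - j%:R * (rho / k%:R).
  move=> uw; have -> : u - z = (u - w) + (w - z) by ring.
  apply: (le_trans (ler_normcD _ _)); move: wz; rewrite -natr1 mulrDl mul1r.
  by move: (j%:R * (rho / k%:R)) uw => a; lra.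
have inn' u : normc (u - w) <= rho / k%:R -> normc (u - z) <= rho.
  move=> /inn h; apply: (le_trans h); rewrite gerBl.
  by apply: mulr_ge0 => //; exact: ltW.
rewrite derive1nS exprS.
have dd : derivable_disc (derive1n j f) w (rho / k%:R).
  move=> u uw; apply: holomorphic_at_derivable; apply: holomorphic_at_derive1n.
  by have [] := H u (inn' u uw).
have bb u : normc (u - w) = rho / k%:R -> normc (derive1n j f u) <= B * (2 * (k%:R / rho)) ^+ j.
  by move=> uw; apply: IH; [exact: ltnW|apply: inn; rewrite uw].
apply: (le_trans (cauchy_estimate d0 dd bb)).
rewrite invf_div; move: (_ ^+ j) => q.
suff -> : 2 * (B * q * (k%:R / rho)) = B * (2 * (k%:R / rho) * q) by [].
ring.
Qed.

Lemma logder_higher f z k (A : R) : 0 < A -> (0 < k)%N ->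
  (forall w, normc (w - z) <= (8 * A)^-1 -> regular f w /\ normc (derive1 f w / f w) <= 2 * A) ->
  mero_norm_le (fun w => derive1n k f w / f w) z (2 * (16 * k%:R * A) ^+ k).
Proof.
move=> A0 k0 H; have A8 : 0 < 8 * A by rewrite mulr_gt0.
have r0 : 0 < (8 * A)^-1 by rewrite invr_gt0.
have rz : regular f z by apply: (H z _).1; rewrite subrr normc0 ltW.
have fz0 : 0 < normc (f z) by rewrite normc_gt0; exact: rz.2.
(* [f] is regular at [z], so the limit required by [mero_norm_le] is the value of the quotient. *)
exists (derive1n k f z / f z).
  have hk : holomorphic_at (fun w => derive1n k f w * (f w)^-1) z.
    by apply: holomorphic_atM; [exact: holomorphic_at_derive1n rz.1|exact: (regularV rz).1].
  have := holomorphic_at_continuous hk => /continuous_withinNx; exact.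
have hb w : normc (w - z) <= (8 * A)^-1 -> holomorphic_at f w /\ normc (f w) <= 2 * normc (f z).
  by move=> wz; split; [have [[]] := H w wz|exact: (logder_disc A0 H)].
have := iterated_cauchy r0 k0 hb (leqnn k) (w := z).
have kn : k%:R != 0 :> R by rewrite pnatr_eq0 -lt0n.
have -> : (8 * A)^-1 - k%:R * ((8 * A)^-1 / k%:R) = 0.
  by rewrite [k%:R * _]mulrC divfK// subrr.
rewrite subrr normc0 lexx => /(_ isT); rewrite invrK.
have -> : 2 * (k%:R * (8 * A)) = 16 * k%:R * A by ring.
move=> h; rewrite normcM normcV ler_pdivrMr//; apply: (le_trans h).
by rewrite -!mulrA [normc _ * _]mulrC.
Qed.

(** Each single term is at most [lam], so every point of [cs] is at distance at least 1 / lam from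
    [z]; a displacement of 1 / (2 lam) at most halves these distances. *)
Lemma sum_inv_dist cs z w (lam : R) : z \notin cs ->
  \sum_(c <- cs) (normc (z - c))^-1 <= lam -> 2 * lam * normc (w - z) <= 1 ->
  w \notin cs /\ \sum_(c <- cs) (normc (w - c))^-1 <= 2 * lam.
Proof.
move=> zcs hl wl.
have key c : c \in cs -> normc (z - c) / 2 <= normc (w - c).
  move=> cc; have zc : 0 < normc (z - c).
    by rewrite normc_gt0 subr_eq0; apply: contra zcs => /eqP ->.
  have : (normc (z - c))^-1 <= lam.
    apply: le_trans hl; rewrite (big_rem c)//= lerDl.
    by apply: sumr_ge0 => q _; rewrite invr_ge0.
  move=> h; have h1 : 1 <= lam * normc (z - c) by rewrite -ler_pdivrMr// div1r.
  have lam0 : 0 < lam by apply: lt_le_trans h; rewrite invr_gt0.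
  have h2 : normc (w - z) <= normc (z - c) / 2.
    rewrite ler_pdivlMr// mulrC -(ler_pM2l lam0); apply: le_trans h1.
    by rewrite mulrCA mulrA.
  have : normc (z - c) <= normc (w - c) + normc (w - z).
    have -> : z - c = (w - c) - (w - z) by ring.
    exact: ler_normcB.
  by lra.
have zpos c : c \in cs -> 0 < normc (z - c).
  by move=> cc; rewrite normc_gt0 subr_eq0; apply: contra zcs => /eqP ->.
split.
  apply/negP => wc; have := key w wc; rewrite subrr normc0.
  by have := zpos w wc; lra.
apply: (@le_trans _ _ (\sum_(c <- cs) 2 * (normc (z - c))^-1)); last by rewrite -mulr_sumr ler_pM2l.
rewrite big_seq [leRHS]big_seq; apply: ler_sum => c cc; have z0 := zpos c cc.
have k1 := key c cc; have w0 : 0 < normc (w - c) by lra.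
rewrite -[2]invrK -invfM lef_pV2 ?posrE//; last by rewrite mulr_gt0.
by rewrite mulrC.
Qed.

(** With A = lam + K >= 1/r, the disc of radius 1 / (8 A) lies within r/8 of [z], inside the annulus
    of the hypothesis; there the sum at most doubles, so |f'/f| <= K + 2 lam <= 2 A. *)
Lemma local_higher f cs (r K lam : R) z k : 0 < r -> 0 <= K -> 0 < lam -> r^-1 <= lam + K -> (0 < k)%N ->
  (forall w, r / 4 <= normc w <= 2 * r -> w \notin cs -> regular f w /\
      normc (derive1 f w / f w) <= K + \sum_(c <- cs) (normc (w - c))^-1) ->
  r / 2 <= normc z <= r -> z \notin cs -> \sum_(c <- cs) (normc (z - c))^-1 <= lam ->
  mero_norm_le (fun w => derive1n k f w / f w) z (2 * (16 * k%:R * (lam + K)) ^+ k).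
Proof.
move=> r0 K0 l0 lr k0 H /andP[z1 z2] zcs hl; pose A := lam + K; have A0 : 0 < A by rewrite /A; lra.
have A8 : 0 < 8 * A by rewrite mulr_gt0.
apply: logder_higher => // w wz.
have wz1 : normc (w - z) * (8 * A) <= 1 by rewrite -ler_pdivlMr// div1r.
have n0 : 0 <= normc (w - z) by [].
have wr : normc (w - z) <= r / 8.
  have h : 1 <= A * r by rewrite -ler_pdivrMr// div1r.
  by nra.
have wl : 2 * lam * normc (w - z) <= 1 by rewrite /A in wz1; nra.
have [wcs hw] := sum_inv_dist zcs hl wl.
have d1 : normc z <= normc w + normc (w - z).
  by have := ler_normcB w (w - z); have -> : w - (w - z) = z by ring.
have d2 : normc w <= normc z + normc (w - z).
  by have := ler_normcD z (w - z); rewrite addrC subrK addrC.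
have [||rw bw] := H w; [by apply/andP; split; lra|by []|].
by split=> //; apply: (le_trans bw); rewrite /A; lra.
Qed.

End HigherDerivatives.

(** * Exceptional sets *)

Section Covering.
Variable R : realType.
Local Notation mu := (@lebesgue_measure R).
Implicit Types (x a lam d : R).

Definition kernel_sum (L : seq (R * R)) (x : R) : R :=
  \sum_(i <- L) i.2^-1 * \1_(`]i.1 - i.2, i.1 + i.2[%classic) x.

Lemma kernel_term (i : R * R) : 0 < i.2 ->
  (\int[mu]_x (i.2^-1 * \1_(`]i.1 - i.2, i.1 + i.2[%classic) x)%:E)%E = 2%:E.
Proof.
move=> i0; under eq_integral do rewrite EFinM.
rewrite ge0_integralZl_EFin//.
- rewrite integral_indic//= setIT lebesgue_measure_itv/= lte_fin.
  rewrite ifT; last by rewrite ltrD2l; lra.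
  by rewrite -EFinD -EFinM; congr EFin; field; rewrite gt_eqF.
- by apply/measurable_EFinP; exact: measurable_indic.
- by rewrite invr_ge0 ltW.
Qed.

Lemma measurable_kernel_sum L : measurable_fun setT (kernel_sum L).
Proof.
apply: measurable_sum => i; apply: measurable_funM => //; exact: measurable_indic.
Qed.

Lemma kernel_markov (L : seq (R * R)) lam : 0 < lam -> (forall i, i \in L -> 0 < i.2) ->
  measurable [set x | lam < kernel_sum L x] /\
  (lam%:E * mu [set x | (lam < kernel_sum L x)%R] <= (2 * (size L)%:R)%:E)%E.
Proof.
move=> lam0 hL; set B := [set x | _].
have mB : measurable B.
  have -> : B = setT `&` kernel_sum L @^-1` `]lam, +oo[%classic.
    by rewrite setTI; apply/seteqP; split=> x /=; rewrite /B/= in_itv/= andbT.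
  by apply: measurable_kernel_sum.
split=> //.
have -> : (lam%:E * mu B)%E = (\int[mu]_x (lam * \1_B x)%:E)%E.
  under eq_integral do rewrite EFinM.
  rewrite ge0_integralZl_EFin//; last exact: ltW.
  - by rewrite integral_indic// setIT.
  - by apply/measurable_EFinP; exact: measurable_indic.
have pos (i : R * R) x : i \in L -> 0 <= i.2^-1 * \1_(`]i.1 - i.2, i.1 + i.2[%classic) x.
  by move=> /hL i0; rewrite mulr_ge0// invr_ge0 ltW.
apply: (@le_trans _ _ (\int[mu]_x (kernel_sum L x)%:E)%E).
  apply: ge0_le_integral_any => x _; rewrite lee_fin; first by rewrite mulr_ge0// ltW.
  rewrite indicE; case: (boolP (x \in B)) => [/set_mem/= h|_]; first by rewrite mulr1 ltW.
  by rewrite mulr0 /kernel_sum big_seq; apply: sumr_ge0 => i iL; exact: pos.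
elim: L hL {B mB pos} => [_|i L IH hL].
  rewrite mulr0; under eq_integral do rewrite /kernel_sum big_nil.
  by rewrite integral0.
have pos x : 0 <= kernel_sum L x.
  rewrite /kernel_sum big_seq; apply: sumr_ge0 => q qL.
  by rewrite mulr_ge0// invr_ge0 ltW// hL// inE qL orbT.
have i0 := hL i (mem_head _ _).
under eq_integral do rewrite /kernel_sum big_cons EFinD.
rewrite ge0_integralD//.
- have -> : 2 * (size (i :: L))%:R = 2 + 2 * (size L)%:R :> R.
    by rewrite /= -[(size L).+1%:R]natr1; ring.
  rewrite EFinD; apply: leeD; first by rewrite kernel_term.
  by apply: IH => q qL; apply: hL; rewrite inE qL orbT.
- by move=> x _; rewrite lee_fin mulr_ge0// invr_ge0 ltW.
- by apply/measurable_EFinP; apply: measurable_funM => //; exact: measurable_indic.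
- by move=> x _; rewrite lee_fin; exact: pos.
- by apply/measurable_EFinP; exact: measurable_kernel_sum.
Qed.

(* The step functions 2^-i d^-1 \1_(|x - a| < 2^i d) sum up to at least half of
   1/|x - a|, while each has integral 2; [kernel_markov] is Markov's inequality. *)
Lemma covering (s : seq R) lam d (m : nat) : 0 < lam -> 0 < d -> lam < d^-1 ->
  exists B : set R, [/\ measurable B, (lam%:E * mu B <= (2 * ((size s)%:R * m.+1%:R))%:E)%E &
    forall x, ~ B x -> (forall a, a \in s -> `|x - a| < 2 ^+ m * d) ->
      x \notin s /\ \sum_(a <- s) `|x - a|^-1 <= 2 * lam].
Proof.
move=> lam0 d0 ld.
pose L := [seq (a, 2 ^+ i * d) | a <- s, i <- iota 0 m.+1].
have L0 i : i \in L -> 0 < i.2.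
  by move=> /allpairsP[[a j] [_ _ ->]]/=; rewrite mulr_gt0// exprn_gt0.
have [mB muB] := kernel_markov lam0 L0.
exists [set x | lam < kernel_sum L x]; split=> //.
  by move: muB; rewrite size_allpairs size_iota natrM.
move=> x /negP; rewrite -leNgt => Sx hx.
pose T a := \sum_(0 <= i < m.+1) (2 ^+ i * d)^-1 * \1_(`]a - 2 ^+ i * d, a + 2 ^+ i * d[%classic) x.
have T0 a i : 0 <= (2 ^+ i * d)^-1 * \1_(`]a - 2 ^+ i * d, a + 2 ^+ i * d[%classic) x.
  by rewrite mulr_ge0// invr_ge0 mulr_ge0// ltW.
have SE : kernel_sum L x = \sum_(a <- s) T a.
  rewrite /kernel_sum /L big_allpairs_dep; apply: eq_bigr => a _.
  by rewrite /T /index_iota subn0.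
have term a i : (i <= m)%N -> `|x - a| < 2 ^+ i * d -> (2 ^+ i * d)^-1 <= T a.
  move=> im xa; rewrite /T (bigD1_seq i) ?iota_uniq ?mem_index_iota//=.
  rewrite indicE mem_set ?mulr1 ?lerDl ?sumr_ge0//=.
  by rewrite in_itv/= -ltr_distl.
(* A centre closer than d would contribute d^-1 > lam by the smallest step function alone. *)
have big a : a \in s -> d <= `|x - a|.
  move=> as_; rewrite leNgt; apply/negP => xa.
  have h := term a 0%N (leq0n m); rewrite expr0 mul1r in h.
  have : T a <= \sum_(a <- s) T a.
    by rewrite (big_rem a)//= lerDl; apply: sumr_ge0 => b _; apply: sumr_ge0.
  by have := h xa; lra.
split.
  by apply/negP => /big; rewrite subrr normr0 leNgt d0.
apply: (@le_trans _ _ (\sum_(a <- s) 2 * T a)); last by rewrite -mulr_sumr -SE ler_pM2l.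
rewrite big_seq [leRHS]big_seq; apply: ler_sum => a as_.
have xa0 : 0 < `|x - a| := lt_le_trans d0 (big a as_).
have ex : exists i, `|x - a| < 2 ^+ i * d by exists m; exact: hx.
(* By [big] the least such i is positive, so 2^(i-1) d <= |x - a| < 2^i d and the i-th step function
   alone is at least half of 1/|x - a|. *)
case: (ex_minnP ex) => i hi mini.
have im : (i <= m)%N by apply: mini; exact: hx.
have i0 : (0 < i)%N.
  by rewrite lt0n; apply/eqP => E; move: hi; rewrite E expr0 mul1r ltNge big.
have pi_ : 2 ^+ i.-1 * d <= `|x - a|.
  by rewrite leNgt; apply/negP => /mini; rewrite -ltnS prednK// ltnn.
apply: (@le_trans _ _ (2 * (2 ^+ i * d)^-1)); last by rewrite ler_pM2l// term.
have -> : 2 * (2 ^+ i * d)^-1 = (2 ^+ i.-1 * d)^-1.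
  by rewrite -{1}(prednK i0) exprS -mulrA invfM mulrA divff ?mul1r// pnatr_eq0.
by rewrite lef_pV2 ?posrE// mulr_gt0// exprn_gt0.
Qed.

End Covering.

(** * Dyadic scales, and distances in terms of radii and angles *)

Section Scales.
Variable R : realType.
Local Notation C := (R[i]^o).
Local Notation mu := (@lebesgue_measure R).

Definition scale (j : nat) : R := 2^-1 ^+ j.

Lemma scale_gt0 j : 0 < scale j. Proof. by rewrite exprn_gt0. Qed.

Lemma scaleS j : scale j.+1 = scale j / 2. Proof. by rewrite /scale exprSr. Qed.

Lemma scale_le i j : (i <= j)%N -> scale j <= scale i.
Proof.
move=> /subnK <-; rewrite /scale exprD ler_piMl ?exprn_ge0//.
by rewrite exprn_ile1//; lra.
Qed.

Lemma scale_le1 j : scale j <= 1. Proof. by have := @scale_le 0 j (leq0n j); rewrite {2}/scale expr0. Qed.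

Lemma scale_lt1 j : (0 < j)%N -> scale j < 1.
Proof. by move=> j0; apply: le_lt_trans (scale_le j0) _; rewrite /scale expr1; lra. Qed.

Lemma scale_small (e : R) : 0 < e -> exists J, forall j, (J <= j)%N -> scale j < e.
Proof.
move=> e0; pose J := Num.bound e^-1; exists J => j Jj.
apply: (le_lt_trans (scale_le Jj)).
rewrite /scale exprVn -[X in _ < X]invrK ltf_pV2 ?posrE ?invr_gt0 ?exprn_gt0//.
have h : e^-1 < J%:R by apply: archi_boundP; rewrite invr_ge0 ltW.
by apply: (lt_le_trans h); rewrite -natrX ler_nat; apply: ltnW; exact: ltn_expl.
Qed.

Lemma dyadic (x : R) J : 0 < x -> x <= scale J -> exists2 j, (J <= j)%N & scale j / 2 <= x <= scale j.
Proof.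
move=> x0 xJ; have ex : exists j, scale j < x.
  by have [j hj] := scale_small x0; exists j; exact: hj.
case: (ex_minnP ex) => i hi mini.
have Ji : (J < i)%N by rewrite ltnNge; apply/negP => /scale_le; lra.
have i0 : (0 < i)%N by apply: leq_ltn_trans Ji.
exists i.-1; first by rewrite -ltnS prednK.
rewrite -scaleS prednK// (ltW hi)/= leNgt; apply/negP => /mini.
by rewrite -ltnS prednK// ltnn.
Qed.

Lemma powR_neg_lt (r a b : R) : 0 < r -> r < 1 -> a < b -> r `^ (- a) < r `^ (- b).
Proof.
move=> r0 r1 ab; rewrite /powR gt_eqF// ltr_expR !mulNr ltrN2.
by rewrite ltr_nM2r// ln_lt0// r0.
Qed.

Lemma scale_powR j (a : R) : scale j `^ a = (2^-1 `^ a) ^+ j.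
Proof.
have p0 : 0 <= 2^-1 `^ a :> R by exact: powR_ge0.
by rewrite -(powR_mulrn j p0) -powRrM mulrC powRrM powR_mulrn// invr_ge0.
Qed.

Lemma index_le_scale j (eta : R) : 0 < eta -> j%:R <= 2 * eta^-1 * scale j `^ (- eta).
Proof.
move=> e0; have h := ln_absorb e0 (scale_gt0 j).
rewrite -mulrA; apply: (@le_trans _ _ (2 * - ln (scale j))); last by rewrite ler_pM2l.
rewrite /scale lnXn// lnV ?posrE// -mulNrn opprK -mulr_natr.
by have := ln2_ge R; have := ler0n R j; nra.
Qed.

(** With N > kappa the smallest step d = r^N is below 1 / lam = r^kappa, and j N + 5 doublings raise
    it to 32. The number of levels is of order ln(1/r), paid for by r^-eta. The factor 5 in the size
    of [s] allows five angles per point. *)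
Lemma scale_cover (N : nat) (tau' kappa eta : R) : 0 < eta -> kappa < N%:R ->
  exists2 c : R, 0 < c & forall j (s : seq R), (0 < j)%N -> (size s)%:R <= 5 * scale j `^ (- tau') ->
    exists B : set R, [/\ measurable B, (mu B <= (c * scale j `^ (kappa - tau' - eta))%:E)%E &
      forall x, ~ B x -> (forall a, a \in s -> `|x - a| < 32) ->
        x \notin s /\ \sum_(a <- s) `|x - a|^-1 <= 2 * scale j `^ (- kappa)].
Proof.
move=> e0 kN; pose c1 : R := 2 * N%:R * eta^-1 + 6.
have c10 : 0 < c1.
  apply: ltr_wpDl => //; apply: mulr_ge0; first by rewrite mulr_ge0.
  by rewrite invr_ge0 ltW.
exists (10 * c1); first by rewrite mulr_gt0.
move=> j s j0 hs; have r0 := scale_gt0 j; have r1 := scale_lt1 j0.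
pose lam := scale j `^ (- kappa); have lam0 : 0 < lam by rewrite powR_gt0.
pose d := scale j ^+ N; have d0 : 0 < d by rewrite exprn_gt0.
have ld : lam < d^-1 by rewrite /d -powR_invn ?ltW//; exact: powR_neg_lt.
have [B [mB muB HB]] := @covering R s lam d (j * N + 5) lam0 d0 ld.
have md : 2 ^+ (j * N + 5) * d = 32.
  rewrite /d /scale -exprM exprVn exprD -mulrA mulrCA divff ?mulr1 ?expf_neq0//.
  by rewrite -natrX.
exists B; split=> //; last by move=> x /HB; rewrite md; apply.
have X1 : 1 <= scale j `^ (- eta) by apply: powR_neg_ge1; rewrite // ltW.
have hm : (j * N + 5).+1%:R <= c1 * scale j `^ (- eta).
  rewrite -addnS natrD natrM mulrDl; apply: lerD; last by rewrite ler_peMr.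
  have := index_le_scale j e0; move: (scale j `^ (- eta)) => X h.
  have -> : 2 * N%:R * eta^-1 * X = 2 * eta^-1 * X * N%:R by ring.
  by rewrite ler_wpM2r.
rewrite -lee_pdivlMl// in muB; apply: (le_trans muB).
rewrite -EFinM lee_fin.
have -> : scale j `^ (kappa - tau' - eta) = lam^-1 * scale j `^ (- tau') * scale j `^ (- eta).
  have rn : scale j != 0 by rewrite gt_eqF.
  by rewrite !powRD ?rn ?implybT// /lam -powRN opprK.
have -> : 10 * c1 * (lam^-1 * scale j `^ (- tau') * scale j `^ (- eta)) =
    lam^-1 * (2 * ((5 * scale j `^ (- tau')) * (c1 * scale j `^ (- eta)))) by ring.
by rewrite ler_pM2l ?invr_gt0// ler_pM2l// ler_pM.
Qed.

Lemma normr_sin_le (x : R) : 0 <= x -> `|sin x| <= x.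
Proof.
move=> x0; have [|xi _] := @MVT_segment R (@sin R) (@cos R) 0 x x0.
  by apply: cont_within => y _; exact: continuous_sin.
rewrite sin0 !subr0 => ->; rewrite normrM (ger0_norm x0) ler_piMl//; exact: cos_max.
Qed.

Lemma cos_ge_half (x : R) : 0 <= x <= 1 -> 2^-1 <= cos x.
Proof.
move=> /andP[x0 x1]; have -> : x = (x / 2) *+ 2 by rewrite -mulr_natr divfK.
rewrite cos_mulr2n; have h : `|sin (x / 2)| <= 2^-1 by apply: le_trans (normr_sin_le _) _; lra.
have s2 : sin (x / 2) ^+ 2 <= 2^-1 ^+ 2 by rewrite -real_normK ?num_real// ler_pXn2r ?nnegrE//; lra.
have -> : cos (x / 2) ^+ 2 = 1 - sin (x / 2) ^+ 2 by apply/esym/eqP; rewrite subr_eq cos2Dsin2.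
rewrite -[(1 - _) *+ 2]mulr_natl; move: (sin _ ^+ 2) s2 => u; rewrite expr2; lra.
Qed.

Lemma sin_ge (x : R) : 0 <= x <= 2 -> x / 4 <= sin x.
Proof.
move=> /andP[x0 x2]; pose y := x / 2; have y01 : 0 <= y <= 1 by rewrite /y; lra.
have -> : sin x = 2 * (cos y * sin y).
  by rewrite mulr_natl -sin_mulr2n -mulr_natr /y divfK.
have /andP[y0 y1] := y01.
have [|xi] := @MVT_segment R (@sin R) (@cos R) 0 y y0.
  by apply: cont_within => t _; exact: continuous_sin.
rewrite in_itv/= sin0 !subr0 => /andP[h1 h2] ->.
have c1 : 2^-1 <= cos xi by apply: cos_ge_half; rewrite h1 (le_trans h2).
have c2 := cos_ge_half y01.
have ab : 2^-1 * 2^-1 <= cos y * cos xi by rewrite ler_pM.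
have aby : 2^-1 * 2^-1 * y <= cos y * cos xi * y by rewrite ler_wpM2r.
by rewrite [cos y * _]mulrA; move: aby; rewrite /y; move: (cos _ * cos _ * _) => u; lra.
Qed.

Lemma normr_sin_ge (x : R) : `|x| <= pi / 2 -> `|x| / 4 <= `|sin x|.
Proof.
move=> h; have -> : `|sin x| = `|sin `|x| |.
  by have [x0|x0] := leP 0 x; [rewrite (ger0_norm x0)|rewrite (ltr0_norm x0) sinN normrN].
apply: (le_trans _ (ler_norm _)); apply: sin_ge; rewrite normr_ge0/=; apply: (le_trans h).
by apply: ltW; exact: pihalf_lt2.
Qed.

Lemma normr_sinDpi (x : R) : `|sin (x + pi)| = `|sin x|.
Proof. by rewrite sinD cospi sinpi mulr0 addr0 mulrN1 normrN. Qed.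

(** The possible zeros of t |-> sin(t - a) when t and a both lie in [0, 2 pi]. *)
Definition angle_centers (a : R) : seq R :=
  [:: a; a + pi; a - pi; a + 2 * pi; a - 2 * pi].

Lemma sin_angle_ge (t a : R) : 0 <= t <= 2 * pi -> 0 <= a <= 2 * pi ->
  exists2 b, b \in angle_centers a & `|t - b| / 4 <= `|sin (t - a)|.
Proof.
move=> /andP[t0 t1] /andP[a0 a1].
have sB (x : R) : `|sin (x - pi)| = `|sin x| by rewrite -(normr_sinDpi (x - pi)) subrK.
have near b : `|t - b| <= pi / 2 -> `|sin (t - b)| = `|sin (t - a)| -> `|t - b| / 4 <= `|sin (t - a)|.
  by move=> h <-; exact: normr_sin_ge.
have [h1|h1] := leP (t - a) (- (3 * (pi / 2))).
  exists (a - 2 * pi); first by rewrite !inE eqxx !orbT.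
  apply: near; first by rewrite ler_norml; apply/andP; split; lra.
  have -> : t - (a - 2 * pi) = t - a + pi + pi by ring.
  by rewrite !normr_sinDpi.
have [h2|h2] := leP (t - a) (- (pi / 2)).
  exists (a - pi); first by rewrite !inE eqxx !orbT.
  apply: near; first by rewrite ler_norml; apply/andP; split; lra.
  have -> : t - (a - pi) = t - a + pi by ring.
  by rewrite !normr_sinDpi.
have [h3|h3] := leP (t - a) (pi / 2).
  exists a; first by rewrite !inE eqxx.
  by apply: near => //; rewrite ler_norml; apply/andP; split; lra.
have [h4|h4] := leP (t - a) (3 * (pi / 2)).
  exists (a + pi); first by rewrite !inE eqxx !orbT.
  apply: near; first by rewrite ler_norml; apply/andP; split; lra.
  have -> : t - (a + pi) = t - a - pi by ring.
  by rewrite sB.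
exists (a + 2 * pi); first by rewrite !inE eqxx !orbT.
apply: near; first by rewrite ler_norml; apply/andP; split; lra.
have -> : t - (a + 2 * pi) = t - a - pi - pi by ring.
by rewrite !sB.
Qed.

(** The left side is the distance from the point to the line through 0 and [c], read off as an
    imaginary part after rotating that line onto the real axis. *)
Lemma polar_dist_sin (r t a : R) (c : C) : 0 <= r -> c = (normc c)%:C * cis a ->
  r * `|sin (t - a)| <= normc (polar r t - c).
Proof.
move=> r0 cE; rewrite -[leRHS]mulr1 -(normc_cis a) -(normc_conj (cis a)) -normcM.
apply: le_trans (ler_Im_normc _).
suff -> : Im ((polar r t - c) * (cis a)^* ) = r * sin (t - a) by rewrite normrM ger0_norm.
rewrite {1}cE; move: (normc c) => u; rewrite /polar /cis sinB /=; ring.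
Qed.

Definition arg (c : C) : R := xget 0 [set a : R | 0 <= a < 2 * pi /\ c = (normc c)%:C * cis a].

Lemma argP (c : C) : 0 <= arg c < 2 * pi /\ c = (normc c)%:C * cis (arg c).
Proof.
have [x hx cx] := polar_rep c.
have : exists a : R, 0 <= a < 2 * pi /\ c = (normc c)%:C * cis a by exists x.
exact: (@xgetPex R 0 [set a : R | 0 <= a < 2 * pi /\ c = (normc c)%:C * cis a]).
Qed.

Definition angles (cs : seq C) : seq R := flatten [seq angle_centers (arg c) | c <- cs].

Lemma size_angles cs : size (angles cs) = (5 * size cs)%N.
Proof. by elim: cs => [//|c cs IH]; rewrite /angles /= -/(angles cs) IH mulnS. Qed.

Lemma angles_bound cs (t b : R) : 0 <= t < 2 * pi -> b \in angles cs -> `|t - b| < 32.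
Proof.
move=> /andP[t0 t1] /flattenP[_ /mapP[c _ ->]].
have [/andP[a0 a1] _] := argP c; move: (arg c) a0 a1 => a a0 a1.
have p2 := pihalf_lt2 R; have p0 := pi_gt0 R.
have E : forall x : R, - (4 * pi) <= x <= 4 * pi -> `|x| < 32.
  by move=> x /andP[h1 h2]; rewrite ltr_norml; apply/andP; split; lra.
by rewrite !inE => /or4P[/eqP->|/eqP->|/eqP->|/orP[/eqP->|/eqP->]]; apply: E; apply/andP; split; lra.
Qed.

(** For each c, one of its five angles b satisfies |z - c| >= r |t - b| / 4; the other four only
    enlarge the right-hand side. *)
Lemma angles_sum cs (r t : R) : 0 < r -> 0 <= t < 2 * pi -> t \notin angles cs ->
  polar r t \notin cs /\
  \sum_(c <- cs) (normc (polar r t - c))^-1 <= 4 / r * \sum_(b <- angles cs) `|t - b|^-1.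
Proof.
move=> r0 ht; have ht' : 0 <= t <= 2 * pi by have /andP[-> /ltW] := ht.
elim: cs => [_|c cs IH]; first by rewrite !big_nil mulr0.
have -> : angles (c :: cs) = angle_centers (arg c) ++ angles cs by [].
have [/andP[a0 /ltW a1] ca] := argP c; move: (arg c) a0 a1 ca => a a0 a1 ca.
have [|b ba hb] := @sin_angle_ge t a ht'; first by rewrite a0.
rewrite mem_cat negb_or => /andP[tc /IH[hcs Ics]].
have tb : 0 < `|t - b|.
  by rewrite normr_gt0 subr_eq0; apply: contra tc => /eqP ->.
have D : r * (`|t - b| / 4) <= normc (polar r t - c).
  by apply: le_trans (polar_dist_sin t (ltW r0) ca); rewrite ler_pM2l.
have D0 : 0 < r * (`|t - b| / 4) by rewrite mulr_gt0// divr_gt0.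
split.
  rewrite inE negb_or hcs andbT -subr_eq0 -normc_gt0; exact: lt_le_trans D.
rewrite big_cons big_cat mulrDr; apply: lerD => //.
apply: (@le_trans _ _ (4 / r * `|t - b|^-1)).
  apply: (@le_trans _ _ (r * (`|t - b| / 4))^-1); first by rewrite lef_pV2 ?posrE// (lt_le_trans D0).
  have rn : r != 0 by rewrite gt_eqF.
  have tn : `|t - b| != 0 by rewrite gt_eqF.
  suff -> : (r * (`|t - b| / 4))^-1 = 4 / r * `|t - b|^-1 by [].
  by field; rewrite rn tn.
rewrite ler_pM2l ?divr_gt0// (big_rem b)//= lerDl.
by apply: sumr_ge0 => q _; rewrite invr_ge0.
Qed.

Lemma radii_sum cs (z : C) : normc z \notin [seq normc c | c <- cs] ->
  z \notin cs /\
  \sum_(c <- cs) (normc (z - c))^-1 <= \sum_(a <- [seq normc c | c <- cs]) `|normc z - a|^-1.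
Proof.
move=> zn; split; first by apply: contra zn => zc; exact: (map_f (@normc R) zc).
rewrite big_map big_seq [leRHS]big_seq; apply: ler_sum => c cc.
have nz : 0 < `|normc z - normc c|.
  rewrite normr_gt0 subr_eq0; apply: contra zn => /eqP ->; exact: (map_f (@normc R) cc).
have h : `|normc z - normc c| <= normc (z - c).
  rewrite ler_norml lerB_normc andbT lerNl opprB normcB; exact: lerB_normc.
by rewrite lef_pV2 ?posrE// (lt_le_trans nz).
Qed.

End Scales.

(** * Summation of the exceptional sets over dyadic scales *)

Section ExceptionalSets.
Variable R : realType.
Local Notation mu := (@lebesgue_measure R).

Lemma geometric_bound (a q : R) n : 0 <= a -> 0 <= q -> q < 1 ->
  \sum_(0 <= i < n) a * q ^+ i <= a / (1 - q).
Proof.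
move=> a0 q0 q1; have p : 0 < 1 - q by lra.
have E : (\sum_(0 <= i < n) a * q ^+ i) * (1 - q) = a - a * q ^+ n.
  elim: n => [|n IH]; first by rewrite big_geq// mul0r expr0 mulr1 subrr.
  by rewrite big_nat_recr//= mulrDl IH exprSr; ring.
by rewrite ler_pdivlMr// E lerBlDr lerDl mulr_ge0// exprn_ge0.
Qed.

Lemma scale_series (u : nat -> \bar R) (c a : R) J : 0 <= c -> 0 < a ->
  (forall i, (0 <= u i)%E) -> (forall i, (u i <= (c * scale R (i + J) `^ a)%:E)%E) ->
  (\sum_(0 <= i <oo) u i < +oo)%E.
Proof.
move=> c0 a0 u0 hu; pose q : R := 2^-1 `^ a.
have q0 : 0 <= q by exact: powR_ge0.
have q1 : q < 1.
  have l2 : a * ln (2^-1) < 0.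
    by rewrite pmulr_rlt0// lnV ?posrE// oppr_lt0; apply: lt_le_trans (ln2_ge R).
  by rewrite /q /powR gt_eqF ?invr_gt0//; move: l2; rewrite -ltr_expR expR0.
have b0 : 0 <= c * q ^+ J by rewrite mulr_ge0// exprn_ge0.
apply: (@le_lt_trans _ _ ((c * q ^+ J) / (1 - q))%:E); last exact: ltry.
apply: lime_le; first by apply: is_cvg_nneseries => n _ _; exact: u0.
apply: nearW => n; apply: (@le_trans _ _ ((\sum_(0 <= i < n) (c * q ^+ J) * q ^+ i)%:E)).
  rewrite -sumEFin; apply: lee_sum => i _; apply: (le_trans (hu i)).
  by rewrite lee_fin scale_powR exprD mulrA mulrAC.
by rewrite lee_fin; exact: geometric_bound.
Qed.

Lemma nneseries_ge_term (u : nat -> \bar R) i : (forall n, (0 <= u n)%E) ->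
  (u i <= \sum_(0 <= n <oo) u n)%E.
Proof.
move=> u0; apply: le_trans (nneseries_lim_ge (m := 0) i.+1 (fun n _ _ => u0 n)).
by rewrite big_nat_recr//= leeDr//; apply: sume_ge0.
Qed.

(** All radii from [scale R J] up to R' are put in, since the estimates hold only for small radii;
    this range has finite logarithmic measure. Below it, each [B i] is restricted to its own dyadic
    block. *)
Definition log_exceptional (R' : R) (J : nat) (B : nat -> set R) : set R :=
  `]0, R'[ `&` (`[scale R J, +oo[ `|`
    \bigcup_i (B i `&` `[scale R (i + J) / 2, scale R (i + J)])).

Lemma measurable_log_exceptional (R' : R) J B : (forall i, measurable (B i)) ->
  measurable (log_exceptional R' J B).
Proof.
move=> mB; apply: measurableI => //; apply: measurableU => //.
by apply: bigcupT_measurable => i; exact: measurableI.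
Qed.

(** On the dyadic block of scale s one has 1/t <= 2/s, so that block contributes at most 2 c s^a, a
    geometric sequence; above [scale R J] the integrand is bounded. *)
Lemma finite_log_measure (R' c a : R) J (B : nat -> set R) : 0 <= c -> 0 < a ->
  (forall i, measurable (B i)) ->
  (forall i, (mu (B i) <= (c * scale R (i + J) `^ (1 + a))%:E)%E) ->
  (\int[mu]_(t in `]0%R, R'[) (\1_(log_exceptional R' J B) t / t)%:E < +oo)%E.
Proof.
move=> c0 a0 mB hB; have sc := scale_gt0 R.
pose u i (t : R) : \bar R := ((2 / scale R (i + J)) * \1_(B i) t)%:E.
have s2 i : 0 <= 2 / scale R (i + J) by rewrite divr_ge0// ltW.
have u0 i t : (0 <= u i t)%E by rewrite lee_fin mulr_ge0.
have mu_ i : measurable_fun `]0, R'[ (u i).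
  by apply/measurable_EFinP; apply: measurable_funM => //; exact: measurable_indic.
have I0 : 0 <= (scale R J)^-1 by rewrite invr_ge0 ltW.
apply: (@le_lt_trans _ _ (\int[mu]_(t in `]0%R, R'[) (((scale R J)^-1)%:E + \sum_(0 <= i <oo) u i t))%E).
  apply: ge0_le_integral_any => t; rewrite /= in_itv/= => /andP[t0 tR].
    by rewrite lee_fin divr_ge0// ltW.
  have S0 : (0 <= \sum_(0 <= i <oo) u i t)%E by apply: nneseries_ge0.
  rewrite indicE; case: (boolP (t \in _)) => [/set_mem|_]; last first.
    by rewrite mul0r adde_ge0// lee_fin.
  move=> [_ [|[i _ [Bt]]]]; rewrite /= in_itv/= => /andP[h1 h2].
    rewrite -[leLHS]adde0; apply: leeD => //.
    by rewrite lee_fin mul1r lef_pV2 ?posrE.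
  rewrite -[leLHS]add0e; apply: leeD; first by rewrite lee_fin.
  apply: le_trans (nneseries_ge_term i (fun n => u0 n t)).
  rewrite /u lee_fin indicE mem_set// mulr1 mul1r -[leRHS]invrK invf_div lef_pV2 ?posrE//.
  by rewrite divr_gt0.
rewrite ge0_integralD//; last 2 first.
- by move=> t _; apply: nneseries_ge0.
- by apply: (@ge0_emeasurable_sum _ _ _ _ u xpredT).
rewrite integral_nneseries//.
apply: lte_add_pinfty.
  rewrite integral_cst//= lebesgue_measure_itv/=; case: ifP => _; last by rewrite mule0 ltry.
  by rewrite -EFinB -EFinM ltry.
have c2 : 0 <= 2 * c by rewrite mulr_ge0.
apply: (@scale_series _ (2 * c) a J c2 a0) => i; first by apply: integral_ge0.
have rn : scale R (i + J) != 0 by rewrite gt_eqF.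
apply: (@le_trans _ _ ((2 / scale R (i + J))%:E * mu (B i))%E); last first.
  apply: (@le_trans _ _ ((2 / scale R (i + J))%:E * (c * scale R (i + J) `^ (1 + a))%:E)%E).
    by apply: lee_wpmul2l => //; rewrite lee_fin.
  rewrite -EFinM lee_fin powRD ?rn ?implybT// powRr1; last exact: ltW.
  suff -> : 2 / scale R (i + J) * (c * (scale R (i + J) * scale R (i + J) `^ a)) =
    2 * c * scale R (i + J) `^ a by [].
  by move: (_ `^ a) rn => X; move: (scale R (i + J)) => s rn; field.
rewrite /u; under eq_integral do rewrite EFinM.
rewrite ge0_integralZl_EFin//; last first.
  by apply/measurable_EFinP; apply: measurable_indic; exact: mB.
apply: lee_wpmul2l; first by rewrite lee_fin.
apply: (@le_trans _ _ (\int[mu]_x (\1_(B i) x)%:E)%E); last first.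
  by rewrite integral_indic ?setIT//; exact: mB.
rewrite [leLHS]integral_mkcond; apply: ge0_le_integral_any => x _; rewrite /patch.
  by case: ifPn => // _; rewrite lee_fin.
by case: ifPn => // _; rewrite lee_fin.
Qed.

Lemma limsup_negligible (c a : R) J (B : nat -> set R) : 0 <= c -> 0 < a ->
  (forall i, measurable (B i)) ->
  (forall i, (mu (B i) <= (c * scale R (i + J) `^ a)%:E)%E) ->
  mu.-negligible (lim_sup_set B).
Proof.
move=> c0 a0 mB hB; exists (lim_sup_set B); split=> //.
  apply: bigcapT_measurable => n; apply: bigcup_measurable => i _; exact: mB.
by apply: lim_sup_set_cvg0 => //; apply: (@scale_series _ c a J).
Qed.

End ExceptionalSets.

(** * Choice of exponents and the two exceptional sets *)

Section FinalAssembly.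
Variables (R : realType) (R' rho : R) (f : R[i]^o -> R[i]^o) (sigma eps : R) (k : nat).
Local Notation C := (R[i]^o).
Local Notation mu := (@lebesgue_measure R).
Hypothesis R'0 : 0 < R'.
Hypothesis R'rho : R' < rho.
Hypothesis mf : meromorphic_on (punctured_disc rho) f.
Hypothesis ncf : ~ constant_on (punctured_disc rho) f.
Hypothesis ordf : order_at0 R' f = sigma%:E.
Hypothesis eps0 : 0 < eps.
Hypothesis k0 : (0 < k)%N.

Lemma final_bound (b : R) z r : 0 < normc z -> normc z <= r -> 0 <= b ->
  mero_norm_le (fun w => derive1n k f w / f w) z (r `^ (- b)) ->
  mero_norm_le (fun w => derive1n k f w / f w) z (1 / normc z `^ b).
Proof.
move=> z0 zr b0 [l hl hb]; exists l => //; apply: (le_trans hb).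
by rewrite div1r -powRN; exact: powR_neg_anti.
Qed.

(** Everything at one scale except the measure estimate. The last step, from eps/2 to eps, absorbs
    the constants and the k-th power. [c0] is left open because radii and angles lead to different
    constants. *)
Lemma scale_logder (c0 : R) : 0 < c0 -> exists J, forall j, (J <= j)%N ->
  exists cs : seq C, [/\ (size cs)%:R <= scale R j `^ (- (sigma + eps / 4)),
    forall c, c \in cs -> normc c <= 1 &
    forall z, scale R j / 2 <= normc z <= scale R j -> z \notin cs ->
      \sum_(c <- cs) (normc (z - c))^-1 <= c0 * scale R j `^ (- (sigma + eps / 2 + 1)) ->
      log_derivative_bound f k sigma eps z].
Proof.
move=> c00; have s0 := order_at0_ge0 ordf; have e0 := eps0.
have st : sigma < sigma + eps / 8 by lra.
have tt : sigma + eps / 8 < sigma + eps / 4 by lra.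
have [r1 /andP[r10 r11] H1] := local_logder R'0 R'rho mf ncf ordf st tt.
have kp : 0 < k%:R :> R by rewrite ltr0n.
pose a : R := k%:R * (sigma + eps / 2 + 1); pose b : R := k%:R * (sigma + 1 + eps).
have ab : a < b by rewrite /a /b ltr_pM2l//; lra.
have b0 : 0 <= b by apply: mulr_ge0; [exact: ltW|lra].
have [r2 /andP[r20 _] H2] := powR_absorb (2 * (16 * k%:R * (c0 + 1)) ^+ k) ab.
have [|J HJ] := @scale_small R (Num.min r1 r2); first by rewrite lt_min r10.
exists J => j /HJ; rewrite lt_min => /andP[jr1 jr2].
have sc := scale_gt0 R j.
have [cs [hs cs1 hz]] := H1 _ sc jr1.
exists cs; split=> // z hz1 zcs hsum.
have /andP[z1 z2] := hz1; have z0 : 0 < normc z by apply: lt_le_trans z1; rewrite divr_gt0.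
apply: (final_bound z0 z2 b0).
set r := scale R j in sc jr1 jr2 hs hz hz1 hsum z1 z2 *.
set X := r `^ (- (sigma + eps / 2 + 1)) in hsum *.
have r1' : r <= 1 by exact: scale_le1.
have X0 : 0 < X by rewrite powR_gt0.
pose K := r `^ (- (sigma + eps / 4 + 1)); have K0 : 0 <= K by exact: powR_ge0.
have KX : K <= X by apply: powR_neg_le => //; lra.
(* Since sigma >= 0, the exponent in K is at least 1. *)
have rK : r^-1 <= K.
  rewrite -powR_inv1; last exact: ltW.
  by apply: powR_neg_le => //; lra.
have l0 : 0 < c0 * X by rewrite mulr_gt0.
have lr : r^-1 <= c0 * X + K by rewrite (le_trans rK)// lerDr ltW.
have [l hl hb] := local_higher sc K0 l0 lr k0 hz hz1 zcs hsum.
exists l => //; apply: (le_trans hb); apply: le_trans (H2 _ sc jr2).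
have -> : r `^ (- a) = X ^+ k.
  by rewrite /X -powR_mulrn ?powR_ge0// -powRrM /a mulNr mulrC.
suff h : (16 * k%:R * (c0 * X + K)) ^+ k <= (16 * k%:R * (c0 + 1) * X) ^+ k.
  by rewrite -[leRHS]mulrA -[in leRHS]exprMn ler_pM2l.
have k16 : 0 < 16 * k%:R :> R by rewrite mulr_gt0.
have c1 : 0 <= c0 + 1 by lra.
have cXK : 0 <= c0 * X + K by apply: addr_ge0 => //; exact: ltW.
rewrite ler_pXn2r// ?nnegrE.
- by rewrite -[leRHS]mulrA ler_pM2l// mulrDl mul1r lerD2l.
- by apply: mulr_ge0 => //; exact: ltW.
- by apply: mulr_ge0; [apply: mulr_ge0 => //; exact: ltW|exact: ltW].
Qed.

Lemma radial_exceptional : exists (c : R) (J : nat) (B : nat -> set R), [/\ 0 <= c,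
  forall i, measurable (B i),
  forall i, (mu (B i) <= (c * scale R (i + J) `^ (1 + eps / 8))%:E)%E &
  forall i z, scale R (i + J) / 2 <= normc z <= scale R (i + J) -> ~ B i (normc z) ->
    log_derivative_bound f k sigma eps z].
Proof.
have e0 := eps0; have s0 := order_at0_ge0 ordf.
(* The full exponent: | |z| - |c| | bounds |z - c| from below without loss, and the bad radii have
   measure of order r^(1 + eps/8), small compared with r. *)
pose kappa := sigma + eps / 2 + 1.
have kN : kappa < (Num.bound kappa)%:R by apply: archi_boundP; rewrite /kappa; lra.
have e8 : 0 < eps / 8 by lra.
have [c c0 Hc] := scale_cover (sigma + eps / 4) e8 kN.
have [J HJ] := scale_logder (ltr0n R 2).
(* The shift to [J.+1] makes every index positive, as [scale_cover] requires. *)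
have : forall i, exists B : set R, [/\ measurable B,
    (mu B <= (c * scale R (i + J.+1) `^ (1 + eps / 8))%:E)%E &
    forall z, scale R (i + J.+1) / 2 <= normc z <= scale R (i + J.+1) -> ~ B (normc z) ->
    log_derivative_bound f k sigma eps z].
  move=> i; have [|cs [hs cs1 hz]] := HJ (i + J.+1)%N.
    by rewrite addnS ltnW// ltnS leq_addl.
  have j0 : (0 < i + J.+1)%N by rewrite addnS.
  have hs' : (size [seq normc c | c <- cs])%:R <= 5 * scale R (i + J.+1) `^ (- (sigma + eps / 4)).
    rewrite size_map (le_trans hs)// ler_peMl ?powR_ge0//; lra.
  have [B [mB muB HB]] := Hc _ _ j0 hs'.
  exists B; split=> //.
    have -> : 1 + eps / 8 = kappa - (sigma + eps / 4) - eps / 8 by rewrite /kappa; lra.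
    exact: muB.
  move=> z zr /HB[|zn hsum].
    move=> _ /mapP[c' /cs1 h1 ->]; have /andP[h2 h3] := zr; have h4 := scale_le1 R (i + J.+1).
    have n1 : 0 <= normc z by []. have n2 : 0 <= normc c' by [].
    by rewrite ltr_norml; apply/andP; split; lra.
  have [zcs h] := radii_sum zn.
  by apply: hz => //; exact: le_trans hsum.
move=> /choice[B HB]; exists c, J.+1, B; split; first exact: ltW.
- by move=> i; have [] := HB i.
- by move=> i; have [] := HB i.
- by move=> i; have [] := HB i.
Qed.

Lemma angular_exceptional : exists (c : R) (J : nat) (B : nat -> set R), [/\ 0 <= c,
  forall i, measurable (B i),
  forall i, (mu (B i) <= (c * scale R (i + J) `^ (eps / 8))%:E)%E &
  forall i r t, 0 <= t < 2 * pi -> scale R (i + J) / 2 <= r <= scale R (i + J) -> ~ B i t ->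
    log_derivative_bound f k sigma eps (polar r t)].
Proof.
have e0 := eps0; have s0 := order_at0_ge0 ordf.
(* One power of r less than for radii: |z - c| is compared with r times an angular distance. *)
pose kappa := sigma + eps / 2.
have kN : kappa < (Num.bound kappa)%:R by apply: archi_boundP; rewrite /kappa; lra.
have e8 : 0 < eps / 8 by lra.
have [c c0 Hc] := scale_cover (sigma + eps / 4) e8 kN.
(* 16 = 8 * 2: at scale s one has 4/r <= 8/s because r >= s/2, and the angular sum is at most 2
   s^-kappa. *)
have [J HJ] := scale_logder (ltr0n R 16).
have : forall i, exists B : set R, [/\ measurable B,
    (mu B <= (c * scale R (i + J.+1) `^ (eps / 8))%:E)%E &
    forall r t, 0 <= t < 2 * pi -> scale R (i + J.+1) / 2 <= r <= scale R (i + J.+1) -> ~ B t ->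
    log_derivative_bound f k sigma eps (polar r t)].
  move=> i; have [|cs [hs cs1 hz]] := HJ (i + J.+1)%N.
    by rewrite addnS ltnW// ltnS leq_addl.
  have j0 : (0 < i + J.+1)%N by rewrite addnS.
  have hs' : (size (angles cs))%:R <= 5 * scale R (i + J.+1) `^ (- (sigma + eps / 4)).
    by rewrite size_angles natrM ler_pM2l.
  have [B [mB muB HB]] := Hc _ _ j0 hs'.
  exists B; split=> //.
    have -> : eps / 8 = kappa - (sigma + eps / 4) - eps / 8 by rewrite /kappa; lra.
    exact: muB.
  move=> r t ht hr /HB[|tn hsum]; first by move=> b; exact: angles_bound.
  have sc := scale_gt0 R (i + J.+1).
  have /andP[r1 r2] := hr; have r0 : 0 < r by apply: lt_le_trans r1; rewrite divr_gt0.
  have [zcs h] := angles_sum r0 ht tn.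
  have nr : normc (polar r t) = r by rewrite polarE normc_circle0// ltW.
  apply: hz => //; first by rewrite nr.
  apply: (le_trans h).
  have -> : scale R (i + J.+1) `^ (- (sigma + eps / 2 + 1)) =
      scale R (i + J.+1) `^ (- kappa) / scale R (i + J.+1).
    have rn : scale R (i + J.+1) != 0 by rewrite gt_eqF.
    by rewrite opprD powRD ?rn ?implybT// powR_inv1// ltW.
  set s := scale R (i + J.+1) in sc r1 r2 hsum *; set Y := s `^ (- kappa) in hsum *.
  have q : 4 / r <= 8 / s.
    rewrite ler_pdivrMr// mulrAC ler_pdivlMr//; lra.
  have S0 : 0 <= \sum_(b <- angles cs) `|t - b|^-1.
    by apply: sumr_ge0 => b _; rewrite invr_ge0.
  have q0 : 0 <= 4 / r by rewrite divr_ge0// ltW.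
  apply: (@le_trans _ _ (8 / s * (2 * Y))); first exact: ler_pM.
  suff -> : 8 / s * (2 * Y) = 16 * (Y / s) by [].
  ring.
move=> /choice[B HB]; exists c, J.+1, B; split; first exact: ltW.
- by move=> i; have [] := HB i.
- by move=> i; have [] := HB i.
- by move=> i; have [] := HB i.
Qed.

End FinalAssembly.

Theorem corollary1 (R : realType) (R' rho : R) (f : R[i]^o -> R[i]^o)
    (sigma eps : R) (k : nat) :
  0 < R' -> R' < rho ->
  meromorphic_on (punctured_disc rho) f ->
  ~ constant_on (punctured_disc rho) f ->
  singular_point f 0 ->
  order_at0 R' f = sigma%:E ->
  0 < eps ->
  (0 < k)%N ->
  (exists E1 : set R,
    [/\ E1 `<=` `]0, R'[,
        measurable E1,
        (\int[lebesgue_measure]_(t in `]0%R, R'[) (\1_E1 t / t)%:E < +oo)%E &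
        forall z : R[i], (`]0, R'[ `\` E1) (normc z) ->
          log_derivative_bound f k sigma eps z])
  /\
  (exists E2 : set R,
    [/\ E2 `<=` `[0, 2 * pi[,
        lebesgue_measure.-negligible E2 &
        forall theta : R, (`[0, 2 * pi[ `\` E2) theta ->
          exists2 r0 : R, 0 < r0 &
            forall r : R, 0 < r < r0 ->
              log_derivative_bound f k sigma eps (polar r theta)]).
Proof.
move=> R'0 R'rho mf ncf _ ordf eps0 k0; have e8 : 0 < eps / 8 by lra.
split.
- have [c [J [B [c0 mB muB HB]]]] := radial_exceptional R'0 R'rho mf ncf ordf eps0 k0.
  exists (log_exceptional R' J B); split.
  + exact: subIsetl.
  + exact: measurable_log_exceptional.
  + exact: finite_log_measure muB.
  + move=> z [zR nE]; have z0 : 0 < normc z by move: zR; rewrite /= in_itv/= => /andP[].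
    have zJ : normc z <= scale R J.
      rewrite leNgt; apply/negP => h; apply: nE; split=> //; left.
      by rewrite /= in_itv/= andbT ltW.
    have [j Jj hj] := dyadic z0 zJ; rewrite -(subnK Jj) in hj.
    apply: (HB _ _ hj) => Bz; apply: nE; split=> //; right.
    by exists (j - J)%N => //; split=> //; rewrite /= in_itv.
- have [c [J [B [c0 mB muB HB]]]] := angular_exceptional R'0 R'rho mf ncf ordf eps0 k0.
  exists (`[0, 2 * pi[ `&` lim_sup_set B); split.
  + exact: subIsetl.
  + by apply: (negligibleS (@subIsetr _ _ _)); exact: limsup_negligible c0 e8 mB muB.
  + move=> t [ht nt].
    have : ~ lim_sup_set B t by move=> h; apply: nt.
    (* From the index n on, no [B i] contains t; the set of index i lives at scale i + J, whence the
       threshold [scale R (n + J)]. *)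
    move=> /existsNP[n /not_implyP[_ nB]].
    exists (scale R (n + J)); first exact: scale_gt0.
    move=> r /andP[r0 /ltW rn]; have [j nj hj] := dyadic r0 rn.
    have Jj : (J <= j)%N by apply: leq_trans nj; exact: leq_addl.
    rewrite -(subnK Jj) in hj; apply: (HB _ _ _ _ hj).
      by move: ht; rewrite /= in_itv.
    move=> Bt; apply: nB; exists (j - J)%N => //=.
    by rewrite leq_subRL// addnC.
Qed.
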